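(* Let $\Omega\subset\mathbb{R}^d$ be an open set of finite measure, let $\lambda_1(\Omega)<\lambda_2(\Omega)\le\dots$ be the eigenvalues (counted with multiplicity) of the operator $\mathcal H=\frac12\log(-\Delta)$ in $\Omega$ with Dirichlet condition $\varphi=0$ on $\mathbb{R}^d\setminus\Omega$, and let $N(\lambda)=\#\{k:\lambda_k(\Omega)<\lambda\}$. Then $$\lim_{\lambda\to\infty}e^{-d\lambda}N(\lambda)=\frac{1}{(2\pi)^d}\,|\Omega|\,|B_d|.$$
   Context: Here $d\ge1$ is an integer, $\Omega$ is nonempty, $|\cdot|$ of a set is Lebesgue measure, and $B_d$ is the unit ball in $\mathbb{R}^d$. The Fourier transform is $\widehat\varphi(\xi)=\int_{\mathbb{R}^d}e^{-ix\cdot\xi}\varphi(x)\,dx$, and $L^2(\Omega)$ is identified with the functions in $L^2(\mathbb{R}^d)$ vanishing on $\mathbb{R}^d\setminus\Omega$. Let $\mathbb{H}(\Omega)\subset L^2(\Omega)$ be the closure (completion) of $C_c^\infty(\Omega)$ with respect to the norm $\|\varphi\|_*$ given by $\|\varphi\|_*^2=\int_{\mathbb{R}^d}\log(e+|\xi|)\,|\widehat\varphi(\xi)|^2\,d\xi$. The quadratic form $$(\varphi,\varphi)_{\log}=\frac{1}{(2\pi)^d}\int_{\mathbb{R}^d}\log(|\xi|)\,|\widehat\varphi(\xi)|^2\,d\xi$$ (with associated sesquilinear form $(\varphi,\psi)_{\log}=\frac{1}{(2\pi)^d}\int_{\mathbb{R}^d}\log(|\xi|)\,\widehat\varphi(\xi)\overline{\widehat\psi(\xi)}\,d\xi$)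 with domain $\mathbb{H}(\Omega)$ is closed, symmetric and semibounded in $L^2(\Omega)$; $\mathcal H$ is the associated self-adjoint operator in $L^2(\Omega)$. Eigenvalues are understood weakly: $\varphi\in\mathbb{H}(\Omega)\setminus\{0\}$ is an eigenfunction with eigenvalue $\lambda$ if $(\varphi,\psi)_{\log}=\lambda\int_\Omega\varphi\overline{\psi}\,dx$ for all $\psi\in\mathbb{H}(\Omega)$. The spectrum is discrete: there is a sequence of eigenvalues $\lambda_1(\Omega)<\lambda_2(\Omega)\le\dots$, $\lambda_k(\Omega)\to\infty$, with a corresponding complete orthonormal system of eigenfunctions in $L^2(\Omega)$. *)

(* Defs.v *)
From HB Require Import structures.
From mathcomp Require Import all_boot all_order all_algebra.
From mathcomp Require Import complex.
From mathcomp Require Import all_classical all_reals all_analysis.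

Set Implicit Arguments.
Unset Strict Implicit.
Unset Printing Implicit Defensive.

Import Order.TTheory GRing.Theory Num.Theory.
Import numFieldNormedType.Exports.

Local Open Scope classical_set_scope.
Local Open Scope ring_scope.

(* R^d is the space of row vectors 'rV[R]_d, with its library topology (whose
   norm `|x| is the sup norm; the Euclidean norm is enorm below). It carries
   the product sigma-algebra, generated by the coordinates, i.e. the Borel one. *)
Definition measure_rV_display : measure_display -> measure_display.
Proof. exact. Qed.

Section measurable_rV.
Context {d} {T : measurableType d}.
Variable n : nat.

Let coors : 'I_n -> 'rV[T]_n -> T := fun i v => v ord0 i.

Let rV_set0 : g_sigma_preimage coors set0.
Proof. exact: sigma_algebra0. Qed.

Let rV_setC A : g_sigma_preimage coors A -> g_sigma_preimage coors (~` A).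
Proof. exact: sigma_algebraC. Qed.

Let rV_bigcup (F : (set 'rV[T]_n)^nat) :
  (forall i, g_sigma_preimage coors (F i)) ->
  g_sigma_preimage coors (\bigcup_i (F i)).
Proof. exact: sigma_algebra_bigcup. Qed.

HB.instance Definition _ := @isMeasurable.Build (measure_rV_display d)
  'rV[T]_n (g_sigma_preimage coors) rV_set0 rV_setC rV_bigcup.

End measurable_rV.

Lemma measurable_coord_rV d (T : measurableType d) n (i : 'I_n) :
  measurable_fun [set: 'rV[T]_n] (fun v : 'rV[T]_n => v ord0 i).
Proof.
move=> _ Y mY; rewrite setTI; apply: sub_sigma_algebra => /=.
rewrite -bigcup_seq/=; exists i => /=; first by rewrite mem_index_enum.
by exists Y => //; rewrite setTI.
Qed.

Lemma measurable_fun_rVP d1 d2 (T1 : measurableType d1) (T2 : measurableType d2)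
    n (f : T1 -> 'rV[T2]_n) :
  (forall i, measurable_fun [set: T1] (fun x => f x ord0 i)) ->
  measurable_fun [set: T1] f.
Proof.
move=> mf.
suff : g_sigma_preimage (fun i => (fun v : 'rV[T2]_n => v ord0 i) \o f)
    `<=` measurable.
  rewrite g_sigma_preimage_comp => prefS _ A mA.
  by apply: prefS; exists A.
apply: smallest_sub; first exact: sigma_algebra_measurable.
case: n => [|n] in f mf *; first by rewrite big_ord0.
rewrite -bigcup_mkord_ord; apply: bigcup_sub => i Ii.
by move=> A [B mB <-]; exact: mf.
Qed.

Section lebesgue_rV.
Context {R : realType}.

Definition cons_rV n (p : measurableTypeR R * 'rV[R]_n) : 'rV[R]_n.+1 :=
  \row_i if unlift ord0 i is Some j then p.2 ord0 j else p.1.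

Lemma measurable_cons_rV n : measurable_fun setT (@cons_rV n).
Proof.
apply: measurable_fun_rVP => i; under eq_fun do rewrite mxE.
case: unliftP => [j|] _; last exact: measurable_fst.
apply: (@measurableT_comp _ _ _ _ _ _ (fun v : 'rV[R]_n => v ord0 j)).
  exact: measurable_coord_rV.
exact: measurable_snd.
Qed.

Definition uncons_rV n (v : 'rV[R]_n.+1) : measurableTypeR R * 'rV[R]_n :=
  (v ord0 ord0, \row_j v ord0 (lift ord0 j)).

Lemma cons_rVK n : cancel (@cons_rV n) (@uncons_rV n).
Proof.
move=> [x v]; rewrite /uncons_rV mxE unlift_none; congr pair.
by apply/rowP => j; rewrite !mxE liftK.
Qed.

Lemma measurable_uncons_rV n : measurable_fun setT (@uncons_rV n).
Proof.
apply: measurable_fun_pair; first exact: measurable_coord_rV.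
apply: measurable_fun_rVP => j; under eq_fun do rewrite mxE.
exact: measurable_coord_rV.
Qed.

Lemma preimage_cons_rV n (I : 'I_n.+1 -> set R) :
  @cons_rV n @^-1` [set v : 'rV[R]_n.+1 | forall i, I i (v ord0 i)] =
  I ord0 `*` [set v : 'rV[R]_n | forall i, I (lift ord0 i) (v ord0 i)].
Proof.
apply/seteqP; split => -[x v] /= Ixv.
  split; first by have := Ixv ord0; rewrite mxE unlift_none.
  by move=> i; have := Ixv (lift ord0 i); rewrite mxE liftK.
by move=> i; rewrite mxE; case: unliftP => [j|] ->; case: Ixv.
Qed.

Lemma measurable_box n (I : 'I_n -> set R) : (forall i, measurable (I i)) ->
  measurable [set v : 'rV[R]_n | forall i, I i (v ord0 i)].
Proof.
move=> mI; rewrite (_ : [set v | _] =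
    \bigcap_i ((fun v : 'rV[R]_n => v ord0 i) @^-1` I i)); last first.
  apply/seteqP; split => v Iv i; [move=> _|]; exact: Iv.
apply: fin_bigcap_measurable; first exact: finite_finset.
move=> i _; rewrite -[X in measurable X]setTI.
by apply: measurable_coord_rV.
Qed.

Section step.
Variables (n : nat) (m : {sigma_finite_measure set 'rV[R]_n -> \bar R}).

Definition lebesgue_rV_step : set 'rV[R]_n.+1 -> \bar R :=
  pushforward (@lebesgue_measure R \x m)%E (@cons_rV n).

Let prodm := [the {measure set (measurableTypeR R * 'rV[R]_n)%type -> \bar R} of
   (@lebesgue_measure R \x m)%E].

Let step0 : lebesgue_rV_step set0 = 0%E.
Proof. by rewrite /lebesgue_rV_step /pushforward preimage_set0 (measure0 prodm). Qed.

Let step_ge0 A : (0 <= lebesgue_rV_step A)%E.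
Proof. exact: (measure_ge0 prodm). Qed.

Let step_sigma_additive : semi_sigma_additive lebesgue_rV_step.
Proof.
move=> F mF tF mUF; rewrite /lebesgue_rV_step /pushforward preimage_bigcup.
have mpre A : measurable A -> measurable (@cons_rV n @^-1` A).
  by move=> mA; rewrite -[X in measurable X]setTI; exact: measurable_cons_rV.
apply: (@measure_semi_sigma_additive _ _ _ prodm) => //.
- by move=> k; exact: mpre.
- apply/trivIsetP => /= i j _ _ ij; rewrite -preimage_setI.
  by move/trivIsetP : tF => /(_ _ _ _ _ ij) ->//; rewrite preimage_set0.
- by rewrite -preimage_bigcup; exact: mpre.
Qed.

HB.instance Definition _ := isMeasure.Build _ _ _ lebesgue_rV_step
  step0 step_ge0 step_sigma_additive.

Lemma lebesgue_rV_step_box (I : 'I_n.+1 -> set R) :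
  (forall i, measurable (I i)) ->
  lebesgue_rV_step [set v : 'rV[R]_n.+1 | forall i, I i (v ord0 i)] =
  (lebesgue_measure (I ord0) *
   m [set v : 'rV[R]_n | forall i, I (lift ord0 i) (v ord0 i)])%E.
Proof.
move=> mI; rewrite /lebesgue_rV_step /pushforward preimage_cons_rV.
apply: (@product_measure1E _ _ (measurableTypeR R) _ R (@lebesgue_measure R) m).
  exact: mI.
exact: (@measurable_box n (fun i => I (lift ord0 i))).
Qed.

Let step_sigma_finite : sigma_finite setT lebesgue_rV_step.
Proof.
have /sigma_finiteP[F [TF ndF Foo]] := sigma_finiteT (@lebesgue_measure R).
have /sigma_finiteP[G [TG ndG Goo]] := sigma_finiteT m.
exists (fun k => @uncons_rV n @^-1` (F k `*` G k)).
  rewrite -preimage_bigcup (_ : \bigcup_k _ = setT) ?preimage_setT//.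
  rewrite -setXTT TF TG predeqE => -[x y]; split.
    by move=> [k _ []/= ? ?]; split; exists k.
  move=> [/= [k _ Fkx] [l _ Gly]]; exists (maxn k l) => //; split.
  - by move: x Fkx; exact/subsetPset/ndF/leq_maxl.
  - by move: y Gly; exact/subsetPset/ndG/leq_maxr.
move=> k; have [mF Fk] := Foo k; have [mG Gk] := Goo k; split.
  rewrite -[X in measurable X]setTI; apply: measurable_uncons_rV => //.
  exact: measurableX.
rewrite /lebesgue_rV_step /pushforward -comp_preimage.
rewrite (_ : _ \o _ = id); last by apply/funext => p; exact: cons_rVK.
by rewrite preimage_id product_measure1E// lte_mul_pinfty// ge0_fin_numE//.
Qed.

HB.instance Definition _ := Measure_isSigmaFinite.Build _ _ _ lebesgue_rV_step
  step_sigma_finite.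

End step.

(* Iterated product of the one-dimensional Lebesgue measure, transported along
   R x R^n ~ R^(n+1); see lebesgue_rV_box for its value on boxes. *)
Fixpoint lebesgue_rV n : {sigma_finite_measure set 'rV[R]_n -> \bar R} :=
  match n with
  | 0 => [the {sigma_finite_measure set 'rV[R]_0 -> \bar R} of
          \d_(0 : 'rV[R]_0)]
  | n'.+1 => [the {sigma_finite_measure set 'rV[R]_n'.+1 -> \bar R} of
          lebesgue_rV_step (lebesgue_rV n')]
  end.

Lemma lebesgue_rV_box n (I : 'I_n -> set R) : (forall i, measurable (I i)) ->
  lebesgue_rV n [set v : 'rV[R]_n | forall i, I i (v ord0 i)] =
  (\prod_(i < n) lebesgue_measure (I i))%E.
Proof.
elim: n => [|n IHn] in I * => mI.
  by rewrite big_ord0 /= diracE mem_set//; case.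
rewrite big_ord_recl -(IHn (fun i => I (lift ord0 i)))//.
exact: lebesgue_rV_step_box.
Qed.

End lebesgue_rV.

Section log_laplacian.
Context {R : realType} {d : nat}.
Local Open Scope complex_scope.
Local Notation E := 'rV[R]_d.
Local Notation leb := (@lebesgue_rV R d).
Local Notation Re := (@complex.Re R).
Local Notation Im := (@complex.Im R).
Implicit Types (Omega : set E) (f g phi psi : E -> R[i]).

Definition dot (x y : E) : R := \sum_(i < d) x ord0 i * y ord0 i.

Definition enorm (x : E) : R := Num.sqrt (dot x x).

Definition unit_ball : set E := [set x | enorm x < 1].

Definition cintegral (D : set E) f : R[i] :=
  (\int[leb]_(x in D) Re (f x))%R +i*
  (\int[leb]_(x in D) Im (f x))%R.

(* Elements of L^2(R^d) are represented by functions; all the notions below are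
   insensitive to modifications on null sets. *)
Definition L2 Omega f : Prop :=
  [/\ Re \o f \in Lfun leb 2%:E, Im \o f \in Lfun leb 2%:E &
      {ae leb, forall x, ~ Omega x -> f x = 0}].

Definition L2dot Omega f g : R[i] := cintegral Omega (fun x => f x * (g x)^*).

Definition partial (s : seq 'I_d) (u : E -> R) : E -> R :=
  foldr (fun i v x => 'D_(delta_mx ord0 i) v x) u s.

Definition smooth (u : E -> R) : Prop := forall s : seq 'I_d,
  continuous (partial s u) /\
  forall i x, derivable (partial s u) x (delta_mx ord0 i).

Definition test_function Omega f : Prop :=
  [/\ smooth (Re \o f), smooth (Im \o f),
      compact (closure [set x | f x != 0]) &
      closure [set x | f x != 0] `<=` Omega].

(* On L2 Omega with Omega of finite measure this integral converges absolutely,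
   so that it is the Fourier transform on that space, without any extension. *)
Definition fourier f (xi : E) : R[i] :=
  cintegral setT (fun x => (cos (dot x xi) -i* sin (dot x xi)) * f x).

Definition norm_star f : \bar R :=
  sqrte (\int[leb]_xi
    (ln (expR 1 + enorm xi) * Normc.normc (fourier f xi) ^+ 2)%:E)%E.

(* Since log (e + |xi|) >= 1, norm_star dominates the L^2 norm, and the
   completion of the test functions is their norm_star-closure in L^2. *)
Definition HH Omega phi : Prop :=
  L2 Omega phi /\
  forall eps : R, 0 < eps -> exists2 psi, test_function Omega psi &
    (norm_star (phi \- psi)%R < eps%:E)%E.

(* The value ln 0 = 0 at xi = 0 is immaterial. *)
Definition log_form phi psi : R[i] :=
  ((2 * pi) ^- d)%:C *
  cintegral setT (fun xi =>
    (ln (enorm xi))%:C * fourier phi xi * (fourier psi xi)^*).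

Definition eigenfunction Omega (lambda : R) phi : Prop :=
  [/\ HH Omega phi, ~ {ae leb, forall x, phi x = 0} &
      forall psi, HH Omega psi ->
        log_form phi psi = lambda%:C * L2dot Omega phi psi].

Definition complete_orthonormal Omega (phi : nat -> E -> R[i]) : Prop :=
  [/\ forall k, L2 Omega (phi k),
      forall j k, L2dot Omega (phi j) (phi k) = (j == k)%:R &
      forall f, L2 Omega f -> forall eps : R, 0 < eps ->
        exists n (c : 'I_n -> R[i]),
          (\int[leb]_(x in Omega) (Normc.normc
             (f x - \sum_(k < n) c k * phi k x) ^+ 2)%:E < eps%:E)%E].

(* lambda 0, lambda 1, ... are the eigenvalues lambda_1 < lambda_2 <= ...:
   each occurs as often as its multiplicity since the eigenfunctions form a
   complete orthonormal system. *)
Definition eigenvalue_sequence Omega (lambda : nat -> R) : Prop :=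
  [/\ lambda 0%N < lambda 1%N,
      {homo lambda : j k / (j <= k)%N >-> j <= k},
      lambda @ \oo --> +oo &
      exists phi : nat -> E -> R[i], complete_orthonormal Omega phi /\
        forall k, eigenfunction Omega (lambda k) (phi k)].

End log_laplacian.

Definition counting_function {R : realType} (lambda : nat -> R) (l : R) :
    \bar R :=
  counting [set k | lambda k < l].

(* Main.v *)
(* The Riesz mean S(l) = sum_k (l - lambda_k)_+ is trapped between two
   asymptotically equal bounds and N is recovered by a Tauberian step. With
   F_k the Fourier transform of the k-th eigenfunction and p = (2 pi)^d:
   - upper bound: p lambda_k = int ln|xi| |F_k|^2 and p = int |F_k|^2
     (Plancherel), while sum_k |F_k(xi)|^2 <= |Omega| (Bessel for e^(i x xi) on
     Omega), so p S(l) <= |Omega| int (l - ln|xi|)_+ = |Omega| |B| e^(d l) / d;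
   - lower bound: for a smooth cutoff u of compact support in Omega, the form
     sum_(lambda_k < l) (l - lambda_k) |<u e^(i x xi), phi_k>|^2 dominates
     l |u|^2 - (u e^(i x xi), u e^(i x xi))_log >= |u|^2 (l - ln|xi|) - C/|xi|,
     and integrating over |xi| < e^l bounds p S(l) from below; then u tends to
     the indicator of Omega.
   - h N(l) lies between S(l) - S(l - h) and S(l + h) - S(l). *)
From HB Require Import structures.
Require Import Defs.
From mathcomp Require Import all_boot all_order all_algebra.
From mathcomp Require Import complex ring lra.
From mathcomp Require Import all_classical all_reals all_analysis.
From mathcomp Require Import measurable_realfun.

Set Implicit Arguments.
Unset Strict Implicit.
Unset Printing Implicit Defensive.

Import Order.TTheory GRing.Theory Num.Theory.
Import numFieldNormedType.Exports.

Local Open Scope classical_set_scope.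
Local Open Scope ring_scope.

(** * Lebesgue measure on row vectors *)

(** For a general open set the wave e^(i x xi) restricted to Omega is not known to lie in the form
    domain; multiplied by the cutoff u it is a test function. The constant C is (up to
    normalisation) the first moment of |u^|^2, finite because difference quotients of u are bounded
    in L^2. It depends on u, so u stays fixed while l tends to infinity and varies only afterwards.
    The logarithmic form is not nonnegative, hence an eigenfunction expansion cannot simply be
    truncated in it. Only finite partial sums occur: the energy of the remainder is bounded below by
    semiboundedness, i.e. by a multiple of its squared L^2 norm, which completeness makes small. The
    error C/|xi| says nothing near the origin. The ball |xi| < e^(l/2) is therefore given up, at a
    cost of order l e^(n l / 2), and outside it C/|xi| <= C e^(-l/2); all losses are O(e^(n l) / l).
    Plancherel's formula is needed as an equality for the eigenfunctions and as a bound for u phi_k.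
    It is derived from the explicit transform of a damping factor, the Poisson kernel. *)

Section affine.
Context {R : realType}.
Local Notation mu := (@lebesgue_measure R).

Lemma measurable_affine (r a : R) :
  measurable_fun setT (fun x : R => r * x + a).
Proof. by apply: measurable_funD => //; exact: measurable_funM. Qed.

(** By uniqueness of Lebesgue measure: the image of r times the measure under x -> r x + a has the
    right value on half-open intervals. *)
Lemma integral_affine (r a : R) (f : R -> \bar R) : 0 < r ->
  measurable_fun setT f -> (forall x, 0 <= f x)%E ->
  (r%:E * \int[mu]_x f (r * x + a)%R = \int[mu]_x f x)%E.
Proof.
move=> r0 mf f0.
pose phi := (fun x : R => r * x + a) : R -> measurableTypeR R.
have mphi : measurable_fun setT phi by exact: measurable_affine.
pose ms := mscale (NngNum (ltW r0)) mu.
have mE A : measurable A -> mu A = pushforward ms phi A.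
  apply: lebesgue_measure_unique => // _ [[u v]] _ <-.
  rewrite [RHS]/= /pushforward (_ : phi @^-1` _ = `](u - a) / r, (v - a) / r]%classic); last first.
    apply/seteqP; split => x; rewrite /phi /= !in_itv /= ltr_pdivrMr// ler_pdivlMr//;
    by rewrite ltrBlDr lerBrDr (mulrC x).
  rewrite /ms /mscale /= !lebesgue_measure_itv /= !lte_fin ltr_pM2r ?invr_gt0// ltrD2r.
  case: ifPn => _; last by rewrite mule0.
  rewrite -!EFinB -EFinM; congr EFin.
  by rewrite -mulrBl mulrCA mulfV ?gt_eqF// mulr1 opprB addrA subrK.
rewrite [RHS](@eq_measure_integral _ _ _ _ (pushforward ms phi))//; last first.
  by move=> A mA _; exact: mE.
rewrite ge0_integral_pushforward// preimage_setT ge0_integral_mscale//=.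
exact: (measurableT_comp mf mphi).
Qed.

Lemma integral_oppr (f : R -> \bar R) :
  measurable_fun setT f -> (forall x, 0 <= f x)%E ->
  (\int[mu]_x f (- x)%R = \int[mu]_x f x)%E.
Proof.
move=> mf f0.
have mN : measurable_fun setT (-%R : R -> measurableTypeR R) by exact: oppr_measurable.
rewrite [RHS](@eq_measure_integral _ _ _ _ (pushforward mu (-%R : R -> measurableTypeR R))).
  by rewrite ge0_integral_pushforward.
by move=> A mA _; rewrite /= lebesgue_measureN.
Qed.

End affine.

Section integral_rV.
Context {R : realType}.
Local Notation mu := (@lebesgue_measure R).
Local Notation leb := (@lebesgue_rV R).

Lemma integral_cons_rV n (f : 'rV[R]_n.+1 -> \bar R) :
  measurable_fun setT f -> (forall x, 0 <= f x)%E ->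
  (\int[leb n.+1]_v f v = \int[mu]_x \int[leb n]_v f (cons_rV (x, v)))%E.
Proof.
move=> mf f0.
(* The successor case of [lebesgue_rV] is by definition the image of a product measure, to which
   Tonelli's theorem applies. *)
have -> : (\int[leb n.+1]_v f v =
   \int[pushforward (mu \x leb n)%E (@cons_rV R n)]_v f v)%E by [].
rewrite ge0_integral_pushforward//; last exact: measurable_cons_rV.
rewrite preimage_setT (fubini_tonelli1 (f \o @cons_rV R n))//.
  by apply: measurableT_comp => //; exact: measurable_cons_rV.
by move=> x; exact: f0.
Qed.

Lemma measurable_cons_rV2 n (x : R) :
  measurable_fun setT (fun v : 'rV[R]_n => cons_rV (x, v)).
Proof. by apply: (measurableT_comp (@measurable_cons_rV R n)). Qed.

Lemma measurable_rowmap n (T : 'I_n -> R -> R) :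
  (forall i, measurable_fun setT (T i)) ->
  measurable_fun setT (fun v : 'rV[R]_n => (\row_i T i (v ord0 i) : 'rV[R]_n)).
Proof.
move=> mT; apply: measurable_fun_rVP => i; under eq_fun do rewrite mxE.
by apply: measurableT_comp => //; exact: measurable_coord_rV.
Qed.

Lemma rowmap_cons n (T : 'I_n.+1 -> R -> R) x (v : 'rV[R]_n) :
  \row_i T i (cons_rV (x, v) ord0 i) =
  cons_rV (T ord0 x, \row_i T (lift ord0 i) (v ord0 i)).
Proof.
by apply/rowP => i; rewrite !mxE; case: unliftP => [j|] -> /=; rewrite ?mxE.
Qed.

(** Coordinatewise change of variables with the same factor c on every axis, by induction on the
    dimension: Tonelli splits off one coordinate. Translations, dilations and the reflection are its
    instances. *)
Lemma integral_rowmap n (T : 'I_n -> R -> R) (c : R) (f : 'rV[R]_n -> \bar R) :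
  0 <= c -> (forall i, measurable_fun setT (T i)) ->
  (forall i (g : R -> \bar R), measurable_fun setT g -> (forall x, 0 <= g x)%E ->
    (c%:E * \int[mu]_x g (T i x) = \int[mu]_x g x)%E) ->
  measurable_fun setT f -> (forall x, 0 <= f x)%E ->
  ((c ^+ n)%:E * \int[leb n]_v f (\row_i T i (v ord0 i)) = \int[leb n]_v f v)%E.
Proof.
move=> c0; elim: n T f => [|n IH] T f mT hT mf f0.
  rewrite expr0 mul1e; apply: eq_integral => v _; congr f.
  by apply/rowP; case.
have mrm := @measurable_rowmap _ T mT.
rewrite !integral_cons_rV//; last exact: (measurableT_comp mf mrm).
have mg : measurable_fun setT (fun x : R => \int[leb n]_v f (cons_rV (x, v)))%E.
  apply: (measurable_fun_fubini_tonelli_F (f \o @cons_rV R n)).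
    by apply: measurableT_comp => //; exact: measurable_cons_rV.
  by move=> x; exact: f0.
rewrite -(hT ord0 (fun x => \int[leb n]_v f (cons_rV (x, v))))%E//; last first.
  by move=> x; exact: integral_ge0.
rewrite exprS EFinM -muleA; congr (_ * _)%E.
rewrite -ge0_integralZl//; last 3 first.
- apply: (measurable_fun_fubini_tonelli_F ((fun v => f (\row_i T i (v ord0 i))) \o @cons_rV R n)).
    apply: (measurableT_comp mf); apply: (measurableT_comp mrm).
    exact: measurable_cons_rV.
  by move=> x; exact: f0.
- by move=> x _; exact: integral_ge0.
- by rewrite lee_fin exprn_ge0.
apply: eq_integral => x _.
rewrite -(IH (fun i => T (lift ord0 i)) (fun v => f (cons_rV (T ord0 x, v))))//.
- congr (_ * _)%E; apply: eq_integral => v _.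
  by rewrite rowmap_cons.
- by move=> i; exact: hT.
- by apply: measurableT_comp => //; exact: measurable_cons_rV2.
Qed.

Lemma integral_translate n (a : 'rV[R]_n) (f : 'rV[R]_n -> \bar R) :
  measurable_fun setT f -> (forall x, 0 <= f x)%E ->
  (\int[leb n]_v f (v + a)%R = \int[leb n]_v f v)%E.
Proof.
move=> mf f0.
rewrite -[RHS](@integral_rowmap n (fun i x => 1 * x + a ord0 i) 1)//.
- rewrite expr1n mul1e; apply: eq_integral => v _; congr f.
  by apply/rowP => i; rewrite !mxE mul1r.
- by move=> i; exact: measurable_affine.
- by move=> i g mg g0; exact: integral_affine.
Qed.

Lemma integral_scale n (r : R) (f : 'rV[R]_n -> \bar R) : 0 < r ->
  measurable_fun setT f -> (forall x, 0 <= f x)%E ->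
  ((r ^+ n)%:E * \int[leb n]_v f (r *: v)%R = \int[leb n]_v f v)%E.
Proof.
move=> r0 mf f0.
rewrite -[RHS](@integral_rowmap n (fun i x => r * x + 0) r _ (ltW r0))//.
- congr (_ * _)%E; apply: eq_integral => v _; congr f.
  by apply/rowP => i; rewrite !mxE addr0.
- by move=> i; exact: measurable_affine.
- by move=> i g mg g0; exact: integral_affine.
Qed.

Lemma integral_oppv n (f : 'rV[R]_n -> \bar R) :
  measurable_fun setT f -> (forall x, 0 <= f x)%E ->
  (\int[leb n]_v f (- v)%R = \int[leb n]_v f v)%E.
Proof.
move=> mf f0.
rewrite -[RHS](@integral_rowmap n (fun i x => - x) 1)//.
- rewrite expr1n mul1e; apply: eq_integral => v _; congr f.
  by apply/rowP => i; rewrite !mxE.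
- by move=> i; exact: oppr_measurable.
- by move=> i g mg g0; rewrite mul1e integral_oppr.
Qed.

Lemma measurable_prod_coord n (h : 'I_n -> R -> R) :
  (forall i, measurable_fun setT (h i)) ->
  measurable_fun setT (fun v : 'rV[R]_n => \prod_i h i (v ord0 i)).
Proof.
move=> mh; apply: measurable_prod => i _.
by apply: measurableT_comp => //; exact: measurable_coord_rV.
Qed.

Lemma integral_prod_coord n (h : 'I_n -> R -> R) :
  (forall i, measurable_fun setT (h i)) -> (forall i x, 0 <= h i x) ->
  (\int[leb n]_v (\prod_i h i (v ord0 i))%:E =
   \prod_i \int[mu]_x (h i x)%:E)%E.
Proof.
elim: n h => [|n IH] h mh h0.
  rewrite big_ord0; under eq_integral do rewrite big_ord0.
  by rewrite integral_cst//= diracT mule1.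
rewrite integral_cons_rV//; last 2 first.
- by apply/measurable_EFinP; exact: measurable_prod_coord.
- by move=> x; rewrite lee_fin prodr_ge0.
rewrite big_ord_recl -(IH (fun i => h (lift ord0 i)))//.
rewrite -ge0_integralZr//; last 3 first.
- by apply/measurable_EFinP; exact: mh.
- by move=> x _; rewrite lee_fin.
- by apply: integral_ge0 => x _; rewrite lee_fin prodr_ge0.
apply: eq_integral => x _.
rewrite -ge0_integralZl//; last 3 first.
- by apply/measurable_EFinP; apply: (@measurable_prod_coord n (fun i => h (lift ord0 i))).
- by move=> v _; rewrite lee_fin prodr_ge0.
- by rewrite lee_fin.
apply: eq_integral => v _.
rewrite big_ord_recl EFinM mxE unlift_none; congr (_ * (_)%:E)%E.
by apply: eq_bigr => i _; rewrite mxE liftK.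
Qed.

End integral_rV.

(** * Cubes, balls and the Euclidean norm *)

Section geometry.
Context {R : realType} {n : nat}.
Local Notation E := 'rV[R]_n.
Local Notation mu := (@lebesgue_measure R).
Local Notation leb := (@lebesgue_rV R n).

(** Cubes with rational centre and radius 1/(m+1) are countably many. The closed ones stay in the
    set while the open ones cover it, as the cutoffs require. *)
Lemma open_cube_cover (Om : set E) : open Om -> Om !=set0 ->
  exists (c : nat -> E) (r : nat -> R),
    [/\ forall k, 0 < r k,
        forall k (y : E), (forall i, `|y ord0 i - c k ord0 i| <= r k) -> Om y &
        forall x : E, Om x -> exists k, forall i, `|x ord0 i - c k ord0 i| < r k].
Proof.
move=> oOm [x0 Omx0].
pose c (p : 'rV[rat]_n * nat) : E := \row_i ratr (p.1 ord0 i).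
pose r (p : 'rV[rat]_n * nat) : R := p.2.+1%:R^-1.
pose good p := forall y : E, (forall i, `|y ord0 i - c p ord0 i| <= r p) -> Om y.
have gx x : Om x -> exists2 p, good p & forall i, `|x ord0 i - c p ord0 i| < r p.
  move=> Omx; have /nbhs_ballP[e /= e0 eOm] : nbhs x Om by exact: open_nbhs_nbhs.
  (* Half of e, since both x and y are within one radius of the rational centre. *)
  have [m me] : exists m : nat, m.+1%:R^-1 < e / 2.
    have /ltr_add_invr[m hm] : (0 : R) < e / 2 by rewrite divr_gt0.
    by exists m; rewrite add0r in hm.
  have qex (i : 'I_n) : {q : rat | `|x ord0 i - ratr q| < m.+1%:R^-1}.
    apply: cid; have /rat_in_itvoo[q] : x ord0 i - m.+1%:R^-1 < x ord0 i + m.+1%:R^-1.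
      by rewrite ltrBlDr -addrA ltrDl addr_gt0 ?invr_gt0.
    by rewrite in_itv/= => hq; exists q; rewrite distrC ltr_distl.
  exists (\row_i projT1 (qex i), m); last first.
    by move=> i; rewrite /c /r /= !mxE; exact: (projT2 (qex i)).
  move=> y hy; apply: eOm; split => // i j; rewrite ord1 /ball /=.
  rewrite (le_lt_trans (ler_distD (ratr (projT1 (qex j))) _ _))//.
  rewrite (splitr e) ltrD//; first exact: (lt_trans (projT2 (qex j))).
  have := hy j; rewrite /c /r !mxE /= distrC => h.
  exact: (le_lt_trans h).
have [p0 gp0 _] := gx _ Omx0.
(* Codes of no cube, or of a cube that leaves the set, are sent to the admissible cube [p0]. *)
pose f k := if unpickle k is Some p then (if pselect (good p) then p else p0) else p0.
have gf k : good (f k).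
  by rewrite /f; case: unpickle => // p; case: pselect.
exists (c \o f), (r \o f); split.
- by move=> k; rewrite /r /= invr_gt0.
- by move=> k y; exact: gf.
- move=> x /gx[p gp hp]; exists (pickle p) => i.
  by rewrite /= /f pickleK; case: pselect.
Qed.

(** The sigma-algebra is generated by the coordinates, so an open set has to be exhibited as a
    countable union of boxes. *)
Lemma open_measurable_rV (Om : set E) : open Om -> measurable Om.
Proof.
move=> oOm; have [->|/set0P Om0] := eqVneq Om set0; first exact: measurable0.
have [c [r [r0 h1 h2]]] := open_cube_cover oOm Om0.
have -> : Om = \bigcup_k [set x : E | forall i, [set t | `|t - c k ord0 i| < r k] (x ord0 i)].
  apply/seteqP; split => [x /h2[k hk]|x [k _ hk]]; first by exists k.
  by apply: (h1 k) => i; exact/ltW/hk.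
apply: bigcupT_measurable => k.
apply: (@measurable_box R n (fun i => [set t | `|t - c k ord0 i| < r k])) => i.
have -> : [set t | `|t - c k ord0 i| < r k] = ball (c k ord0 i) (r k).
  by apply/seteqP; split => t; rewrite /ball /= distrC.
exact: measurable_ball.
Qed.

Lemma continuous_measurable_rV (f : E -> R) :
  continuous f -> measurable_fun setT f.
Proof.
move=> cf; apply: (measurability _ (RGenOpens.measurableE R)) => //.
move=> _ [_ [a [b ->] <-]]; apply: open_measurable_rV; rewrite setTI.
move/continuousP: cf; apply.
exact: interval_open.
Qed.

Lemma measurable_dot (y : E) : measurable_fun setT (fun x : E => dot x y).
Proof.
apply: measurable_sum => i; apply: measurable_funM => //.
exact: measurable_coord_rV.
Qed.

Lemma measurable_dot2 : measurable_fun setT (fun p : E * E => dot p.1 p.2).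
Proof.
apply: measurable_sum => i; apply: measurable_funM => //;
  
  apply: (@measurableT_comp _ _ _ _ _ _ (fun v : 'rV[R]_n => v ord0 i));
  solve [exact: measurable_coord_rV|exact: measurable_fst|exact: measurable_snd].
Qed.

Lemma measurable_enorm : measurable_fun setT (@enorm R n).
Proof.
apply: measurableT_comp => //.
  exact: continuous_measurable_fun (@sqrt_continuous R).
apply: measurable_sum => i; apply: measurable_funM => //;
  exact: measurable_coord_rV.
Qed.

Lemma dotC (x y : E) : dot x y = dot y x.
Proof. by apply: eq_bigr => i _; rewrite mulrC. Qed.

Lemma dotDl (x y z : E) : dot (x + y) z = dot x z + dot y z.
Proof. by rewrite -big_split; apply: eq_bigr => i _; rewrite mxE mulrDl. Qed.

Lemma dotZl a (x z : E) : dot (a *: x) z = a * dot x z.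
Proof. by rewrite mulr_sumr; apply: eq_bigr => i _; rewrite mxE mulrA. Qed.

Lemma dotNl (x z : E) : dot (- x) z = - dot x z.
Proof. by rewrite -scaleN1r dotZl mulN1r. Qed.

Lemma dotDr (x y z : E) : dot x (y + z) = dot x y + dot x z.
Proof. by rewrite dotC dotDl !(dotC x). Qed.

Lemma dotNr (x z : E) : dot x (- z) = - dot x z.
Proof. by rewrite dotC dotNl dotC. Qed.

Lemma dot_ge0 (x : E) : 0 <= dot x x.
Proof. by apply: sumr_ge0 => i _; rewrite -expr2 sqr_ge0. Qed.

Lemma enorm_ge0 (x : E) : 0 <= enorm x.
Proof. exact: sqrtr_ge0. Qed.

Lemma enorm_sqr (x : E) : enorm x ^+ 2 = dot x x.
Proof. by rewrite sqr_sqrtr// dot_ge0. Qed.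

Lemma coord_le_enorm (x : E) i : `|x ord0 i| <= enorm x.
Proof.
rewrite -(ler_pXn2r (_ : 0 < 2)%N)// ?nnegrE// ?enorm_ge0//.
rewrite enorm_sqr real_normK ?num_real// /dot (bigD1 i)//= -expr2 lerDl.
by apply: sumr_ge0 => j _; rewrite -expr2 sqr_ge0.
Qed.

Lemma enorm_eq0 (x : E) : enorm x = 0 -> x = 0.
Proof.
move=> x0; apply/rowP => i; rewrite mxE; apply/eqP.
by rewrite -normr_le0 -x0 coord_le_enorm.
Qed.

Lemma enormZ a (x : E) : enorm (a *: x) = `|a| * enorm x.
Proof.
by rewrite /enorm dotZl dotC dotZl mulrA -expr2 sqrtrM ?sqr_ge0// sqrtr_sqr.
Qed.

Lemma dot_le_enorm (x y : E) : dot x y <= enorm x * enorm y.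
Proof.
have [/enorm_eq0->|x0] := eqVneq (enorm x) 0.
  have -> : dot 0 y = 0 by apply: big1 => i _; rewrite mxE mul0r.
  by rewrite mulr_ge0 ?enorm_ge0.
have [/enorm_eq0->|y0] := eqVneq (enorm y) 0.
  have -> : dot x 0 = 0 by apply: big1 => i _; rewrite mxE mulr0.
  by rewrite mulr_ge0 ?enorm_ge0.
have xp : 0 < enorm x by rewrite lt_neqAle eq_sym x0 enorm_ge0.
have yp : 0 < enorm y by rewrite lt_neqAle eq_sym y0 enorm_ge0.
(* The squared length of |y| x - |x| y is 2 |x| |y| (|x| |y| - x.y), and |x| |y| > 0 can be divided
   out. *)
have := dot_ge0 (enorm y *: x - enorm x *: y).
rewrite dotDl !dotDr !dotNl !dotNr !dotZl !(dotC _ (_ *: _)) !dotZl.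
rewrite -!enorm_sqr (dotC y x) => h.
rewrite -subr_ge0 -(pmulr_rge0 _ (mulr_gt0 xp yp)).
nra.
Qed.

Lemma enormD (x y : E) : enorm (x + y) <= enorm x + enorm y.
Proof.
rewrite -(ler_pXn2r (_ : 0 < 2)%N)// ?nnegrE ?addr_ge0 ?enorm_ge0//.
rewrite enorm_sqr sqrrD !enorm_sqr dotDl !dotDr (dotC y x).
by have := dot_le_enorm x y; lra.
Qed.

Lemma measurable_enorm_lt (r : R) : measurable [set x : E | enorm x < r].
Proof.
rewrite -[X in measurable X]setTI.
have -> : [set x : E | enorm x < r] = (@enorm R n) @^-1` `]-oo, r[%classic.
  by apply/seteqP; split => x; rewrite /= in_itv.
exact: measurable_enorm.
Qed.

Lemma ball_volume_lty : (leb unit_ball < +oo)%E.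
Proof.
apply: (@le_lt_trans _ _ (leb [set x : E | forall i, `[-1, 1]%classic (x ord0 i)])).
  apply: le_measure; rewrite ?inE.
  - exact: measurable_enorm_lt.
  - by apply: (@measurable_box R n (fun=> `[-1, 1]%classic)) => i; exact: measurable_itv.
  - move=> x /= hx i; rewrite in_itv /= -ler_norml.
    exact: le_trans (coord_le_enorm _ _) (ltW hx).
rewrite (@lebesgue_rV_box R n (fun=> `[-1, 1]%classic))//.
rewrite (eq_bigr (fun=> 2%:E)); first by rewrite prodEFin ltry.
by move=> i _; rewrite lebesgue_measure_itv /= lte_fin ifT ?gtrN//; congr EFin; lra.
Qed.

Lemma ball_volumeE : leb unit_ball = (fine (leb (@unit_ball R n)))%:E.
Proof. by rewrite fineK// ge0_fin_numE ?ball_volume_lty. Qed.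

Lemma ball_volume r : 0 < r ->
  leb [set x : E | enorm x < r] = ((r ^+ n)%:E * leb unit_ball)%E.
Proof.
move=> r0; have mB := @measurable_enorm_lt.
rewrite -(setIT [set x : E | enorm x < r]) -(setIT unit_ball).
rewrite -(@integral_indic _ _ _ leb setT measurableT _ (mB r)).
rewrite -(@integral_indic _ _ _ leb setT measurableT _ (mB 1)).
rewrite -(integral_scale r0)//.
- congr (_ * _)%E; apply: eq_integral => x _.
  rewrite !indicE; set b := _ \in _; set b' := _ \in _.
  suff -> : b = b' by [].
  by apply/idP/idP; rewrite !inE /= enormZ gtr0_norm// -{2}(mulr1 r) ltr_pM2l.
- apply/measurable_EFinP; exact: measurable_indic.
Qed.
End geometry.

(** * Layer-cake evaluation of the integral of (l - ln|x|)_+ *)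

Section layer_cake.
Context {R : realType} {n : nat}.
Local Notation E := 'rV[R]_n.
Local Notation mu := (@lebesgue_measure R).
Local Notation leb := (@lebesgue_rV R n).

Lemma null_origin : (0 < n)%N -> leb [set 0] = 0%E.
Proof.
move=> n0; have -> : [set 0] = [set v : E | forall i, [set (0 : R)] (v ord0 i)].
  apply/seteqP; split => [x -> i|x hx]; first by rewrite /= mxE.
  by apply/rowP => i; rewrite mxE hx.
rewrite (@lebesgue_rV_box R n (fun=> [set (0 : R)]))//.
by rewrite (bigD1 (Ordinal n0))//= lebesgue_measure_set1 mul0e.
Qed.

(** Up to the constant the integrand is the exponential density of rate k, of total mass 1. *)
Lemma integral_expR_decay (k l : R) : 0 < k ->
  (\int[mu]_(t in `[0%R, +oo[) (expR (k * (l - t)))%:E = (expR (k * l) / k)%:E)%E.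
Proof.
move=> k0.
have -> : (expR (k * l) / k)%:E = ((expR (k * l) / k)%:E * \int[mu]_t (exponential_pdf k t)%:E)%E.
  by rewrite integral_exponential_pdf// mule1.
rewrite -ge0_integralZl//; last 3 first.
- by apply/measurable_EFinP; exact: measurable_exponential_pdf.
- by move=> x _; rewrite lee_fin exponential_pdf_ge0// ltW.
- by rewrite lee_fin divr_ge0 ?expR_ge0// ltW.
rewrite [LHS]integral_mkcond; apply: (@eq_integral _ _ _ mu) => t _.
rewrite patchE /exponential_pdf patchE; case: ifPn => _; last by rewrite mule0.
rewrite -EFinM; congr EFin.
rewrite -mulrA mulKf ?gt_eqF// -expRD; congr expR.
by rewrite mulrBr mulNr.
Qed.

(** (l - ln|x|)_+ is the length of the set of t >= 0 with |x| < e^(l - t). By Tonelli the integral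
    becomes that of the ball volumes e^(n (l - t)) |B| over t >= 0. *)
Lemma integral_log_ball (l : R) : (0 < n)%N ->
  (\int[leb]_x (Num.max 0 (l - ln (enorm x)))%:E =
   (expR (n%:R * l) / n%:R)%:E * leb unit_ball)%E.
Proof.
move=> n0.
pose A : set (measurableTypeR R * E) := [set p | 0 <= p.1 /\ enorm p.2 < expR (l - p.1)].
have mA : measurable A.
  have -> : A = (fst @^-1` `[0%R, +oo[%classic) `&`
      ((fun p : measurableTypeR R * E => enorm p.2 - expR (l - p.1)) @^-1` `]-oo, 0[%classic).
    by apply/seteqP; split => p; rewrite /A /= !in_itv /= andbT subr_lt0.
  apply: measurableI.
    rewrite -[X in measurable X]setTI.
    by apply: measurable_fst => //; exact: measurable_itv.
  rewrite -[X in measurable X]setTI.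
  suff mg : measurable_fun setT (fun p : measurableTypeR R * E => enorm p.2 - expR (l - p.1)).
    by apply: mg => //; exact: measurable_itv.
  apply: measurable_funB.
    by apply: measurableT_comp => //; exact: measurable_enorm.
  by apply: measurableT_comp => //; apply: measurable_funB.
have h1 (t : R) : (\int[leb]_x (\1_A (t, x))%:E =
   ((fun t => (expR (n%:R * (l - t)))%:E * leb unit_ball) \_ `[0%R, +oo[) t)%E.
  rewrite patchE; case: ifPn => t0.
    have {}t0 : 0 <= t by move: t0; rewrite inE /= in_itv /= andbT.
    rewrite expRM_natl -ball_volume ?expR_gt0//.
    rewrite -[X in _ = leb X]setIT -(@integral_indic _ _ _ leb setT measurableT _ (measurable_enorm_lt _)).
    apply: eq_integral => x _; rewrite !indicE; set b := _ \in _; set b' := _ \in _.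
    suff -> : b = b' by [].
    by apply/idP/idP; rewrite /A !inE /=; [case|].
  apply: integral0_eq => x _; rewrite indicE memNset// => -[/= t00 _].
  by move/negP: t0; apply; rewrite inE /= in_itv /= t00.
(* At the origin the identity fails, because ln 0 = 0 whereas the slice is the whole half-line; that
   point is a null set since n > 0. *)
have h2 (x : E) : x <> 0 ->
  (\int[mu]_t (\1_A (t, x))%:E = (Num.max 0 (l - ln (enorm x)))%:E)%E.
  move=> x0; have sx : 0 < enorm x.
    by rewrite lt_neqAle enorm_ge0 andbT eq_sym; apply/eqP => /enorm_eq0.
  transitivity (mu (`[0, l - ln (enorm x)[%classic `&` setT)).
    rewrite -integral_indic//; apply: eq_integral => t _; rewrite !indicE.
    set b := _ \in _; set b' := _ \in _; suff -> : b = b' by [].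
    apply/idP/idP; rewrite /A !inE /= in_itv /=.
      by move=> [-> /= h]; rewrite ltrBrDl -ltrBrDr -ltr_expR lnK ?posrE.
    by move=> /andP[t0 h]; split => //=; rewrite -(lnK sx) ltr_expR ltrBrDr addrC -ltrBrDr.
  rewrite setIT lebesgue_measure_itv /= lte_fin.
  by case: ltP => h; rewrite ?oppr0 ?adde0// sube0.
have mF : measurable_fun setT (fun p : measurableTypeR R * E => (\1_A p : R)%:E).
  by apply/measurable_EFinP; exact: measurable_indic.
transitivity (\int[leb]_x \int[mu]_t (\1_A (t, x))%:E)%E.
  apply: ge0_ae_eq_integral => //.
  - apply/measurable_EFinP; apply: measurable_maxr => //; apply: measurable_funB => //.
    by apply: measurableT_comp => //; exact: measurable_enorm.
  - exact: (measurable_fun_fubini_tonelli_G (fun p => (\1_A p : R)%:E)).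
  - by move=> x _; rewrite lee_fin le_max lexx.
  - by move=> x _; apply: integral_ge0 => t _; rewrite lee_fin.
  - exists [set 0]; split; [|exact: null_origin|].
      rewrite (_ : [set 0] = [set v : E | forall i, [set (0 : R)] (v ord0 i)]).
        exact: (@measurable_box R n (fun=> [set 0])).
      apply/seteqP; split => [x -> i|x hx]; first by rewrite /= mxE.
      by apply/rowP => i; rewrite mxE hx.
    by move=> x /=; apply: contra_notP => x0 _; rewrite h2.
rewrite -(fubini_tonelli (fun p => (\1_A p : R)%:E))//=.
under eq_integral do rewrite h1.
rewrite -integral_mkcond ge0_integralZr//.
- by rewrite integral_expR_decay ?ltr0n.
- apply/measurable_EFinP; apply: measurable_funTS; apply: measurableT_comp => //.
  by apply: measurable_funM => //; apply: measurable_funB.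
Qed.

End layer_cake.

(** * The Poisson kernel *)

Section ftc_helpers.
Context {R : realType}.
Local Notation mu := (@lebesgue_measure R).

Lemma is_derive_continuous (F : R -> R) (f : R -> R) :
  (forall x, is_derive x (1 : R) F (f x)) -> continuous F.
Proof.
move=> dF x; apply: differentiable_continuous; apply/derivable1_diffP.
by have [] := dF x.
Qed.

Lemma FTC_0y (F f : R -> R) (l : R) :
  (forall x, is_derive x (1 : R) F (f x)) -> continuous f ->
  (forall x, 0 <= f x) -> F x @[x --> +oo%R] --> l ->
  (\int[mu]_(x in `[0%R, +oo[) (f x)%:E = (l - F 0)%:E)%E.
Proof.
move=> dF cf f0 Fl; rewrite (@ge0_continuous_FTC2y _ f F 0 l)//.
- exact: continuous_subspaceT.
- by apply: cvg_at_right_filter; exact: (is_derive_continuous dF).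
- by move=> x _; rewrite derive1E; have [_ ->] := dF x.
Qed.

Lemma FTC_ab (F f : R -> R) (a b : R) : a < b ->
  (forall x, is_derive x (1 : R) F (f x)) -> continuous f ->
  (\int[mu]_(x in `[a, b]) (f x)%:E = (F b - F a)%:E)%E.
Proof.
move=> ab dF cf; rewrite (@continuous_FTC2 _ f F)//.
- exact: continuous_subspaceT.
- have cF := is_derive_continuous dF; split.
  + by move=> x _; have [] := dF x.
  + by apply: cvg_at_right_filter; exact: cF.
  + by apply: cvg_at_left_filter; exact: cF.
- by move=> x _; rewrite derive1E; have [_ ->] := dF x.
Qed.

(** The even integrand g contains e^(- e |t|), which has a corner at 0. The primitive F is that of a
    function f smooth on the whole line and equal to g on the half-line only. *)
Lemma integral_even (F f : R -> R) (l : R) :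
  (forall x, is_derive x (1 : R) F (f x)) -> continuous f ->
  (forall x, 0 <= f x) -> F x @[x --> +oo%R] --> l ->
  forall g : R -> R, continuous g -> (forall x, 0 <= g x) -> (forall x, g (- x) = g x) ->
  (forall x, 0 <= x -> g x = f x) ->
  (\int[mu]_x (g x)%:E = (2 * (l - F 0))%:E)%E.
Proof.
move=> dF cf f0 Fl g cg g0 ge gf.
rewrite ge0_symfun_integralT//; last by move=> x /=; rewrite ge.
rewrite EFinM -(FTC_0y dF)//; congr (_ * _)%E.
rewrite set_itvcy; apply: eq_integral => x; rewrite inE /= => x0.
by rewrite gf.
Qed.

End ftc_helpers.

Section kernel1.
Context {R : realType}.
Local Notation mu := (@lebesgue_measure R).
Implicit Types e z t : R.

Definition expk e t := expR (- e * `|t|).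
(** The Fourier transform of [expk e]: 2 pi times the Poisson kernel of the half-plane, so of mass 2
    pi for every e > 0. *)
Definition poisson e z := 2 * e / (e ^+ 2 + z ^+ 2).

Lemma poisson_ge0 e z : 0 < e -> 0 <= poisson e z.
Proof.
by move=> e0; rewrite divr_ge0 ?mulr_ge0 ?addr_ge0 ?sqr_ge0// ltW.
Qed.

Lemma den_neq0 e z : 0 < e -> e ^+ 2 + z ^+ 2 != 0.
Proof. by move=> e0; rewrite gt_eqF// ltr_pwDl ?sqr_ge0// exprn_gt0. Qed.

Lemma continuous_expk e : continuous (expk e).
Proof.
move=> t; apply: continuous_comp; last exact: continuous_expR.
by apply: continuousM; [exact: cst_continuous|exact: norm_continuous].
Qed.

Lemma cvg_bounded_exp e (b : R -> R) C : 0 < e -> (forall x, `|b x| <= C) ->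
  (expR (- e * x) * b x @[x --> +oo%R] --> (0 : R)).
Proof.
move=> e0 bC.
have h : expR (- e * x) @[x --> +oo%R] --> (0 : R).
  rewrite (_ : (fun x => expR (- e * x)) =
               (fun z => expR (- z)) \o (fun z => e * z)); last first.
    by apply/funext => x /=; rewrite mulNr.
  apply: (@cvg_comp _ _ _ _ _ _ (pinfty_nbhs R)); last exact: cvgr_expR.
  exact: gt0_cvgMry.
have hC : C * expR (- e * x) @[x --> +oo%R] --> (0 : R).
  by rewrite -[X in _ --> X](mulr0 C); apply: cvgMr.
have hC' : - (C * expR (- e * x)) @[x --> +oo%R] --> (0 : R).
  by rewrite -oppr0; exact: cvgN.
apply: (squeeze_cvgr _ hC' hC); near=> x.
rewrite -ler_norml normrM gtr0_norm ?expR_gt0// mulrC.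
by rewrite ler_pM2r ?expR_gt0.
Unshelve. all: by end_near. Qed.

(** Adding 1 to the cosine makes the integrand nonnegative, as the fundamental theorem on a
    half-line requires; [Rint_cosk] subtracts the extra term again. F is the explicit primitive that
    vanishes at infinity. *)
Lemma integral_cosexp e z : 0 < e ->
  (\int[mu]_t ((1 + cos (z * t)) * expk e t)%:E =
   (2 / e + poisson e z)%:E)%E.
Proof.
move=> e0; have d0 := den_neq0 z e0.
pose F t := expR (- e * t) * (- e^-1 + (z * sin (z * t) - e * cos (z * t)) / (e ^+ 2 + z ^+ 2)).
pose f t := (1 + cos (z * t)) * expR (- e * t).
have cle (x : R) : 0 <= 1 + cos x by have := cos_geN1 x; lra.
have dF (x : R) : is_derive x (1 : R) F (f x).
  apply: is_derive_eq.
  rewrite /GRing.scale /=.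
  by rewrite /f; field; rewrite d0 gt_eqF.
have ccos : continuous (fun t => 1 + cos (z * t)).
  by apply: (@is_derive_continuous _ _ (fun t => - sin (z * t) * z)) => x; apply: is_derive_eq; rewrite /GRing.scale /=; ring.
have cf : continuous f.
  apply: (@is_derive_continuous _ _ (fun t => - (z * sin (z * t) + e * (1 + cos (z * t))) * expR (- e * t))) => x.
  by rewrite /f; apply: is_derive_eq; rewrite /GRing.scale /=; ring.
rewrite (integral_even dF (l := 0)).
- congr EFin; rewrite /F /poisson !mulr0 expR0 sin0 cos0 mulr0 sub0r mul1r mulr1.
  by field; rewrite d0 gt_eqF.
- exact: cf.
- by move=> x; rewrite mulr_ge0 ?expR_ge0.
- apply: (@cvg_bounded_exp _ _ (e^-1 + (`|z| + e) / (e ^+ 2 + z ^+ 2))) => // x.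
  rewrite (le_trans (ler_normD _ _))// normrN gtr0_norm ?invr_gt0// lerD2l.
  rewrite normrM [X in _ * X]ger0_norm ?invr_ge0 ?addr_ge0 ?sqr_ge0//.
  rewrite ler_wpM2r ?invr_ge0 ?addr_ge0 ?sqr_ge0//.
  rewrite (le_trans (ler_normB _ _))// !normrM (gtr0_norm e0).
  by rewrite lerD// ler_piMr// ?(ltW e0)// ?sin_max ?cos_max.
- move=> x; apply: (@continuousM R R (fun t => 1 + cos (z * t)) (expk e)).
    exact: ccos.
  exact: continuous_expk.
- by move=> x; rewrite mulr_ge0 ?expR_ge0.
- by move=> x; rewrite mulrN cosN /expk normrN.
- by move=> x x0; rewrite /f /expk ger0_norm.
Qed.

Lemma integral_expk e : 0 < e -> (\int[mu]_t (expk e t)%:E = (2 / e)%:E)%E.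
Proof.
move=> e0; have h := integral_cosexp 0 e0.
have : (\int[mu]_t (2%:E * (expk e t)%:E) = (2 / e + poisson e 0)%:E)%E.
  rewrite -h; apply: eq_integral => t _.
  by rewrite mul0r cos0 EFinM.
rewrite ge0_integralZl//; last 2 first.
- apply/measurable_EFinP; apply: continuous_measurable_fun; exact: continuous_expk.
- by move=> t _; rewrite lee_fin expR_ge0.
have -> : poisson e 0 = 2 / e.
  by rewrite /poisson expr0n addr0; field; rewrite gt_eqF.
case: (integral _ _ _) => [r| |].
- by rewrite -EFinM => -[]hr; congr EFin; lra.
- by rewrite mulry gtr0_sg// mul1e.
- by rewrite mulrNy gtr0_sg// mul1e.
Qed.

Lemma measurable_expk e : measurable_fun setT (expk e).
Proof. apply: continuous_measurable_fun; exact: continuous_expk. Qed.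

Lemma continuous_poisson e : 0 < e -> continuous (poisson e).
Proof.
move=> e0 x; rewrite /poisson.
apply: (@continuousM R R (cst (2 * e)) (fun z => (e ^+ 2 + z ^+ 2)^-1)).
  exact: cst_continuous.
apply: continuousV; first exact: den_neq0.
apply: continuousD; first exact: cst_continuous.
exact: exprn_continuous.
Qed.

Lemma continuous_poisson_sub e x : 0 < e -> continuous (fun y => poisson e (x - y)).
Proof.
move=> e0 y; apply: (@continuous_comp _ _ _ (fun y => x - y) (poisson e)).
  by apply: (@continuousB _ R^o R^o (cst x) id); [exact: cst_continuous|exact: cvg_id].
exact: continuous_poisson.
Qed.

Lemma measurable_poisson e : 0 < e -> measurable_fun setT (poisson e).
Proof. by move=> e0; apply: continuous_measurable_fun; exact: continuous_poisson. Qed.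

Lemma is_derive_atan_poisson e x y : 0 < e ->
  is_derive y (1 : R) (fun y => 2 * atan ((y - x) / e)) (poisson e (x - y)).
Proof.
move=> e0; apply: is_derive_eq.
rewrite /GRing.scale /poisson /=.
have := den_neq0 (x - y) e0.
have e1 : e != 0 by rewrite gt_eqF.
have h2 : 1 + ((y - x) / e) ^+ 2 != 0 by rewrite gt_eqF// ltr_pwDl ?sqr_ge0.
have -> : 1 + ((y - x) / e) ^+ 2 = (e ^+ 2 + (x - y) ^+ 2) / e ^+ 2 by field.
by move=> h; field; rewrite e1 h.
Qed.

Lemma integral_poisson e : 0 < e ->
  (\int[mu]_z (poisson e z)%:E = (2 * pi)%:E)%E.
Proof.
move=> e0.
rewrite (integral_even (fun y => is_derive_atan_poisson 0 y e0) (l := pi)).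
- by congr EFin; rewrite subrr mul0r atan0 mulr0 subr0.
- exact: continuous_poisson_sub.
- by move=> x; exact: poisson_ge0.
- rewrite (_ : pi = 2 * (pi / 2)); last by field.
  apply: cvgMr; apply: cvg_comp; last exact: cvgy_atan.
  rewrite (_ : (fun _ => _) = (fun y => e^-1 * y)).
    have ei : 0 < e^-1 by rewrite invr_gt0.
    exact: gt0_cvgMry.
  by apply/funext => y; rewrite subr0 mulrC.
- exact: continuous_poisson.
- by move=> x; exact: poisson_ge0.
- by move=> x; rewrite /poisson sqrrN.
- by move=> x _; rewrite /poisson sub0r sqrrN.
Qed.

Lemma integral_poisson_itv e x a b : 0 < e -> a < b ->
  (\int[mu]_(y in `[a, b]) (poisson e (x - y))%:E =
   (2 * atan ((b - x) / e) + 2 * atan ((x - a) / e))%:E)%E.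
Proof.
move=> e0 ab.
rewrite (FTC_ab ab (fun y => is_derive_atan_poisson x y e0))//.
- by congr EFin; rewrite -(opprB x a) mulNr atanN mulrN opprK.
- exact: continuous_poisson_sub.
Qed.

End kernel1.

(** * Integrable real functions *)

Section real_integrals.
Context {R : realType} {dp : measure_display} {T : measurableType dp}.
Variable mu : {measure set T -> \bar R}.
Implicit Types f g u v : T -> R.

Definition itg f := mu.-integrable setT (EFin \o f).

Lemma itg_meas f : itg f -> measurable_fun setT f.
Proof. by move=> /integrableP[/measurable_EFinP]. Qed.

Lemma itg_le f g : measurable_fun setT f -> (forall x, `|f x| <= g x) -> itg g -> itg f.
Proof.
move=> mf fg ig; apply: (le_integrable measurableT _ _ ig).
  exact/measurable_EFinP.
by move=> x _ /=; rewrite lee_fin; exact: le_trans (fg x) (ler_norm _).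
Qed.

Lemma itg_eq f g : f =1 g -> itg f -> itg g.
Proof. by move=> /funext ->. Qed.

Lemma itgD f g : itg f -> itg g -> itg (fun x => f x + g x).
Proof. by move=> hf hg; exact: (integrableD measurableT hf hg). Qed.

Lemma itgZ c f : itg f -> itg (fun x => c * f x).
Proof. by move=> hf; exact: (integrableZl measurableT c hf). Qed.

Lemma itgN f : itg f -> itg (fun x => - f x).
Proof. by move=> hf; apply: itg_eq (itgZ (-1) hf) => x; rewrite mulN1r. Qed.

Lemma itgB f g : itg f -> itg g -> itg (fun x => f x - g x).
Proof. by move=> hf hg; apply: itgD => //; exact: itgN. Qed.

Lemma itg0 : itg (fun=> 0).
Proof. exact: integrable0. Qed.

Lemma itg_norm f : itg f -> itg (fun x => `|f x|).
Proof.
move=> hf; apply: (le_integrable measurableT _ _ hf).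
  by apply/measurable_EFinP; apply: measurableT_comp => //; exact: itg_meas.
by move=> x _ /=; rewrite lee_fin normr_id.
Qed.

Lemma itg_sum (I : Type) (s : seq I) (F : I -> T -> R) :
  (forall i, itg (F i)) -> itg (fun x => \sum_(i <- s) F i x).
Proof.
move=> hF; elim: s => [|i s IH].
  by apply: itg_eq itg0 => x; rewrite big_nil.
by apply: itg_eq (itgD (hF i) IH) => x; rewrite big_cons.
Qed.

Lemma itg_bM C f g : measurable_fun setT f -> (forall x, `|f x| <= C) -> itg g ->
  itg (fun x => f x * g x).
Proof.
move=> mf fC ig; apply: (@itg_le _ (fun x => C * `|g x|)).
- by apply: measurable_funM => //; exact: itg_meas.
- by move=> x; rewrite normrM ler_wpM2r.
- by apply: itgZ; exact: itg_norm.
Qed.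

Lemma itg_sqrD u v : measurable_fun setT u -> measurable_fun setT v ->
  itg (fun x => u x ^+ 2) -> itg (fun x => v x ^+ 2) -> itg (fun x => (u x + v x) ^+ 2).
Proof.
move=> mu_ mv iu iv; apply: (@itg_le _ (fun x => 2 * (u x ^+ 2 + v x ^+ 2))).
- by apply: measurable_funX; exact: measurable_funD.
- move=> x; rewrite ger0_norm ?sqr_ge0//.
  by have := sqr_ge0 (u x - v x); nra.
- by apply: itgZ; exact: itgD.
Qed.

Lemma itg_fin f : itg f -> (\int[mu]_x (f x)%:E = (\int[mu]_x f x)%:E)%E.
Proof. by move=> hf; rewrite /Rintegral fineK//; exact: (integrable_fin_num measurableT hf). Qed.

Lemma itg_lty f : measurable_fun setT f -> (forall x, 0 <= f x) ->
  (\int[mu]_x (f x)%:E < +oo)%E -> itg f.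
Proof.
move=> mf f0 foo; apply/integrableP; split; first exact/measurable_EFinP.
by under eq_integral do rewrite /= ger0_norm//.
Qed.

Lemma itg_fin_lty f : itg f -> (\int[mu]_x (f x)%:E < +oo)%E.
Proof. by move=> hf; rewrite itg_fin// ltry. Qed.

Lemma Rint_le f g : itg f -> itg g -> (forall x, f x <= g x) ->
  \int[mu]_x f x <= \int[mu]_x g x.
Proof. by move=> hf hg fg; apply: le_Rintegral. Qed.

Lemma Rint_ext f g : f =1 g -> \int[mu]_x f x = \int[mu]_x g x.
Proof. by move=> /funext ->. Qed.

Lemma RintD f g : itg f -> itg g ->
  \int[mu]_x (f x + g x) = \int[mu]_x f x + \int[mu]_x g x.
Proof. by move=> hf hg; exact: RintegralD. Qed.

Lemma RintB f g : itg f -> itg g ->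
  \int[mu]_x (f x - g x) = \int[mu]_x f x - \int[mu]_x g x.
Proof. by move=> hf hg; exact: RintegralB. Qed.

Lemma RintZ c f : itg f -> \int[mu]_x (c * f x) = c * \int[mu]_x f x.
Proof. by move=> hf; exact: RintegralZl. Qed.

Lemma RintZr c f : itg f -> \int[mu]_x (f x * c) = \int[mu]_x f x * c.
Proof. by move=> hf; exact: RintegralZr. Qed.

Lemma Rint_sum (I : Type) (s : seq I) (F : I -> T -> R) :
  (forall i, itg (F i)) ->
  \int[mu]_x (\sum_(i <- s) F i x) = \sum_(i <- s) \int[mu]_x F i x.
Proof.
move=> hF; elim: s => [|i s IH].
  rewrite big_nil; under Rint_ext do rewrite big_nil.
  by rewrite /Rintegral integral0.
rewrite big_cons -IH -RintD//; last exact: itg_sum.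
by apply: Rint_ext => x; rewrite big_cons.
Qed.

Lemma fatou_bound (F : nat -> T -> R) f (C : \bar R) :
  (forall m, measurable_fun setT (F m)) -> (forall m x, 0 <= F m x) ->
  (forall x, F ^~ x @ \oo --> f x) ->
  (forall m, \int[mu]_x (F m x)%:E <= C)%E -> (\int[mu]_x (f x)%:E <= C)%E.
Proof.
move=> mF F0 Ff FC.
have -> : (\int[mu]_x (f x)%:E = \int[mu]_x limn_einf (fun m => (F m x)%:E))%E.
  apply: eq_integral => x _.
  have h : ((F m x)%:E @[m --> \oo] --> (f x)%:E)%E by apply: cvg_EFin (Ff x); exact: nearW.
  by have [-> _] := cvg_limn_einf_sup h.
apply: (le_trans (fatou _ _ _ _)) => //.
- by move=> m; exact/measurable_EFinP.
- by move=> m x _; rewrite lee_fin.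
- rewrite limn_einf_lim; apply: lime_le; first exact: is_cvg_einfs.
  apply: nearW => m; apply: le_trans (FC m).
  by apply: ereal_inf_lbound; exists m => /=.
Qed.

Lemma dominated_Rint (F : nat -> T -> R) f g :
  (forall m, measurable_fun setT (F m)) -> measurable_fun setT f ->
  (forall x, F ^~ x @ \oo --> f x) -> itg g ->
  (forall m x, `|F m x| <= g x) ->
  (\int[mu]_x F m x @[m --> \oo] --> \int[mu]_x f x).
Proof.
move=> mF mf Ff ig Fg.
have [] := @dominated_convergence _ _ _ mu setT measurableT
  (fun m x => (F m x)%:E) (EFin \o f) (EFin \o g).
- by move=> m; exact/measurable_EFinP.
- exact/measurable_EFinP.
- by apply: aeW => x _; apply: cvg_EFin (Ff x); exact: nearW.
- exact: ig.
- by apply: aeW => x m _; rewrite /= lee_fin.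
move=> itf _ h.
by apply: fine_cvg; rewrite -(itg_fin itf).
Qed.

End real_integrals.

Section real_fubini.
Context {R : realType} {d1 d2 : measure_display} {T1 : measurableType d1} {T2 : measurableType d2}.
Variables (m1 : {sigma_finite_measure set T1 -> \bar R}) (m2 : {sigma_finite_measure set T2 -> \bar R}).
Local Notation pm := (m1 \x m2)%E.

(** Integrability of every section lets the inner extended-valued integral be replaced by its real
    value at each point. *)
Lemma itg_prodE (f : T1 * T2 -> R) : itg pm f -> (forall x, itg m2 (fun y => f (x, y))) ->
  \int[pm]_p f p = \int[m1]_x \int[m2]_y f (x, y).
Proof.
move=> hf hx; rewrite [LHS]/Rintegral -(integral12_prod_meas1 hf).
rewrite /Rintegral; congr fine; apply: eq_integral => x _.
by rewrite /fubini_F /= itg_fin.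
Qed.

Lemma itg_prodE2 (f : T1 * T2 -> R) : itg pm f -> (forall y, itg m1 (fun x => f (x, y))) ->
  \int[pm]_p f p = \int[m2]_y \int[m1]_x f (x, y).
Proof.
move=> hf hy; rewrite [LHS]/Rintegral -(integral21_prod_meas1 hf).
rewrite /Rintegral; congr fine; apply: eq_integral => y _.
by rewrite /fubini_G /= itg_fin.
Qed.

Lemma itg_tensor f g : itg m1 f -> itg m2 g -> itg pm (fun p => f p.1 * g p.2).
Proof.
move=> hf hg.
have mfg : measurable_fun setT (fun p : T1 * T2 => f p.1 * g p.2).
  apply: measurable_funM.
    by apply: measurableT_comp; [exact: itg_meas hf|exact: measurable_fst].
  by apply: measurableT_comp; [exact: itg_meas hg|exact: measurable_snd].
apply/integrable12ltyP; first exact/measurable_EFinP.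
under eq_integral do under eq_integral do rewrite /= normrM EFinM.
under eq_integral.
  move=> x _; rewrite ge0_integralZl//=; last first.
    by apply/measurable_EFinP; apply: measurableT_comp => //; exact: itg_meas hg.
  over.
rewrite /= ge0_integralZr//=.
- rewrite itg_fin; last exact: itg_norm.
  by rewrite itg_fin; [rewrite -EFinM ltry|exact: itg_norm].
- by apply/measurable_EFinP; apply: measurableT_comp => //; exact: itg_meas hf.
- exact: integral_ge0.
Qed.

Lemma Rint_tensor f g : itg m1 f -> itg m2 g ->
  \int[pm]_p (f p.1 * g p.2) = \int[m1]_x f x * \int[m2]_y g y.
Proof.
move=> hf hg; rewrite itg_prodE/=; last 2 first.
- exact: itg_tensor.
- by move=> x; exact: itgZ.
rewrite -RintZr//; apply: Rint_ext => x /=.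
by rewrite RintZ.
Qed.

End real_fubini.

(** * The Poisson kernel in several variables, as a product over the coordinates *)

Section kerneln.
Context {R : realType}.
Local Notation mu := (@lebesgue_measure R).
Local Notation leb := (@lebesgue_rV R).

Definition expK n (e : R) (v : 'rV[R]_n) := \prod_i expk e (v ord0 i).
Definition poissonK n (e : R) (v : 'rV[R]_n) := \prod_i poisson e (v ord0 i).

Lemma expk_le1 (e t : R) : 0 < e -> expk e t <= 1.
Proof. by move=> e0; rewrite expR_le1 mulNr oppr_le0 mulr_ge0// ltW. Qed.

Lemma expK_ge0 n e (v : 'rV[R]_n) : 0 <= expK e v.
Proof. by apply: prodr_ge0 => i _; exact: expR_ge0. Qed.

Lemma expK_le1 n e (v : 'rV[R]_n) : 0 < e -> expK e v <= 1.
Proof.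
by move=> e0; apply: prodr_ile1 => i _; rewrite expR_ge0 expk_le1.
Qed.

Lemma poissonK_ge0 n e (v : 'rV[R]_n) : 0 < e -> 0 <= poissonK e v.
Proof. by move=> e0; apply: prodr_ge0 => i _; exact: poisson_ge0. Qed.

Lemma measurable_expK n e : measurable_fun setT (@expK n e).
Proof. by apply: (@measurable_prod_coord R n (fun=> expk e)) => i; exact: measurable_expk. Qed.

Lemma measurable_poissonK n e : 0 < e -> measurable_fun setT (@poissonK n e).
Proof. by move=> e0; apply: (@measurable_prod_coord R n (fun=> poisson e)) => i; exact: measurable_poisson. Qed.

Lemma itg_expk e : 0 < e -> itg mu (expk e).
Proof.
move=> e0; apply: itg_lty => //; first exact: measurable_expk.
  by move=> t; exact: expR_ge0.
by rewrite integral_expk// ltry.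
Qed.

Lemma itg_expK n e : 0 < e -> itg (leb n) (@expK n e).
Proof.
move=> e0; apply: itg_lty; first exact: measurable_expK.
  exact: expK_ge0.
rewrite (@integral_prod_coord R n (fun=> expk e)).
- rewrite (eq_bigr (fun=> (2 / e)%:E)); first by rewrite prodEFin ltry.
  by move=> i _; rewrite integral_expk.
- by move=> i; exact: measurable_expk.
- by move=> i t; exact: expR_ge0.
Qed.

Lemma integral_poissonK n e : 0 < e ->
  (\int[leb n]_v (poissonK e v)%:E = ((2 * pi) ^+ n)%:E)%E.
Proof.
move=> e0; rewrite (@integral_prod_coord R n (fun=> poisson e)).
- rewrite (eq_bigr (fun=> (2 * pi)%:E)) ?prodEFin ?prodr_const ?card_ord//.
  by move=> i _; rewrite integral_poisson.
- by move=> i; exact: measurable_poisson.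
- by move=> i t; exact: poisson_ge0.
Qed.

Lemma measurable_cosM (z : R) : measurable_fun setT (fun t : R => cos (z * t)).
Proof.
apply: continuous_measurable_fun => t; apply: (@continuous_comp _ _ _ ( *%R z) cos).
  exact: mulrl_continuous.
exact: continuous_cos.
Qed.

Lemma measurable_sinM (z : R) : measurable_fun setT (fun t : R => sin (z * t)).
Proof.
apply: continuous_measurable_fun => t; apply: (@continuous_comp _ _ _ ( *%R z) sin).
  exact: mulrl_continuous.
exact: continuous_sin.
Qed.

Lemma cos_le1 (x : R) : `|cos x| <= 1. Proof. exact: cos_max. Qed.
Lemma sin_le1 (x : R) : `|sin x| <= 1. Proof. exact: sin_max. Qed.

Lemma itg_cosk e z : 0 < e -> itg mu (fun t => cos (z * t) * expk e t).
Proof.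
move=> e0; apply: (itg_bM (C := 1)); last exact: itg_expk.
  exact: measurable_cosM.
by move=> t; exact: cos_le1.
Qed.

Lemma itg_sink e z : 0 < e -> itg mu (fun t => sin (z * t) * expk e t).
Proof.
move=> e0; apply: (itg_bM (C := 1)); last exact: itg_expk.
  exact: measurable_sinM.
by move=> t; exact: sin_le1.
Qed.

Lemma Rint_cosk e z : 0 < e -> \int[mu]_t (cos (z * t) * expk e t) = poisson e z.
Proof.
move=> e0.
have h : \int[mu]_t ((1 + cos (z * t)) * expk e t) = 2 / e + poisson e z.
  by rewrite /Rintegral integral_cosexp.
have h' : \int[mu]_t expk e t = 2 / e by rewrite /Rintegral integral_expk.
move: h; under Rint_ext do rewrite mulrDl mul1r.
by rewrite RintD ?h'//; [exact: addrI|exact: itg_expk|exact: itg_cosk].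
Qed.

(** Oddness. As [integral_oppr] speaks of nonnegative integrands, it is applied to (1 + sin) times
    the weight. *)
Lemma Rint_sink e z : 0 < e -> \int[mu]_t (sin (z * t) * expk e t) = 0.
Proof.
move=> e0.
have m1 : measurable_fun setT (fun t => (1 + sin (z * t)) * expk e t).
  apply: measurable_funM; last exact: measurable_expk.
  by apply: measurable_funD => //; exact: measurable_sinM.
have := @integral_oppr R (fun t => ((1 + sin (z * t)) * expk e t)%:E).
move=> /(_ _ _)/(congr1 fine) H.
have {}H : \int[mu]_t (expk e t - sin (z * t) * expk e t) =
           \int[mu]_t (expk e t + sin (z * t) * expk e t).
  transitivity (\int[mu]_t ((1 + sin (z * t)) * expk e t)); last first.
    by apply: Rint_ext => t; rewrite mulrDl mul1r.
  rewrite [RHS]/Rintegral -H; last 2 first.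
  - exact/measurable_EFinP.
  - by move=> x; rewrite lee_fin mulr_ge0 ?expR_ge0//; have := sin_geN1 (z * x); lra.
  congr fine; apply: eq_integral => t _; congr EFin.
  by rewrite mulrN sinN /expk normrN; ring.
move: H; rewrite RintB ?RintD//; try exact: itg_sink; try exact: itg_expk.
by lra.
Qed.

Lemma dot_cons n (z : 'rV[R]_n.+1) x (v : 'rV[R]_n) :
  dot z (cons_rV (x, v)) =
  z ord0 ord0 * x + dot (\row_i z ord0 (lift ord0 i)) v.
Proof.
rewrite /dot big_ord_recl !mxE unlift_none; congr (_ + _).
by apply: eq_bigr => i _; rewrite !mxE liftK.
Qed.

Lemma prod_cons n (h : R -> R) x (v : 'rV[R]_n) :
  \prod_i h (cons_rV (x, v) ord0 i) = h x * \prod_i h (v ord0 i).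
Proof.
rewrite big_ord_recl !mxE unlift_none; congr (_ * _).
by apply: eq_bigr => i _; rewrite !mxE liftK.
Qed.

Lemma measurable_cosdot n (z : 'rV[R]_n) : measurable_fun setT (fun v => cos (dot z v)).
Proof.
apply: (measurableT_comp (f := cos)).
  exact: continuous_measurable_fun (@continuous_cos R).
have -> : dot z = (fun v => dot v z) by apply/funext => v; rewrite dotC.
exact: measurable_dot.
Qed.

Lemma measurable_sindot n (z : 'rV[R]_n) : measurable_fun setT (fun v => sin (dot z v)).
Proof.
apply: (measurableT_comp (f := sin)).
  exact: continuous_measurable_fun (@continuous_sin R).
have -> : dot z = (fun v => dot v z) by apply/funext => v; rewrite dotC.
exact: measurable_dot.
Qed.

Lemma itg_cosK n e (z : 'rV[R]_n) : 0 < e -> itg (leb n) (fun v => cos (dot z v) * expK e v).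
Proof.
move=> e0; apply: (itg_bM (C := 1)); last exact: itg_expK.
  exact: measurable_cosdot.
by move=> t; exact: cos_le1.
Qed.

Lemma itg_sinK n e (z : 'rV[R]_n) : 0 < e -> itg (leb n) (fun v => sin (dot z v) * expK e v).
Proof.
move=> e0; apply: (itg_bM (C := 1)); last exact: itg_expK.
  exact: measurable_sindot.
by move=> t; exact: sin_le1.
Qed.

Lemma Rint_cons n (f : 'rV[R]_n.+1 -> R) : itg (leb n.+1) f ->
  itg (mu \x leb n)%E (f \o @cons_rV R n) /\
  \int[leb n.+1]_v f v = \int[(mu \x leb n)%E]_p f (cons_rV p).
Proof.
move=> hf; have mf := itg_meas hf.
have mc := @measurable_cons_rV R n.
have h : itg (mu \x leb n)%E (f \o @cons_rV R n).
  apply/integrableP; split.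
    by apply/measurable_EFinP; exact: measurableT_comp.
  have /integrableP[_] := hf.
  have -> : (\int[leb n.+1]_v `|(EFin \o f) v| =
     \int[pushforward (mu \x leb n)%E (@cons_rV R n)]_v `|(EFin \o f) v|)%E by [].
  rewrite (ge0_integral_pushforward mc)//.
  by apply: measurableT_comp => //; exact/measurable_EFinP.
split => //; rewrite /Rintegral.
have -> : (\int[leb n.+1]_v (f v)%:E =
     \int[pushforward (mu \x leb n)%E (@cons_rV R n)]_v (f v)%:E)%E by [].
rewrite (integral_pushforward mc)//.
exact/measurable_EFinP.
Qed.

(** Induction on the dimension with the addition formula for the cosine; the product of sines drops
    out since its first factor has integral zero. *)
Lemma Rint_cosK n e (z : 'rV[R]_n) : 0 < e ->
  \int[leb n]_v (cos (dot z v) * expK e v) = poissonK e z.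
Proof.
move=> e0; elim: n z => [|n IH] z.
  rewrite /Rintegral integral_dirac//=.
    by rewrite indicE in_setT mul1r /dot /expK /poissonK !big_ord0 cos0 mulr1.
  by apply/measurable_EFinP; exact: itg_meas (itg_cosK _ e0).
have [_ ->] := Rint_cons (itg_cosK z e0).
set z' := \row_i z ord0 (lift ord0 i) : 'rV[R]_n.
have E (p : measurableTypeR R * 'rV[R]_n) : cos (dot z (cons_rV p)) * expK e (cons_rV p) =
  (cos (z ord0 ord0 * p.1) * expk e p.1) * (cos (dot z' p.2) * expK e p.2) -
  (sin (z ord0 ord0 * p.1) * expk e p.1) * (sin (dot z' p.2) * expK e p.2).
  case: p => x v; rewrite dot_cons /expK prod_cons cosD /=; ring.
have c1 := itg_cosk (z ord0 ord0) e0; have c2 := itg_cosK z' e0.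
have s1 := itg_sink (z ord0 ord0) e0; have s2 := itg_sinK z' e0.
under Rint_ext do rewrite E.
rewrite RintB; last 2 first.
- exact: (itg_tensor c1 c2).
- exact: (itg_tensor s1 s2).
rewrite (Rint_tensor c1 c2) (Rint_tensor s1 s2).
rewrite Rint_cosk// Rint_sink// mul0r subr0 IH /poissonK big_ord_recl; congr (_ * _).
by apply: eq_bigr => i _; rewrite mxE.
Qed.

End kerneln.

(** * Plancherel's formula *)

Section product_sigma_finite.
Context {d1 d2 : measure_display} {T1 : measurableType d1} {T2 : measurableType d2} {R : realType}.
Variables (m1 : {sigma_finite_measure set T1 -> \bar R}) (m2 : {sigma_finite_measure set T2 -> \bar R}).

(* The library's sigma-finite instance on [m1 \x m2] is shadowed by the one
   keyed on subprobabilities. *)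
Definition prodm : set (T1 * T2) -> \bar R := (m1 \x m2)%E.

HB.instance Definition _ := Measure.copy prodm (m1 \x m2)%E.

Let prodm_sigma_finite : sigma_finite setT prodm.
Proof.
have /sigma_finiteP[F [TF ndF Foo]] := sigma_finiteT m1.
have /sigma_finiteP[G [TG ndG Goo]] := sigma_finiteT m2.
exists (fun k => F k `*` G k).
  rewrite -setXTT TF TG predeqE => -[x y]; split.
    move=> [/= [k _ Fkx] [l _ Gly]]; exists (maxn k l) => //; split.
    - by move: x Fkx; exact/subsetPset/ndF/leq_maxl.
    - by move: y Gly; exact/subsetPset/ndG/leq_maxr.
  by move=> [k _ []/= ? ?]; split; exists k.
move=> k; have [mF Fk] := Foo k; have [mG Gk] := Goo k; split.
  exact: measurableX.
by rewrite /prodm product_measure1E// lte_mul_pinfty// ge0_fin_numE.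
Qed.

HB.instance Definition _ := Measure_isSigmaFinite.Build _ _ _ prodm prodm_sigma_finite.

End product_sigma_finite.

Section energy.
Context {R : realType} {n : nat}.
Local Notation E := 'rV[R]_n.
Local Notation mu := (@lebesgue_rV R n).
Local Notation pm := (mu \x mu)%E.
Implicit Types u v : E -> R.

(** For real u the Fourier transform is [fc u] - i [fs u], and [ft2 u] is its squared modulus. *)
Definition fc u (xi : E) := \int[mu]_x (cos (dot x xi) * u x).
Definition fs u (xi : E) := \int[mu]_x (sin (dot x xi) * u x).
Definition ft2 u xi := fc u xi ^+ 2 + fs u xi ^+ 2.

Lemma ft2_ge0 u xi : 0 <= ft2 u xi.
Proof. by rewrite addr_ge0 ?sqr_ge0. Qed.

Lemma measurable_cosdot' (xi : E) : measurable_fun setT (fun x : E => cos (dot x xi)).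
Proof. by under eq_fun do rewrite dotC; exact: measurable_cosdot. Qed.

Lemma measurable_sindot' (xi : E) : measurable_fun setT (fun x : E => sin (dot x xi)).
Proof. by under eq_fun do rewrite dotC; exact: measurable_sindot. Qed.

Lemma itg_fc u xi : itg mu u -> itg mu (fun x => cos (dot x xi) * u x).
Proof.
by apply: (itg_bM (C := 1)) => [|x]; [exact: measurable_cosdot'|exact: cos_le1].
Qed.

Lemma itg_fs u xi : itg mu u -> itg mu (fun x => sin (dot x xi) * u x).
Proof.
by apply: (itg_bM (C := 1)) => [|x]; [exact: measurable_sindot'|exact: sin_le1].
Qed.

(** Fubini gives measurability in xi only for a jointly integrable function, and the trigonometric
    factor does not decay in xi. The weight [expK 1 xi] is inserted for this and divided out
    afterwards. *)
Lemma measurable_transform (h : R -> R) u : continuous h -> (forall t, `|h t| <= 1) ->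
  itg mu u -> measurable_fun setT (fun xi => \int[mu]_x (h (dot x xi) * u x)).
Proof.
move=> ch h1 iu.
have mh := continuous_measurable_fun ch.
have mhd : measurable_fun setT (fun p : E * E => h (dot p.2 p.1)).
  apply: measurableT_comp => //; under eq_fun do rewrite dotC.
  exact: measurable_dot2.
have ig : itg pm (fun p => h (dot p.2 p.1) * (expK 1 p.1 * u p.2)).
  apply: (itg_bM (C := 1)) => //.
  exact: (itg_tensor (itg_expK n ltr01) iu).
have := measurable_fubini_F ig.
move=> /(measurableT_comp (fine_measurable measurableT)) mF.
rewrite (_ : (fun xi => _) = (fun xi : E => (\prod_i expR `|xi ord0 i|) *
   (fine \o (fubini_F mu (EFin \o (fun p : E * E => h (dot p.2 p.1) * (expK 1 p.1 * u p.2))))) xi)).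
  apply: measurable_funM => //.
  apply: (@measurable_prod_coord R n (fun=> fun t => expR `|t|)) => i.
  by apply: measurableT_comp => //; exact: normr_measurable.
apply/funext => xi; rewrite /fubini_F /=.
rewrite -[X in _ = _ * X]/(\int[mu]_y (h (dot y xi) * (expK 1 xi * u y))).
have iy : itg mu (fun y => h (dot y xi) * u y).
  apply: (itg_bM (C := 1)) => //.
  by apply: measurableT_comp => //; exact: measurable_dot.
under [in RHS]Rint_ext do rewrite mulrCA.
rewrite RintZ// mulrA /expK -big_split /= big1 ?mul1r// => i _.
by rewrite /expk mulN1r -expRD subrr expR0.
Qed.

Lemma measurable_fc u : itg mu u -> measurable_fun setT (fc u).
Proof. by move=> iu; apply: measurable_transform => //; [exact: continuous_cos|exact: cos_le1]. Qed.

Lemma measurable_fs u : itg mu u -> measurable_fun setT (fs u).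
Proof. by move=> iu; apply: measurable_transform => //; [exact: continuous_sin|exact: sin_le1]. Qed.

Lemma measurable_ft2 u : itg mu u -> measurable_fun setT (ft2 u).
Proof.
move=> iu; apply: measurable_funD; apply: measurable_funX.
  exact: measurable_fc.
exact: measurable_fs.
Qed.

Lemma ft2E u xi : itg mu u ->
  ft2 u xi = \int[pm]_p (cos (dot (p.1 - p.2) xi) * (u p.1 * u p.2)).
Proof.
move=> iu; have ic := itg_fc xi iu; have js := itg_fs xi iu.
rewrite /ft2 !expr2 -(Rint_tensor ic ic) -(Rint_tensor js js) -RintD; last 2 first.
- exact: (itg_tensor ic ic).
- exact: (itg_tensor js js).
apply: Rint_ext => p; rewrite dotDl dotNl cosB; ring.
Qed.

Lemma measurable_poissonK_sub e : 0 < e ->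
  measurable_fun setT (fun p : E * E => poissonK e (p.1 - p.2)).
Proof.
move=> e0; apply: (@measurableT_comp _ _ _ _ _ _ (@poissonK R n e)); first exact: measurable_poissonK.
apply: measurable_fun_rVP => i; under eq_fun do rewrite !mxE.
apply: measurable_funB;
  apply: (@measurableT_comp _ _ _ _ _ _ (fun v : 'rV[R]_n => v ord0 i));
  solve [exact: measurable_coord_rV|exact: measurable_fst|exact: measurable_snd].
Qed.

Lemma poissonK_bounded e (z : E) : 0 < e -> `|poissonK e z| <= (2 / e) ^+ n.
Proof.
move=> e0; rewrite ger0_norm ?poissonK_ge0//.
rewrite -[X in _ ^+ X]card_ord -prodr_const; apply: ler_prod => i _.
rewrite poisson_ge0//= /poisson.
rewrite (_ : 2 / e = 2 * e / e ^+ 2); last by field; rewrite gt_eqF.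
rewrite ler_pM2l ?mulr_gt0// lef_pV2 ?posrE ?exprn_gt0//.
  by rewrite lerDl sqr_ge0.
by rewrite ltr_pwDl ?sqr_ge0 ?exprn_gt0.
Qed.

Lemma itg_poissonK_tensor e u v : 0 < e -> itg mu u -> itg mu v ->
  itg pm (fun p => poissonK e (p.1 - p.2) * (u p.1 * v p.2)).
Proof.
move=> e0 iu iv; apply: (itg_bM (C := (2 / e) ^+ n)).
- exact: measurable_poissonK_sub.
- by move=> p; exact: poissonK_bounded.
- exact: itg_tensor.
Qed.

(** The squared transform is a double integral of cos((x - y).xi) u(x) u(y). The damping makes the
    triple integral absolutely convergent, and integrating in xi first turns the damped cosine into
    the Poisson kernel. *)
Lemma kernel_identity e u : 0 < e -> itg mu u ->
  itg mu (fun xi => expK e xi * ft2 u xi) /\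
  \int[mu]_xi (expK e xi * ft2 u xi) =
  \int[pm]_p (poissonK e (p.1 - p.2) * (u p.1 * u p.2)).
Proof.
move=> e0 iu.
have iuu := itg_tensor iu iu.
pose G (q : E * (E * E)) := cos (dot (q.2.1 - q.2.2) q.1) * (expK e q.1 * (u q.2.1 * u q.2.2)).
have mdot : measurable_fun setT (fun q : E * (E * E) => dot (q.2.1 - q.2.2) q.1).
  apply: measurable_sum => i; under eq_fun do rewrite !mxE.
  have mc := @measurable_coord_rV _ R n i.
  apply: measurable_funM; first apply: measurable_funB.
  - apply: (measurableT_comp mc).
    by apply: (measurableT_comp measurable_fst); exact: measurable_snd.
  - apply: (measurableT_comp mc).
    by apply: (measurableT_comp measurable_snd); exact: measurable_snd.
  - by apply: (measurableT_comp mc); exact: measurable_fst.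
have iG : itg (mu \x (prodm mu mu))%E G.
  apply: (itg_bM (C := 1)).
  - by apply: measurableT_comp => //; exact: continuous_measurable_fun (@continuous_cos R).
  - by move=> q; exact: cos_le1.
  - exact: (@itg_tensor _ _ _ _ _ mu (prodm mu mu) _ _ (itg_expK n e0) iuu).
have iG1 xi : itg pm (fun p => cos (dot (p.1 - p.2) xi) * (u p.1 * u p.2)).
  apply: (itg_bM (C := 1)) => //.
  - apply: (measurableT_comp (f := cos)); first exact: continuous_measurable_fun (@continuous_cos R).
    apply: (measurableT_comp (measurable_dot xi)).
    apply: measurable_fun_rVP => i; under eq_fun do rewrite !mxE.
    have mc := @measurable_coord_rV _ R n i.
    by apply: measurable_funB; apply: (measurableT_comp mc);
      solve [exact: measurable_fst|exact: measurable_snd].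
  - by move=> q; exact: cos_le1.
have E1 xi : expK e xi * ft2 u xi = \int[pm]_p G (xi, p).
  rewrite ft2E// -RintZ//; apply: Rint_ext => p; rewrite /G /=; ring.
have iG1' xi : itg pm (fun p => G (xi, p)).
  by apply: itg_eq (itgZ (expK e xi) (iG1 xi)) => p; rewrite /G /=; ring.
have iG2 p : itg mu (fun xi => G (xi, p)).
  apply: itg_eq (itgZ (u p.1 * u p.2) (itg_cosK (p.1 - p.2) e0)) => xi.
  by rewrite /G /=; ring.
split.
  apply/(itg_eq (f := fun xi => fine (fubini_F pm (EFin \o G) xi))).
    by move=> xi; rewrite E1 /fubini_F /Rintegral.
  have := integrable_fubini_F iG; apply: eq_integrable => // xi _ /=.
  by rewrite /fubini_F /= itg_fin.
transitivity (\int[mu]_xi \int[pm]_p G (xi, p)); first exact: Rint_ext.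
rewrite -(@itg_prodE _ _ _ _ _ mu (prodm mu mu) _ iG)// (@itg_prodE2 _ _ _ _ _ mu (prodm mu mu) _ iG)//.
apply: Rint_ext => p.
rewrite -(Rint_cosK (p.1 - p.2) e0) mulrC -RintZ; last exact: itg_cosK.
by apply: Rint_ext => xi; rewrite /G /=; ring.
Qed.

(** By translation and reflection the kernel has mass (2 pi)^n in either variable, so it integrates
    out; these are the two halves of Schur's test. *)
Lemma itg_poisson_conv e u : 0 < e -> measurable_fun setT u -> itg mu (fun x => u x ^+ 2) ->
  (\int[pm]_p (poissonK e (p.1 - p.2) * u p.1 ^+ 2)%:E =
   ((2 * pi) ^+ n * \int[mu]_x (u x ^+ 2))%:E)%E /\
  (\int[pm]_p (poissonK e (p.1 - p.2) * u p.2 ^+ 2)%:E =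
   ((2 * pi) ^+ n * \int[mu]_x (u x ^+ 2))%:E)%E.
Proof.
move=> e0 mu_ iu2.
have mK : measurable_fun setT (fun z : E => (poissonK e z)%:E).
  by apply/measurable_EFinP; exact: measurable_poissonK.
have K0 (z : E) : (0 <= (poissonK e z)%:E)%E by rewrite lee_fin poissonK_ge0.
have tr (x : E) : (\int[mu]_y (poissonK e (x - y))%:E = ((2 * pi) ^+ n)%:E)%E.
  rewrite -(integral_poissonK n e0) -(integral_oppv mK K0).
  rewrite -[RHS](@integral_translate R n (- x) (fun y => (poissonK e (- y))%:E))//.
  - by apply: eq_integral => y _; rewrite opprD opprK addrC.
  - apply: (measurableT_comp mK); apply: measurable_fun_rVP => i.
    under eq_fun do rewrite mxE.
    by apply: measurable_funN; exact: measurable_coord_rV.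
have tr2 (y : E) : (\int[mu]_x (poissonK e (x - y))%:E = ((2 * pi) ^+ n)%:E)%E.
  by rewrite -(integral_poissonK n e0) -[RHS](@integral_translate R n (- y))//.
have mK2 := measurable_poissonK_sub e0.
have mu1 : measurable_fun setT (fun p : E * E => u p.1 ^+ 2).
  by apply: measurable_funX; apply: measurableT_comp => //; exact: measurable_fst.
have mu2 : measurable_fun setT (fun p : E * E => u p.2 ^+ 2).
  by apply: measurable_funX; apply: measurableT_comp => //; exact: measurable_snd.
have fin : (\int[mu]_x (((2 * pi) ^+ n)%:E * (u x ^+ 2)%:E) =
   ((2 * pi) ^+ n * \int[mu]_x (u x ^+ 2))%:E)%E.
  rewrite ge0_integralZl//.
  - by rewrite itg_fin.
  - by apply/measurable_EFinP; exact: measurable_funX.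
  - by move=> x _; rewrite lee_fin sqr_ge0.
  - by rewrite lee_fin exprn_ge0// mulr_ge0// pi_ge0.
split; rewrite -fin.
  rewrite (fubini_tonelli1 (fun p : E * E => (poissonK e (p.1 - p.2) * u p.1 ^+ 2)%:E)); last 2 first.
  - by apply/measurable_EFinP; exact: measurable_funM.
  - by move=> p; rewrite lee_fin mulr_ge0 ?sqr_ge0 ?poissonK_ge0.
  apply: eq_integral => x _; rewrite /fubini_F /= -(tr x) -ge0_integralZr//.
  - by apply: (measurableT_comp (f := EFin)) => //; exact: (measurable_fun_pair2 _ mK2).
  - by rewrite lee_fin sqr_ge0.
rewrite (fubini_tonelli2 (fun p : E * E => (poissonK e (p.1 - p.2) * u p.2 ^+ 2)%:E)); last 2 first.
- by apply/measurable_EFinP; exact: measurable_funM.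
- by move=> p; rewrite lee_fin mulr_ge0 ?sqr_ge0 ?poissonK_ge0.
apply: eq_integral => y _; rewrite /fubini_G /= -(tr2 y) -ge0_integralZr//.
- by apply: (measurableT_comp (f := EFin)) => //; exact: (measurable_fun_pair1 _ mK2).
- by rewrite lee_fin sqr_ge0.
Qed.

Lemma expKE e (v : E) : expK e v = expR (- e * \sum_i `|v ord0 i|).
Proof.
rewrite /expK /expk mulr_sumr expR_sum.
by apply: eq_bigr => i _.
Qed.

Lemma expK_cvg1 (v : E) : expK (m.+1%:R^-1) v @[m --> \oo] --> (1 : R).
Proof.
under eq_fun do rewrite expKE.
have h : - m.+1%:R^-1 * \sum_i `|v ord0 i| @[m --> \oo] --> (0 : R).
  rewrite -[X in _ --> X](mul0r (\sum_i `|v ord0 i|)).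
  apply: cvgMl; rewrite -oppr0; apply: cvgN.
  exact: cvg_harmonic.
have H := @continuous_cvg _ _ _ _ _ _ expR _ (@continuous_expR R 0) h.
rewrite expR0 in H; exact: H.
Qed.

(* Damping by expK e turns the left side into the quadratic form of the Poisson
   kernel, of total mass (2 pi)^n; Schur's test, then e -> 0. *)
Lemma plancherel_le u : itg mu u -> itg mu (fun x => u x ^+ 2) ->
  (\int[mu]_xi (ft2 u xi)%:E <= ((2 * pi) ^+ n * \int[mu]_x (u x ^+ 2))%:E)%E.
Proof.
move=> iu iu2; have mu_ := itg_meas iu.
apply: (fatou_bound (F := fun m xi => expK (m.+1%:R^-1) xi * ft2 u xi)).
- move=> m; apply: measurable_funM; [exact: measurable_expK|exact: measurable_ft2].
- by move=> m x; rewrite mulr_ge0 ?expK_ge0 ?ft2_ge0.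
- move=> x; rewrite -[X in _ --> X]mul1r; apply: cvgMl; exact: expK_cvg1.
move=> m; have : 0 < m.+1%:R^-1 :> R by rewrite invr_gt0.
move: (m.+1%:R^-1) => e e0.
have [h1 h2] := kernel_identity e0 iu.
rewrite itg_fin// h2 lee_fin.
have [q1 q2] := itg_poisson_conv e0 mu_ iu2.
have mK := measurable_poissonK_sub e0.
have i1 : itg pm (fun p => poissonK e (p.1 - p.2) * u p.1 ^+ 2).
  apply: itg_lty.
  - apply: measurable_funM => //; apply: measurable_funX.
    by apply: measurableT_comp => //; exact: measurable_fst.
  - by move=> p; rewrite mulr_ge0 ?sqr_ge0 ?poissonK_ge0.
  - by rewrite q1 ltry.
have i2 : itg pm (fun p => poissonK e (p.1 - p.2) * u p.2 ^+ 2).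
  apply: itg_lty.
  - apply: measurable_funM => //; apply: measurable_funX.
    by apply: measurableT_comp => //; exact: measurable_snd.
  - by move=> p; rewrite mulr_ge0 ?sqr_ge0 ?poissonK_ge0.
  - by rewrite q2 ltry.
rewrite (itg_fin i1) in q1; rewrite (itg_fin i2) in q2.
case: q1 => q1; case: q2 => q2.
(* Schur's test with 2 u(x) u(y) <= u(x)^2 + u(y)^2: each square contributes half of the right
   side. *)
have -> : (2 * pi) ^+ n * \int[mu]_x (u x ^+ 2) =
  \int[pm]_p (2^-1 * (poissonK e (p.1 - p.2) * u p.1 ^+ 2 +
               poissonK e (p.1 - p.2) * u p.2 ^+ 2)).
  rewrite RintZ; last exact: itgD.
  by rewrite RintD// q1 q2; field.
apply: Rint_le; [exact: itg_poissonK_tensor|by apply: itgZ; exact: itgD|].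
move=> p; have := poissonK_ge0 (p.1 - p.2) e0.
by have := sqr_ge0 (u p.1 - u p.2); nra.
Qed.

End energy.

(** * Equality in Plancherel's formula for real functions *)

Section plancherel_real.
Context {R : realType} {n : nat}.
Local Notation E := 'rV[R]_n.
Local Notation mu := (@lebesgue_rV R n).
Implicit Types u v : E -> R.

Definition L12 u := itg mu u /\ itg mu (fun x => u x ^+ 2).
Definition nrm2 u := \int[mu]_x (u x ^+ 2).
(* A nonnegative quadratic form by plancherel_le, hence its zero set is a closed
   subspace; it contains the indicators of boxes, hence everything. *)
Definition defect u := (2 * pi) ^+ n * nrm2 u - \int[mu]_xi ft2 u xi.
Definition isom u := L12 u /\ defect u = 0.

Lemma L12D u v : L12 u -> L12 v -> L12 (fun x => u x + v x).
Proof.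
move=> [u1 u2] [v1 v2]; split; first exact: itgD.
by apply: itg_sqrD => //; [exact: itg_meas u1|exact: itg_meas v1].
Qed.

Lemma L12Z c u : L12 u -> L12 (fun x => c * u x).
Proof.
move=> [u1 u2]; split; first exact: itgZ.
by apply: itg_eq (itgZ (c ^+ 2) u2) => x; rewrite exprMn.
Qed.

Lemma L12B u v : L12 u -> L12 v -> L12 (fun x => u x - v x).
Proof.
move=> hu hv; rewrite (_ : (fun x => _) = fun x => u x + (-1) * v x).
  by apply: L12D => //; exact: L12Z.
by apply/funext => x; rewrite mulN1r.
Qed.

Lemma L12_eq u v : u =1 v -> L12 u -> L12 v.
Proof. by move=> /funext ->. Qed.

Lemma fcD u v xi : itg mu u -> itg mu v ->
  fc (fun x => u x + v x) xi = fc u xi + fc v xi.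
Proof.
move=> hu hv; rewrite /fc -RintD; [|exact: itg_fc|exact: itg_fc].
by apply: Rint_ext => x; rewrite mulrDr.
Qed.

Lemma fsD u v xi : itg mu u -> itg mu v ->
  fs (fun x => u x + v x) xi = fs u xi + fs v xi.
Proof.
move=> hu hv; rewrite /fs -RintD; [|exact: itg_fs|exact: itg_fs].
by apply: Rint_ext => x; rewrite mulrDr.
Qed.

Lemma fcZ c u xi : itg mu u -> fc (fun x => c * u x) xi = c * fc u xi.
Proof.
move=> hu; rewrite /fc -RintZ; last exact: itg_fc.
by apply: Rint_ext => x; rewrite mulrCA.
Qed.

Lemma fsZ c u xi : itg mu u -> fs (fun x => c * u x) xi = c * fs u xi.
Proof.
move=> hu; rewrite /fs -RintZ; last exact: itg_fs.
by apply: Rint_ext => x; rewrite mulrCA.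
Qed.

Lemma fcB u v xi : itg mu u -> itg mu v ->
  fc (fun x => u x - v x) xi = fc u xi - fc v xi.
Proof.
move=> hu hv; rewrite /fc -RintB; [|exact: itg_fc|exact: itg_fc].
by apply: Rint_ext => x; rewrite mulrBr.
Qed.

Lemma fsB u v xi : itg mu u -> itg mu v ->
  fs (fun x => u x - v x) xi = fs u xi - fs v xi.
Proof.
move=> hu hv; rewrite /fs -RintB; [|exact: itg_fs|exact: itg_fs].
by apply: Rint_ext => x; rewrite mulrBr.
Qed.

Lemma itg_ft2 u : L12 u -> itg mu (ft2 u).
Proof.
move=> [u1 u2]; apply: itg_lty; [exact: measurable_ft2|exact: ft2_ge0|].
by apply: le_lt_trans (plancherel_le u1 u2) _; rewrite ltry.
Qed.

Lemma defect_ge0 u : L12 u -> 0 <= defect u.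
Proof.
move=> hu; have [u1 u2] := hu; rewrite subr_ge0 -lee_fin -itg_fin.
  exact: plancherel_le.
exact: itg_ft2.
Qed.

Lemma defect_le u : defect u <= (2 * pi) ^+ n * nrm2 u.
Proof.
rewrite gerBl; apply: Rintegral_ge0 => x _; exact: ft2_ge0.
Qed.

Lemma defect_parallelogram u v : L12 u -> L12 v ->
  defect (fun x => u x + v x) + defect (fun x => u x - v x) =
  2 * defect u + 2 * defect v.
Proof.
move=> hu hv; have hD := L12D hu hv; have hB := L12B hu hv.
have [u1 u2] := hu; have [v1 v2] := hv.
have E1 : nrm2 (fun x => u x + v x) + nrm2 (fun x => u x - v x) = 2 * nrm2 u + 2 * nrm2 v.
  have [_ d2] := hD; have [_ b2] := hB.
  rewrite /nrm2 -RintD// -!RintZ// -RintD; try exact: itgZ.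
  by apply: Rint_ext => x; ring.
have E2 : \int[mu]_xi ft2 (fun x => u x + v x) xi + \int[mu]_xi ft2 (fun x => u x - v x) xi
   = 2 * \int[mu]_xi ft2 u xi + 2 * \int[mu]_xi ft2 v xi.
  have iu := itg_ft2 hu; have iv := itg_ft2 hv.
  have iD := itg_ft2 hD; have iB := itg_ft2 hB.
  rewrite -RintD// -!RintZ// -RintD; try exact: itgZ.
  apply: Rint_ext => xi; rewrite /ft2 fcD// fsD// fcB// fsB//; ring.
rewrite /defect addrACA -mulrDr E1 -opprD E2.
move: (nrm2 u) (nrm2 v) (\int[mu]_xi ft2 u xi) (\int[mu]_xi ft2 v xi) ((2 * pi) ^+ n) => a b c d e.
ring.
Qed.

(** The parallelogram law gives two nonnegative defects with sum zero. *)
Lemma isomD u v : isom u -> isom v -> isom (fun x => u x + v x).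
Proof.
move=> [hu du] [hv dv]; split; first exact: L12D.
have /eqP := defect_parallelogram hu hv; rewrite du dv !mulr0 addr0.
by rewrite (paddr_eq0 (defect_ge0 (L12D hu hv)) (defect_ge0 (L12B hu hv))) => /andP[/eqP].
Qed.

Lemma isomZ c u : isom u -> isom (fun x => c * u x).
Proof.
move=> [hu du]; split; first exact: L12Z.
have [u1 u2] := hu; have iu := itg_ft2 hu.
have -> : defect (fun x => c * u x) = c ^+ 2 * defect u.
  rewrite /defect /nrm2; under Rint_ext do rewrite exprMn.
  rewrite RintZ// mulrBr mulrCA -(RintZ (c ^+ 2) iu); congr (_ - _).
  by apply: Rint_ext => xi; rewrite /ft2 fcZ// fsZ//; ring.
by rewrite du mulr0.
Qed.

Lemma isom_eq u v : u =1 v -> isom u -> isom v.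
Proof. by move=> /funext ->. Qed.

Lemma isomB u v : isom u -> isom v -> isom (fun x => u x - v x).
Proof.
move=> hu hv; apply: isom_eq (isomD hu (isomZ (-1) hv)) => x.
by rewrite mulN1r.
Qed.

Lemma isom0 : isom (fun=> 0).
Proof.
have h0 : L12 (fun=> 0).
  by split; [exact: itg0|apply: itg_eq (itg0 mu) => x; rewrite expr0n].
split => //; apply/eqP; rewrite eq_le defect_ge0// andbT.
apply: le_trans (defect_le _) _; rewrite /nrm2.
by under Rint_ext do rewrite expr0n /=; rewrite /Rintegral integral0 mulr0.
Qed.

Lemma isom_sum (I : Type) (s : seq I) (F : I -> E -> R) :
  (forall i, isom (F i)) -> isom (fun x => \sum_(i <- s) F i x).
Proof.
move=> hF; elim: s => [|i s IH].
  by apply: isom_eq isom0 => x; rewrite big_nil.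
by apply: isom_eq (isomD (hF i) IH) => x; rewrite big_cons.
Qed.

(** The parallelogram law for F_m and u - F_m, together with defect F_m = 0, gives defect u <= 2
    defect(u - F_m) <= 2 (2 pi)^n |u - F_m|^2, which tends to 0 by dominated convergence. *)
Lemma isom_closed u (F : nat -> E -> R) (g : E -> R) : L12 u ->
  (forall m, isom (F m)) -> (forall x, F ^~ x @ \oo --> u x) ->
  itg mu g -> (forall m x, (u x - F m x) ^+ 2 <= g x) -> isom u.
Proof.
move=> hu hF Fu ig Fg; split => //.
apply/eqP; rewrite eq_le defect_ge0// andbT.
have mu_ := itg_meas hu.1.
have h : \int[mu]_x ((u x - F m x) ^+ 2) @[m --> \oo] --> (0 : R).
  rewrite (_ : 0 = \int[mu]_x ((fun=> 0) x : R)); last by rewrite /Rintegral integral0.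
  apply: (dominated_Rint (g := g)) => //.
  - move=> m; apply: measurable_funX; apply: measurable_funB => //.
    exact: itg_meas (hF m).1.1.
  - move=> x; rewrite [X in _ --> X](_ : 0 = (u x - u x) ^+ 2); last by rewrite subrr expr0n.
    by apply: (@cvgM _ _ _ _ (fun m => u x - F m x) (fun m => u x - F m x)); apply: cvgB => //; exact: cvg_cst.
  - by move=> m x; rewrite ger0_norm ?sqr_ge0.
have h2 : 2 * ((2 * pi) ^+ n * \int[mu]_x ((u x - F m x) ^+ 2)) @[m --> \oo] --> (0 : R).
  have -> : (0 : R) = 2 * ((2 * pi) ^+ n * 0) by rewrite !mulr0.
  by apply: cvgMr; apply: cvgMr.
apply: (cvgr_to_ge h2); apply: nearW => m.
have [hm dm] := hF m; have hd := L12B hu hm.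
have := defect_parallelogram hm hd; rewrite dm mulr0 add0r.
rewrite (_ : (fun x => F m x + _) = u); last by apply/funext => x; ring.
move=> e; have := defect_ge0 (L12B hm hd).
rewrite -(lerD2l (defect u)) e addr0 => /le_trans; apply.
by rewrite (ler_pM2l (ltr0Sn R 1)); exact: defect_le.
Qed.

Lemma itg_indic (A : set E) : measurable A -> (mu A < +oo)%E -> itg mu (\1_A).
Proof.
move=> mA Aoo; apply: itg_lty => //.
by rewrite integral_indic// setIT.
Qed.

Lemma L12_indic (A : set E) : measurable A -> (mu A < +oo)%E -> L12 (\1_A).
Proof.
move=> mA Aoo; have h := itg_indic mA Aoo; split => //.
by apply: itg_eq h => x; rewrite indicE; case: (_ \in _); rewrite ?expr1n ?expr0n.
Qed.

Lemma isom_indic_cvg (A : set E) (F : nat -> set E) : measurable A -> (mu A < +oo)%E ->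
  (forall m, isom (\1_(F m))) -> (forall m, F m `<=` A) ->
  (forall x, A x -> \forall m \near \oo, F m x) -> isom (\1_A).
Proof.
move=> mA Aoo hF FA AF; apply: (isom_closed (F := fun m => \1_(F m)) (g := \1_A)) => //.
- exact: L12_indic.
- move=> x; have [Ax|nAx] := pselect (A x).
    apply: cvg_near_cst; near=> m.
    have Fx : F m x by near: m; exact: AF.
    by rewrite !indicE !mem_set.
  rewrite (_ : (fun m => _) = cst 0).
    by rewrite indicE memNset//; exact: cvg_cst.
  by apply/funext => m; rewrite indicE memNset// => /FA.
- exact: itg_indic.
- move=> m x; rewrite !indicE; have [Ax|nAx] := pselect (A x).
    rewrite (mem_set Ax); case: (_ \in _); rewrite ?subrr ?subr0 ?expr0n ?expr1n//.
  by rewrite !memNset ?subrr ?expr0n//; exact: contra_not (FA m x) nAx.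
Unshelve. all: by end_near. Qed.

Lemma isom_indicU (A B : set E) : A `&` B = set0 -> isom (\1_A) -> isom (\1_B) ->
  isom (\1_(A `|` B)).
Proof.
move=> AB iA iB; apply: isom_eq (isomD iA iB) => x.
have : ~ (A `&` B) x by rewrite AB.
rewrite !indicE; have [Ax|nAx] := pselect (A x); have [Bx|nBx] := pselect (B x) => nAB.
- by exfalso; apply: nAB.
- by rewrite (mem_set Ax) (memNset nBx) mem_set ?addr0//; left.
- by rewrite (memNset nAx) (mem_set Bx) mem_set ?add0r//; right.
- by rewrite (memNset nAx) (memNset nBx) memNset ?addr0// => -[].
Qed.

Definition obox (a b : 'I_n -> R) : set E := [set v | forall i, `]a i, b i[%classic (v ord0 i)].

Lemma measurable_obox a b : measurable (obox a b).
Proof. by apply: (@measurable_box R n (fun i => `]a i, b i[%classic)) => i; exact: measurable_itv. Qed.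

Lemma obox_lty a b : (mu (obox a b) < +oo)%E.
Proof.
rewrite (@lebesgue_rV_box R n (fun i => `]a i, b i[%classic))//.
rewrite (eq_bigr (fun i => (Num.max 0 (b i - a i))%:E)); first by rewrite prodEFin ltry.
move=> i _; rewrite lebesgue_measure_itv /= lte_fin.
case: ltP => h; rewrite -?EFinB; congr EFin.
  by rewrite max_r// subr_ge0 ltW.
by rewrite max_l// subr_le0.
Qed.

Lemma oboxI a b a' b' : obox a b `&` obox a' b' =
  obox (fun i => Num.max (a i) (a' i)) (fun i => Num.min (b i) (b' i)).
Proof.
apply/seteqP; split => v.
  move=> [h h'] i; have := h i; have := h' i.
  by rewrite /= !in_itv /= gt_max lt_min => /andP[-> ->] /andP[-> ->].
move=> h; split => i; have := h i;
by rewrite /= !in_itv /= gt_max lt_min => /andP[/andP[? ?] /andP[? ?]]; apply/andP.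
Qed.

(** Open boxes are stable under intersection, so they can start a Dynkin induction once they are
    known to generate. *)
Lemma measurable_rVE : (@measurable _ E) = <<s [set A | exists a b, A = obox a b] >>.
Proof.
apply/seteqP; split; last first.
  apply: smallest_sub; first exact: sigma_algebra_measurable.
  by move=> A [a [b ->]]; exact: measurable_obox.
set G := [set A | _].
apply: smallest_sub; first exact: smallest_sigma_algebra.
rewrite -bigcup_seq; apply: bigcup_sub => i _ A [Y mY <-].
have : @measurable_fun _ _ (g_sigma_algebraType G) R setT (fun v : E => v ord0 i).
  apply: (measurability _ (RGenOpens.measurableE R)) => //.
  move=> _ [_ [x [y ->] <-]].
  (* A slab in direction i is the increasing union of boxes whose other sides are ]-N, N[. *)
  rewrite (_ : _ `&` _ = \bigcup_N obox (fun j => if j == i then x else - N%:R)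
     (fun j => if j == i then y else N%:R)).
    by apply: bigcupT_measurable => N; apply: sub_sigma_algebra; exists (fun j => if j == i then x else - N%:R), (fun j => if j == i then y else N%:R).
  rewrite setTI; apply/seteqP; split => v /=.
    rewrite in_itv /= => hv.
    pose N := (Num.truncn (\sum_j `|v ord0 j|)).+1.
    exists N => // j /=; rewrite in_itv /=; case: ifPn => [/eqP->//|_].
    rewrite -ltr_norml; apply: le_lt_trans (truncnS_gt _).
    rewrite (bigD1 j)//= lerDl; exact: sumr_ge0.
  by move=> [N _ /(_ i)] /=; rewrite eqxx.
by move=> /(_ measurableT Y mY).
Qed.

Lemma indic_obox a b (v : E) :
  \1_(obox a b) v = \prod_i \1_(`]a i, b i[%classic) (v ord0 i) :> R.
Proof.
rewrite indicE; have [h|h] := pselect (obox a b v).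
  by rewrite mem_set// big1// => i _; rewrite indicE mem_set//; exact: h.
rewrite memNset//.
have [i hi] : exists i, ~ `]a i, b i[%classic (v ord0 i).
  by apply/existsNP.
by rewrite (bigD1 i)//= indicE memNset// mul0r.
Qed.

(** The Poisson integral of the indicator of ]a, b[, cut down to that interval. Inside it both
    arctangents tend to pi / 2 as e -> 0, so the limit there is 2 pi. *)
Definition pbox (e a b x : R) : R :=
  \1_(`]a, b[%classic) x * (2 * atan ((b - x) / e) + 2 * atan ((x - a) / e)).

Lemma pboxE (e a b x : R) : 0 < e -> a < b ->
  (\int[@lebesgue_measure R]_y (\1_(`]a, b[%classic) x *
     (poisson e (x - y) * \1_(`]a, b[%classic) y))%:E = (pbox e a b x)%:E)%E.
Proof.
move=> e0 ab; rewrite /pbox.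
have mP : measurable_fun setT (fun y : R => poisson e (x - y)).
  by apply: continuous_measurable_fun; exact: continuous_poisson_sub.
under eq_integral do rewrite EFinM.
rewrite ge0_integralZl//; last 2 first.
- by apply/measurable_EFinP; apply: measurable_funM => //; exact: measurable_indic.
- by move=> y _; rewrite lee_fin mulr_ge0// poisson_ge0.
rewrite EFinM; congr (_ * _)%E.
rewrite -(integral_poisson_itv x e0 ab) (@integral_itv_bndoo R a b (fun y => (poisson e (x - y))%:E) true false); last first.
  by apply: measurable_funTS; exact/measurable_EFinP.
rewrite [RHS]integral_mkcond; apply: (@eq_integral _ _ _ (@lebesgue_measure R)) => y _.
by rewrite patchE indicE; case: (_ \in _); rewrite ?mulr1 ?mulr0.
Qed.

Lemma pbox_ge0 e a b x : 0 < e -> 0 <= pbox e a b x.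
Proof.
move=> e0; rewrite /pbox indicE; have [h|h] := pselect (`]a, b[%classic x); last first.
  by rewrite memNset// mul0r.
rewrite mem_set// mul1r; move: h; rewrite /= in_itv /= => /andP[ax xb].
rewrite addr_ge0// mulr_ge0// -[X in X <= _](@atan0 R) le_atan// divr_ge0 ?ltW// ?subr_gt0//.
Qed.

Lemma measurable_pbox e a b : measurable_fun setT (pbox e a b).
Proof.
apply: measurable_funM; first exact: measurable_indic.
have ma : measurable_fun setT (@atan R).
  by apply: continuous_measurable_fun => x; exact: continuous_atan.
by apply: measurable_funD; apply: measurable_funM => //; apply: (measurableT_comp ma);
  apply: measurable_funM => //; apply: measurable_funB.
Qed.

Lemma itg_indic_itv a b : itg (@lebesgue_measure R) (\1_(`]a, b[%classic)).
Proof.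
apply: itg_lty => //.
suff : (lebesgue_measure `]a, b[%classic < +oo)%E by rewrite integral_indic// setIT.
rewrite lebesgue_measure_itv /=.
by case: ifP => _; rewrite ?ltry// -EFinB ltry.
Qed.

Lemma pbox_bound e a b x : `|pbox e a b x| <= (2 * pi) * \1_(`]a, b[%classic) x.
Proof.
rewrite /pbox normrM [X in X * _]ger0_norm// mulrC ler_wpM2r//.
have := atan_ltpi2 ((b - x) / e); have := atan_gtNpi2 ((b - x) / e).
have := atan_ltpi2 ((x - a) / e); have := atan_gtNpi2 ((x - a) / e).
by rewrite ler_norml => *; apply/andP; split; lra.
Qed.

Lemma itg_pbox e a b : itg (@lebesgue_measure R) (pbox e a b).
Proof.
apply: (@itg_le R _ _ (@lebesgue_measure R) _ (fun x => (2 * pi) * \1_(`]a, b[%classic) x)).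
- exact: measurable_pbox.
- exact: pbox_bound.
- by apply: itgZ; exact: itg_indic_itv.
Qed.

Lemma cvg_atan_scale (c : R) : 0 < c ->
  2 * atan (c / m.+1%:R^-1) @[m --> \oo] --> (pi : R).
Proof.
move=> c0; rewrite (_ : pi = 2 * (pi / 2)); last by field.
apply: cvgMr; apply: (cvg_comp _ _ _ (@cvgy_atan R)).
under eq_fun do rewrite invrK.
have hN : (m.+1%:R : R) @[m --> \oo] --> +oo.
  exact: (@cvg_comp _ _ _ (addn 1) (fun k => k%:R : R) _ _ _ (cvg_addnl 1) cvgr_idn).
exact: (cvg_comp _ _ hN (gt0_cvgMry c0 cvg_id)).
Qed.

Lemma pbox_cvg a b : a < b ->
  \int[@lebesgue_measure R]_x pbox (m.+1%:R^-1) a b x @[m --> \oo] --> 2 * pi * (b - a).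
Proof.
move=> ab.
have -> : 2 * pi * (b - a) = \int[@lebesgue_measure R]_x (2 * pi * \1_(`]a, b[%classic) x).
  rewrite RintZ; last exact: itg_indic_itv.
  congr (_ * _); transitivity (fine (lebesgue_measure `]a, b[%classic)).
    by rewrite lebesgue_measure_itv /= lte_fin ab.
  by rewrite /Rintegral integral_indic// setIT.
apply: (@dominated_Rint R _ _ (@lebesgue_measure R) _ _ (fun x => (2 * pi) * \1_(`]a, b[%classic) x)).
- by move=> m; exact: measurable_pbox.
- by apply: measurable_funM => //; exact: measurable_indic.
- move=> x; rewrite /pbox mulrC indicE.
  have [h|h] := pselect (`]a, b[%classic x); last first.
    by rewrite memNset// mul0r; under eq_fun do rewrite mul0r; exact: cvg_cst.
  rewrite mem_set// mul1r; under eq_fun do rewrite mul1r.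
  move: h; rewrite /= in_itv /= => /andP[ax xb].
  by rewrite mulrC mulr_natr mulr2n; apply: cvgD; apply: cvg_atan_scale; rewrite subr_gt0.
- by apply: itgZ; exact: itg_indic_itv.
- by move=> m x; exact: pbox_bound.
Qed.

(** For the indicator of a box the double integral of [kernel_identity] factors over the
    coordinates. *)
Lemma kernel_obox e a b : 0 < e -> (forall i, a i < b i) ->
  \int[mu]_xi (expK e xi * ft2 (\1_(obox a b)) xi) =
  \prod_i \int[@lebesgue_measure R]_x pbox e (a i) (b i) x.
Proof.
move=> e0 ab; have mB := measurable_obox a b.
have iB := itg_indic mB (obox_lty a b).
have [_ ->] := kernel_identity e0 iB.
rewrite {1}/Rintegral.
rewrite (fubini_tonelli1 (fun p : E * E => (poissonK e (p.1 - p.2) *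
   (\1_(obox a b) p.1 * \1_(obox a b) p.2))%:E)); last 2 first.
- apply/measurable_EFinP; apply: measurable_funM; first exact: measurable_poissonK_sub.
  have m1 := measurable_indic mB (D := setT) (R := R).
  apply: measurable_funM; apply: (measurableT_comp m1);
    solve [exact: measurable_fst|exact: measurable_snd].
- by move=> p; rewrite lee_fin mulr_ge0 ?poissonK_ge0// mulr_ge0.
transitivity (fine (\int[mu]_x (\prod_i pbox e (a i) (b i) (x ord0 i))%:E)%E).
  congr fine; apply: eq_integral => x _; rewrite /fubini_F /=.
  transitivity (\int[mu]_y (\prod_i (\1_(`]a i, b i[%classic) (x ord0 i) *
     (poisson e (x ord0 i - y ord0 i) * \1_(`]a i, b i[%classic) (y ord0 i))))%:E)%E.
    apply: eq_integral => y _; congr EFin.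
    rewrite !indic_obox /poissonK -!big_split /=; apply: eq_bigr => i _.
    by rewrite !mxE; ring.
  rewrite (integral_prod_coord (h := fun i t => \1_(`]a i, b i[%classic) (x ord0 i) *
     (poisson e (x ord0 i - t) * \1_(`]a i, b i[%classic) t))).
  - by rewrite -prodEFin; apply: eq_bigr => i _; exact: pboxE.
  - move=> i; apply: measurable_funM => //; apply: measurable_funM; last exact: measurable_indic.
    by apply: continuous_measurable_fun; exact: continuous_poisson_sub.
  - by move=> i t; apply: mulr_ge0 => //; apply: mulr_ge0 => //; exact: poisson_ge0.
rewrite (integral_prod_coord (h := fun i => pbox e (a i) (b i))).
- rewrite -[RHS]/(fine (_)%:E); congr fine; rewrite -prodEFin; apply: eq_bigr => i _.
  by rewrite itg_fin//; exact: itg_pbox.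
- by move=> i; exact: measurable_pbox.
- by move=> i t; exact: pbox_ge0.
Qed.

Lemma cvg_prod_seq (I : Type) (s : seq I) (F : I -> nat -> R) (l : I -> R) :
  (forall i, F i m @[m --> \oo] --> l i) ->
  \prod_(i <- s) F i m @[m --> \oo] --> \prod_(i <- s) l i.
Proof.
move=> Fl; elim: s => [|i s IH].
  by rewrite big_nil; under eq_fun do rewrite big_nil; exact: cvg_cst.
by rewrite big_cons; under eq_fun do rewrite big_cons; exact: cvgM.
Qed.

(** The damped energies lie below the full one and, by [kernel_obox] and [pbox_cvg], tend to (2
    pi)^n times the volume; so the defect is at most 0. *)
Lemma isom_obox a b : isom (\1_(obox a b)).
Proof.
have [ab|] := pselect (forall i, a i < b i); last first.
  move=> /existsNP[i /negP hi].
  rewrite (_ : obox a b = set0); first by rewrite indic0; exact: isom0.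
  apply/seteqP; split => // v /(_ i); rewrite /= in_itv /= => /andP[h1 h2].
  by rewrite (lt_trans h1 h2) in hi.
have mB := measurable_obox a b.
have hB := L12_indic mB (obox_lty a b).
split => //; apply/eqP; rewrite eq_le defect_ge0// andbT subr_le0.
have -> : (2 * pi) ^+ n * nrm2 (\1_(obox a b)) = \prod_i (2 * pi * (b i - a i)).
  rewrite big_split /= prodr_const card_ord; congr (_ * _).
  rewrite /nrm2 (Rint_ext _ (g := \1_(obox a b))); last first.
    by move=> x; rewrite indicE; case: (_ \in _); rewrite ?expr1n ?expr0n.
  rewrite /Rintegral integral_indic// setIT.
  have /= E := @lebesgue_rV_box R n (fun i => `]a i, b i[%classic) (fun i => measurable_itv _).
  rewrite [X in fine X](_ : _ = (\prod_(i < n) lebesgue_measure `]a i, b i[%classic)%E); last exact: E.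
  rewrite -[RHS]/(fine (_)%:E); congr fine; rewrite -prodEFin; apply: eq_bigr => i _.
  by rewrite lebesgue_measure_itv /= lte_fin ab.
have h : \prod_i \int[@lebesgue_measure R]_x pbox (m.+1%:R^-1) (a i) (b i) x @[m --> \oo]
   --> \prod_i (2 * pi * (b i - a i)).
  by apply: cvg_prod_seq => i; exact: pbox_cvg.
apply: (cvgr_to_le h); apply: nearW => m.
have : 0 < m.+1%:R^-1 :> R by rewrite invr_gt0.
move: (m.+1%:R^-1) => e e0.
rewrite -kernel_obox//; apply: Rint_le.
- by have [] := kernel_identity e0 hB.1.
- exact: itg_ft2.
- by move=> xi; rewrite ler_piMl ?ft2_ge0// expK_le1.
Qed.

Definition ocube (N : nat) : set E := obox (fun=> - N%:R) (fun=> N%:R).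

Lemma ocube_near (x : E) : \forall N \near \oo, ocube N x.
Proof.
exists (Num.truncn (\sum_j `|x ord0 j|)).+1 => // N /= hN j /=; rewrite in_itv /=.
rewrite -ltr_norml; apply: (@lt_le_trans _ _ (Num.truncn (\sum_j `|x ord0 j|)).+1%:R); last by rewrite ler_nat.
apply: le_lt_trans (truncnS_gt _).
rewrite (bigD1 j)//= lerDl; exact: sumr_ge0.
Qed.

(** Dynkin induction inside a fixed cube, which keeps complements of finite measure. Complements are
    differences of indicators, disjoint unions are limits of finite sums. *)
Lemma isom_indic_cube N (A : set E) : measurable A -> isom (\1_(A `&` ocube N)).
Proof.
set G := [set A | exists a b, A = obox a b].
have mK : measurable (ocube N) by exact: measurable_obox.
have Klty (B : set E) : measurable B -> (mu (B `&` ocube N) < +oo)%E.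
  move=> mB; apply: le_lt_trans (obox_lty (fun=> - N%:R) (fun=> N%:R)).
  by apply: le_measure; rewrite ?inE//; exact: measurableI.
have step := @dynkin_induction _ E G (fun A => isom (\1_(A `&` ocube N))) measurable_rVE.
move=> mA; apply: step; last by rewrite -measurable_rVE.
- move=> B C [a [b ->]] [a' [b' ->]]; rewrite oboxI.
  by eexists; eexists.
- by rewrite setTI; exact: isom_obox.
- by move=> B [a [b ->]]; rewrite oboxI; exact: isom_obox.
- move=> S mS iS; apply: isom_eq (isomB (isom_obox (fun=> - N%:R) (fun=> N%:R)) iS) => x.
  rewrite !indicE -[obox _ _]/(ocube N); have [Kx|nKx] := pselect (ocube N x); last first.
    by rewrite (memNset nKx) !memNset ?subrr// => -[].
  have [Sx|nSx] := pselect (S x).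
    rewrite (mem_set Kx) (@mem_set _ (S `&` _) x)// memNset ?subrr// => -[]; exact.
  rewrite (mem_set Kx) (@memNset _ (S `&` _) x) ?subr0; last by case.
  by rewrite mem_set.
- move=> F mF tF iF.
  apply: (isom_indic_cvg (F := fun m => \big[setU/set0]_(k < m) F k `&` ocube N)).
  + by apply: measurableI => //; exact: bigcup_measurable.
  + by apply: Klty; exact: bigcup_measurable.
  + elim=> [|m IH]; first by rewrite big_ord0 set0I indic0; exact: isom0.
    rewrite big_ord_recr /= setIUl; apply: isom_indicU; [|exact: IH|exact: iF].
    apply/seteqP; split => // x [[h1 _] [h2 _]].
    move: h1; rewrite -bigcup_mkord => -[k /= km Fkx].
    move/trivIsetP: tF => /(_ k m I I); rewrite neq_ltn km => /(_ isT) e.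
    have : (F k `&` F m) x by [].
    by rewrite e.
  + move=> m x [h1 h2]; split => //; move: h1.
    by rewrite -bigcup_mkord => -[k _ Fkx]; exists k.
  + move=> x [[k _ Fkx] Kx]; exists k.+1 => // m /= km; split => //.
    by rewrite -bigcup_mkord; exists k.
Qed.

Lemma isom_indic (A : set E) : measurable A -> (mu A < +oo)%E -> isom (\1_A).
Proof.
move=> mA Aoo; apply: (isom_indic_cvg (F := fun N => A `&` ocube N)) => //.
- by move=> N; exact: isom_indic_cube.
- by move=> x Ax; have := ocube_near x; apply: filterS.
Qed.

Import HBNNSimple.

(** A simple function below an integrable one is a finite combination of indicators whose level sets
    at y > 0 have finite measure, by Markov's inequality. *)
Lemma isom_nnsfun (f : {nnsfun E >-> R}) u : itg mu u -> (forall x, f x <= u x) -> isom f.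
Proof.
move=> iu fu.
rewrite (funext (fimfunEord f)); apply: isom_sum => i.
move: (_`_i) => y.
have [y0|y0] := ltP 0 y; last first.
  have [->|yn] := eqVneq y 0.
    by apply: isom_eq isom0 => x; rewrite mul0r.
  rewrite (_ : f @^-1` [set y] = set0).
    by apply: isom_eq isom0 => x; rewrite indic0 mulr0.
  apply/seteqP; split => // x /= fx.
  have : 0 <= f x by [].
  by rewrite fx => h; move: yn; rewrite eq_le y0 h.
apply: isomZ; apply: isom_indic => //.
have h : (y%:E * mu (f @^-1` [set y]) <= \int[mu]_x (`|u x|)%:E)%E.
  rewrite -(setIT (f @^-1` [set y])) -integral_indic// -ge0_integralZl//; last 2 first.
  - by apply/measurable_EFinP; exact: measurable_indic.
  - by rewrite lee_fin ltW.
  apply: ge0_le_integral => //.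
  - by move=> x _; rewrite mule_ge0 ?lee_fin// ltW.
  - by apply: emeasurable_funM => //; apply/measurable_EFinP; exact: measurable_indic.
  - by apply/measurable_EFinP; apply: measurableT_comp => //; exact: itg_meas iu.
  - move=> x _; rewrite -EFinM lee_fin indicE.
    have [fx|nfx] := pselect ((f @^-1` [set y]) x).
      by rewrite mem_set// mulr1 -fx; exact: le_trans (fu x) (ler_norm _).
    by rewrite memNset// mulr0.
have : (mu (f @^-1` [set y]) \is a fin_num).
  rewrite ge0_fin_numE// ltNge leye_eq; apply/negP => /eqP e.
  move: h; rewrite e gt0_muley ?lte_fin// leye_eq => /eqP e'.
  by have := itg_fin_lty (itg_norm iu); rewrite e'.
by rewrite ge0_fin_numE.
Qed.

Lemma isom_nneg u : L12 u -> (forall x, 0 <= u x) -> isom u.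
Proof.
move=> hu u0; have [u1 u2] := hu.
have mu_ : measurable_fun setT (EFin \o u) by apply/measurable_EFinP; exact: itg_meas u1.
pose f := nnsfun_approx measurableT mu_.
have fu m x : f m x <= u x.
  have h := @cvg_nnsfun_approx _ _ _ _ measurableT _ mu_ (fun x _ => u0 x) x I.
  have nd : nondecreasing_seq (fun m => (f m x)%:E).
    by move=> a b ab; rewrite lee_fin; exact/lefP/nd_nnsfun_approx.
  have := ereal_nondecreasing_cvgn nd; move=> /cvg_lim; rewrite (cvg_lim _ h)// => /(_ (@ereal_hausdorff _)) e.
  by rewrite -lee_fin -[X in (_ <= X)%E]/((EFin \o u) x) e; apply: ereal_sup_ubound; exists m.
apply: (isom_closed (F := fun m => f m) (g := fun x => u x ^+ 2)) => //.
- by move=> m; apply: (isom_nnsfun u1) => x; exact: fu.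
- move=> x.
  have h := @cvg_nnsfun_approx _ _ _ _ measurableT _ mu_ (fun x _ => u0 x) x I.
  exact: (fine_cvg h).
- move=> m x; have := fu m x; have : 0 <= f m x by []; have := u0 x.
  by move: (u x) (f m x) => a b; nra.
Qed.

Lemma isomP u : L12 u -> isom u.
Proof.
move=> hu; have [u1 u2] := hu; have mu_ := itg_meas u1.
have h x : u x = Num.max (u x) 0 - Num.max (- u x) 0.
  by case: (leP (u x) 0) => h; [rewrite max_l ?oppr_ge0// opprK add0r|rewrite max_r ?subr0// oppr_le0 ltW].
have hp : L12 (fun x => Num.max (u x) 0).
  split.
    apply: (itg_le (g := fun x => `|u x|)); [exact: measurable_maxr| |exact: itg_norm].
    by move=> x; case: (leP (u x) 0) => //; rewrite normr0.
  apply: (itg_le (g := fun x => u x ^+ 2)) => //; first by apply: measurable_funX; exact: measurable_maxr.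
  move=> x; rewrite ger0_norm ?sqr_ge0//; case: (leP (u x) 0) => // _.
  by rewrite expr0n sqr_ge0.
have hn : L12 (fun x => Num.max (- u x) 0).
  have mN : measurable_fun setT (fun x => Num.max (- u x) 0).
    by apply: measurable_maxr => //; exact: measurable_funN.
  split.
    apply: (itg_le (g := fun x => `|u x|)) => //; last exact: itg_norm.
    by move=> x; case: (leP (- u x) 0) => //; rewrite ?normr0 ?normrN.
  apply: (itg_le (g := fun x => u x ^+ 2)) => //; first exact: measurable_funX.
  move=> x; rewrite ger0_norm ?sqr_ge0//; case: (leP (- u x) 0) => // _.
    by rewrite expr0n sqr_ge0.
  by rewrite sqrrN.
have ip : isom (fun x => Num.max (u x) 0) by apply: isom_nneg => // x; rewrite le_max lexx orbT.
have im : isom (fun x => Num.max (- u x) 0) by apply: isom_nneg => // x; rewrite le_max lexx orbT.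
by apply: isom_eq (isomB ip im) => x; rewrite -h.
Qed.

Lemma plancherel_real u : L12 u -> \int[mu]_xi ft2 u xi = (2 * pi) ^+ n * nrm2 u.
Proof. by move=> /isomP[_ /eqP]; rewrite subr_eq0 => /eqP. Qed.

End plancherel_real.

(** * Weighted sesquilinear forms *)

Section complex_forms.
Context {R : realType} {dp : measure_display} {T : measurableType dp}.
Variable mu : {measure set T -> \bar R}.
Local Open Scope complex_scope.
Local Notation Re := (@complex.Re R).
Local Notation Im := (@complex.Im R).
Implicit Types F G H : T -> R[i].

Definition nsq (z : R[i]) : R := Re z ^+ 2 + Im z ^+ 2.

Lemma nsq_ge0 z : 0 <= nsq z.
Proof. by rewrite addr_ge0 ?sqr_ge0. Qed.

Lemma nsqE z : Normc.normc z ^+ 2 = nsq z.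
Proof. by case: z => a b; rewrite /Normc.normc sqr_sqrtr// addr_ge0 ?sqr_ge0. Qed.

Lemma nsqM x y : nsq (x * y) = nsq x * nsq y.
Proof. by case: x => a b; case: y => c d; rewrite /nsq /=; ring. Qed.

Lemma nsqD_le x y : nsq (x + y) <= 2 * nsq x + 2 * nsq y.
Proof.
case: x => a b; case: y => c d; rewrite /nsq /=.
have := sqr_ge0 (a - c); have := sqr_ge0 (b - d); nra.
Qed.

Lemma nsqJ x : nsq (x^*) = nsq x.
Proof. by case: x => a b; rewrite /nsq /= sqrrN. Qed.

Lemma mulcJ x : x * x^* = (nsq x)%:C.
Proof. by case: x => a b; rewrite /nsq; simpc; congr (_ +i* _); ring. Qed.

Lemma creM (x y : R[i]) : Re (x * y) = Re x * Re y - Im x * Im y.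
Proof. by case: x => a b; case: y. Qed.
Lemma cimM (x y : R[i]) : Im (x * y) = Re x * Im y + Im x * Re y.
Proof. by case: x => a b; case: y. Qed.
Lemma creD (x y : R[i]) : Re (x + y) = Re x + Re y.
Proof. by case: x => a b; case: y. Qed.
Lemma cimD (x y : R[i]) : Im (x + y) = Im x + Im y.
Proof. by case: x => a b; case: y. Qed.
Lemma creN (x : R[i]) : Re (- x) = - Re x. Proof. by case: x. Qed.
Lemma cimN (x : R[i]) : Im (- x) = - Im x. Proof. by case: x. Qed.
Lemma creJ (x : R[i]) : Re (x^*) = Re x. Proof. by case: x. Qed.
Lemma cimJ (x : R[i]) : Im (x^*) = - Im x. Proof. by case: x. Qed.

Definition reimE := (creM, cimM, creD, cimD, creN, cimN, creJ, cimJ).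

Lemma complex_eq (x y : R[i]) : Re x = Re y -> Im x = Im y -> x = y.
Proof. by case: x => a b; case: y => c d /= -> ->. Qed.

Lemma weightJ (r : R) (x y : R[i]) : (r%:C * x * y^*)^* = r%:C * y * x^*.
Proof.
by case: x => a b; case: y => c e; apply: complex_eq; rewrite !reimE /=; ring.
Qed.

Definition citg F := itg mu (Re \o F) /\ itg mu (Im \o F).
Definition cint F : R[i] := (\int[mu]_x Re (F x)) +i* (\int[mu]_x Im (F x)).

Lemma cint_ext F G : F =1 G -> cint F = cint G.
Proof. by move=> /funext ->. Qed.

Lemma citg_ext F G : F =1 G -> citg F -> citg G.
Proof. by move=> /funext ->. Qed.

Lemma citgD F G : citg F -> citg G -> citg (fun x => F x + G x).
Proof.
move=> [f1 f2] [g1 g2]; split; [apply: itg_eq (itgD f1 g1)|apply: itg_eq (itgD f2 g2)];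
by move=> x /=; rewrite reimE.
Qed.

Lemma citgZ (c : R[i]) F : citg F -> citg (fun x => c * F x).
Proof.
move=> [f1 f2]; split.
  by apply: itg_eq (itgB (itgZ (Re c) f1) (itgZ (Im c) f2)) => x /=; rewrite reimE.
by apply: itg_eq (itgD (itgZ (Re c) f2) (itgZ (Im c) f1)) => x /=; rewrite reimE.
Qed.

Lemma cintD F G : citg F -> citg G -> cint (fun x => F x + G x) = cint F + cint G.
Proof.
move=> [f1 f2] [g1 g2]; apply: complex_eq; rewrite reimE /=.
  by rewrite -(RintD f1 g1); apply: Rint_ext => x; rewrite reimE.
by rewrite -(RintD f2 g2); apply: Rint_ext => x; rewrite reimE.
Qed.

Lemma cintZ (c : R[i]) F : citg F -> cint (fun x => c * F x) = c * cint F.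
Proof.
move=> [f1 f2]; apply: complex_eq; rewrite reimE /=.
  rewrite -(RintZ _ f1) -(RintZ _ f2) -RintB; try exact: itgZ.
  by apply: Rint_ext => x; rewrite reimE.
rewrite -(RintZ _ f1) -(RintZ _ f2) -RintD; try exact: itgZ.
by apply: Rint_ext => x; rewrite reimE.
Qed.

Lemma cintJ F : citg F -> cint (fun x => (F x)^*) = (cint F)^*.
Proof.
move=> [f1 f2]; apply: complex_eq; rewrite reimE /=.
  by apply: Rint_ext => x; rewrite reimE.
rewrite -mulN1r -(RintZ _ f2); apply: Rint_ext => x.
by rewrite reimE mulN1r.
Qed.

Section weighted.
Variable w : T -> R.
Hypothesis mw : measurable_fun setT w.

Definition cmeas F := measurable_fun setT (Re \o F) /\ measurable_fun setT (Im \o F).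
Definition wsq F := cmeas F /\ itg mu (fun x => w x * nsq (F x)).
(* With w the indicator of Om this is the inner product of L^2(Om); with
   w = ln|xi|, on the Fourier side, it is (2 pi)^d times the logarithmic form. *)
Definition wform F G := cint (fun x => (w x)%:C * F x * (G x)^*).
Definition wq F := \int[mu]_x (w x * nsq (F x)).

Lemma measurable_nsq F : cmeas F -> measurable_fun setT (nsq \o F).
Proof. by move=> [f1 f2]; apply: measurable_funD; apply: measurable_funX. Qed.

Lemma cmeasD F G : cmeas F -> cmeas G -> cmeas (fun x => F x + G x).
Proof.
move=> [f1 f2] [g1 g2]; split.
  by have := measurable_funD f1 g1; apply: eq_measurable_fun => x _ /=; rewrite reimE.
by have := measurable_funD f2 g2; apply: eq_measurable_fun => x _ /=; rewrite reimE.
Qed.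

Lemma cmeasM F G : cmeas F -> cmeas G -> cmeas (fun x => F x * G x).
Proof.
move=> [f1 f2] [g1 g2]; split.
  by have := measurable_funB (measurable_funM f1 g1) (measurable_funM f2 g2);
    apply: eq_measurable_fun => x _ /=; rewrite reimE.
by have := measurable_funD (measurable_funM f1 g2) (measurable_funM f2 g1);
  apply: eq_measurable_fun => x _ /=; rewrite reimE.
Qed.

Lemma cmeas_cst c : cmeas (fun=> c).
Proof. by split; exact: measurable_cst. Qed.

Lemma cmeasJ F : cmeas F -> cmeas (fun x => (F x)^*).
Proof.
move=> [f1 f2]; split.
  by move: f1; apply: eq_measurable_fun => x _ /=; rewrite reimE.
by have := measurable_funN f2; apply: eq_measurable_fun => x _ /=; rewrite reimE.
Qed.

Lemma itg_abs_wsq F : wsq F -> itg mu (fun x => `|w x| * nsq (F x)).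
Proof.
move=> [_ h]; apply: itg_eq (itg_norm h) => x.
by rewrite normrM (ger0_norm (nsq_ge0 _)).
Qed.

Lemma citg_wform F G : wsq F -> wsq G -> citg (fun x => (w x)%:C * F x * (G x)^*).
Proof.
move=> hF hG; have iF := itg_abs_wsq hF; have iG := itg_abs_wsq hG.
have m1 : cmeas (fun x => (w x)%:C * F x * (G x)^*).
  apply: cmeasM; last exact: cmeasJ hG.1.
  apply: cmeasM hF.1; split; last exact: measurable_cst.
  exact: mw.
split; apply: itg_le (itgD iF iG); [exact: m1.1| |exact: m1.2|];
  move=> x /=; rewrite !reimE /= !mul0r ?subr0 ?addr0 -!mulrA.
  rewrite -mulrBr normrM -mulrDr ler_wpM2l// /nsq ler_norml.
  move: (F x) (G x) => [a b] [c d] /=.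
  have := sqr_ge0 (a - c); have := sqr_ge0 (b - d); have := sqr_ge0 (a + c); have := sqr_ge0 (b + d).
  by move=> *; apply/andP; split; nra.
rewrite -mulrDr normrM -mulrDr ler_wpM2l// /nsq ler_norml.
move: (F x) (G x) => [a b] [c d] /=.
have := sqr_ge0 (a - d); have := sqr_ge0 (b - c); have := sqr_ge0 (a + d); have := sqr_ge0 (b + c).
by move=> *; apply/andP; split; nra.
Qed.

Lemma wsqD F G : wsq F -> wsq G -> wsq (fun x => F x + G x).
Proof.
move=> hF hG; have mD := cmeasD hF.1 hG.1; split => //.
apply: (@itg_le _ _ _ _ _ (fun x => 2 * (`|w x| * nsq (F x)) + 2 * (`|w x| * nsq (G x)))).
- by apply: measurable_funM => //; exact: measurable_nsq.
- move=> x; rewrite normrM (ger0_norm (nsq_ge0 _)) !(mulrCA 2) -mulrDr ler_wpM2l//.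
  exact: nsqD_le.
- by apply: itgD; apply: itgZ; exact: itg_abs_wsq.
Qed.

Lemma wsqZ c F : wsq F -> wsq (fun x => c * F x).
Proof.
move=> hF; split; first by apply: cmeasM hF.1; exact: cmeas_cst.
by apply: itg_eq (itgZ (nsq c) hF.2) => x; rewrite nsqM; ring.
Qed.

Lemma wformDl F F' G : wsq F -> wsq F' -> wsq G ->
  wform (fun x => F x + F' x) G = wform F G + wform F' G.
Proof.
move=> hF hF' hG; rewrite /wform -cintD; try exact: citg_wform.
by apply: cint_ext => x; rewrite mulrDr mulrDl.
Qed.

Lemma wformZl c F G : wsq F -> wsq G -> wform (fun x => c * F x) G = c * wform F G.
Proof.
move=> hF hG; rewrite /wform -cintZ; last exact: citg_wform.
by apply: cint_ext => x; rewrite mulrCA !mulrA.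
Qed.

Lemma wformJ F G : wsq F -> wsq G -> wform G F = (wform F G)^*.
Proof.
move=> hF hG; rewrite /wform -cintJ; last exact: citg_wform.
by apply: cint_ext => x; rewrite weightJ.
Qed.

Lemma wform_diag F : wsq F -> wform F F = (wq F)%:C.
Proof.
move=> hF; apply: complex_eq => /=.
  by apply: Rint_ext => x; rewrite -mulrA mulcJ reimE /= !mul0r subr0.
rewrite -[RHS](_ : \int[mu]_x (0 : R) = 0); last by rewrite /Rintegral integral0.
by apply: Rint_ext => x; rewrite -mulrA mulcJ reimE /= mulr0 mul0r addr0.
Qed.

Definition resid F (c : nat -> R[i]) (G : nat -> T -> R[i]) m x :=
  F x - \sum_(k < m) c k * G k x.

(** Completing the square for a family orthogonal in the weighted form, whatever the signs of the
    weight and of [lam]. It is used with the L^2 form ([lam] = 1) and with the logarithmic form on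
    the Fourier side, with the same coefficients c in both; b is an arbitrary competitor. *)
Lemma gram_expand F (G : nat -> T -> R[i]) (c b : nat -> R[i]) (lam : nat -> R) m :
  wsq F -> (forall k, wsq (G k)) ->
  (forall k, wform (G k) F = (lam k)%:C * (c k)^*) ->
  (forall j k, wform (G j) (G k) = (lam j)%:C * (j == k)%:R) ->
  wsq (resid F b G m) /\
  wq (resid F b G m) = wq F - \sum_(k < m) lam k * (nsq (c k) - nsq (c k - b k)).
Proof.
move=> hF hG GF GG.
(* The induction also carries that pairings with the G k not yet subtracted are those of F. *)
suff [h1 [h2 h3]] : wsq (resid F b G m) /\
  (forall k, (m <= k)%N -> wform (G k) (resid F b G m) = (lam k)%:C * (c k)^*) /\
  wform (resid F b G m) (resid F b G m) =
    wform F F - (\sum_(k < m) lam k * (nsq (c k) - nsq (c k - b k)))%:C.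
  split => //; move: h3; rewrite !wform_diag// => /(congr1 Re).
  by rewrite reimE /=.
elim: m => [|m [IH1 [IH2 IH3]]].
  have -> : resid F b G 0 = F by apply/funext => x; rewrite /resid big_ord0 subr0.
  by split => //; split => //; rewrite big_ord0 subr0.
have E : resid F b G m.+1 = fun x => resid F b G m x + (- b m) * G m x.
  by apply/funext => x; rewrite /resid big_ord_recr /= opprD addrA mulNr.
have hm := wsqZ (- b m) (hG m).
rewrite E; split; first exact: wsqD.
have X k : wform (G k) (fun x => resid F b G m x + - b m * G m x) =
    wform (G k) (resid F b G m) - (b m)^* * wform (G k) (G m).
  rewrite (wformJ (wsqD IH1 hm) (hG k)) wformDl// wformZl//.
  rewrite [in RHS](wformJ IH1 (hG k)) [in RHS](wformJ (hG m) (hG k)).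
  move: (wform (resid _ _ _ _) _) (wform (G m) (G k)) => p q.
  by rewrite rmorphD rmorphM rmorphN mulNr.
split.
  move=> k mk; rewrite X IH2 ?(ltnW mk)// GG gtn_eqF// mulr0 mulr0 subr0//.
rewrite wformDl//; last exact: wsqD.
rewrite wformZl//; last exact: wsqD.
rewrite X GG eqxx mulr1 IH2//.
rewrite (wformJ (wsqD IH1 hm) IH1) wformDl// wformZl// IH2// IH3.
rewrite wform_diag// big_ord_recr /=.
apply: complex_eq; rewrite /nsq !reimE /=; ring.
Qed.

End weighted.
End complex_forms.

Lemma pm_eq0 (R : realFieldType) (a b : R) : a - 2 * b = a + 2 * b -> b = 0.
Proof. by lra. Qed.

(** * The Fourier transform of complex functions *)

Section fourier_transform.
Context {R : realType} {n : nat}.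
Local Open Scope complex_scope.
Local Notation E := 'rV[R]_n.
Local Notation mu := (@lebesgue_rV R n).
Local Notation Re := (@complex.Re R).
Local Notation Im := (@complex.Im R).
Implicit Types f g : E -> R[i].

Definition expi (xi x : E) : R[i] := cos (dot x xi) +i* sin (dot x xi).

Lemma nsq_expi xi x : nsq (expi xi x) = 1.
Proof. by rewrite /nsq /expi /= cos2Dsin2. Qed.

Lemma fourier_Re f xi : citg mu f ->
  Re (fourier f xi) = fc (Re \o f) xi + fs (Im \o f) xi.
Proof.
move=> [f1 f2]; rewrite /fourier /cintegral /= /fc /fs -RintD; [|exact: itg_fc|exact: itg_fs].
by apply: Rint_ext => x; rewrite reimE /= mulNr opprK.
Qed.

Lemma fourier_Im f xi : citg mu f ->
  Im (fourier f xi) = fc (Im \o f) xi - fs (Re \o f) xi.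
Proof.
move=> [f1 f2]; rewrite /fourier /cintegral /= /fc /fs -RintB; [|exact: itg_fc|exact: itg_fs].
by apply: Rint_ext => x; rewrite reimE /= mulNr.
Qed.

Lemma fourierE f xi : fourier f xi = cint mu (fun x => (expi xi x)^* * f x).
Proof. by []. Qed.

Lemma cmeas_expi xi : cmeas (expi xi).
Proof. by split; [exact: measurable_cosdot'|exact: measurable_sindot']. Qed.

Lemma citg_fourier f xi : citg mu f -> citg mu (fun x => (expi xi x)^* * f x).
Proof.
move=> [f1 f2]; split.
  apply: itg_eq (itgD (itg_fc xi f1) (itg_fs xi f2)) => x.
  by rewrite /= reimE /= mulNr opprK.
apply: itg_eq (itgB (itg_fc xi f2) (itg_fs xi f1)) => x.
by rewrite /= reimE /= mulNr.
Qed.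

Lemma fourierD f g xi : citg mu f -> citg mu g ->
  fourier (fun x => f x + g x) xi = fourier f xi + fourier g xi.
Proof.
move=> hf hg; rewrite !fourierE -cintD; try exact: citg_fourier.
by apply: cint_ext => x; rewrite mulrDr.
Qed.

Lemma fourierZ c f xi : citg mu f -> fourier (fun x => c * f x) xi = c * fourier f xi.
Proof.
move=> hf; rewrite !fourierE -cintZ; last exact: citg_fourier.
by apply: cint_ext => x; rewrite mulrCA.
Qed.

Lemma fourierB f g xi : citg mu f -> citg mu g ->
  fourier (fun x => f x - g x) xi = fourier f xi - fourier g xi.
Proof.
move=> hf hg; rewrite -mulN1r -fourierZ// -fourierD//; last exact: citgZ.
by congr fourier; apply/funext => x; rewrite mulN1r.
Qed.

Lemma cmeas_fourier f : citg mu f -> cmeas (fourier f).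
Proof.
move=> hf; have [f1 f2] := hf; split.
  rewrite (_ : _ \o _ = fun xi => fc (Re \o f) xi + fs (Im \o f) xi).
    by apply: measurable_funD; [exact: measurable_fc|exact: measurable_fs].
  by apply/funext => xi; exact: fourier_Re.
rewrite (_ : _ \o _ = fun xi => fc (Im \o f) xi - fs (Re \o f) xi).
  by apply: measurable_funB; [exact: measurable_fc|exact: measurable_fs].
by apply/funext => xi; exact: fourier_Im.
Qed.

Definition CL f := L12 (Re \o f) /\ L12 (Im \o f).

Lemma CL_citg f : CL f -> citg mu f.
Proof. by move=> [[? _] [? _]]. Qed.

Lemma CL_nsq f : CL f -> itg mu (nsq \o f).
Proof. by move=> [[_ h1] [_ h2]]; exact: itgD. Qed.

Lemma CLB f g : CL f -> CL g -> CL (fun x => f x - g x).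
Proof.
move=> [f1 f2] [g1 g2]; split.
  by apply: L12_eq (L12B f1 g1) => x; rewrite /= creD creN.
by apply: L12_eq (L12B f2 g2) => x; rewrite /= cimD cimN.
Qed.

Lemma fc_opp (u : E -> R) xi : fc u (- xi) = fc u xi.
Proof. by apply: Rint_ext => x; rewrite dotNr cosN. Qed.

Lemma fs_opp (u : E -> R) xi : itg mu u -> fs u (- xi) = - fs u xi.
Proof.
move=> iu; rewrite -mulN1r /fs -RintZ; last exact: itg_fs.
by apply: Rint_ext => x; rewrite dotNr sinN mulNr mulN1r.
Qed.

Lemma itg_mul_ft (u v : E -> R) : L12 u -> L12 v -> itg mu (fun xi => fc u xi * fs v xi).
Proof.
move=> hu hv; have [u1 _] := hu; have [v1 _] := hv.
apply: (itg_le _ _ (itgD (itg_ft2 hu) (itg_ft2 hv))).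
  by apply: measurable_funM; [exact: measurable_fc|exact: measurable_fs].
move=> xi; rewrite /ft2; move: (fc u xi) (fs u xi) (fc v xi) (fs v xi) => a b c e.
have := sqr_ge0 (a - e); have := sqr_ge0 (a + e).
have := sqr_ge0 a; have := sqr_ge0 b; have := sqr_ge0 c; have := sqr_ge0 e.
by rewrite ler_norml => *; apply/andP; split; nra.
Qed.

Lemma nsq_fourier f xi : citg mu f ->
  nsq (fourier f xi) = ft2 (Re \o f) xi + ft2 (Im \o f) xi +
   2 * (fc (Re \o f) xi * fs (Im \o f) xi - fc (Im \o f) xi * fs (Re \o f) xi).
Proof. by move=> hf; rewrite /nsq fourier_Re// fourier_Im// /ft2; ring. Qed.

(** For f = u + i v the squared modulus is that of u plus that of v plus a cross term that is odd in
    xi. Reflecting xi shows that the cross term integrates to zero, and the real formula applies to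
    u and v. *)
Lemma plancherel f : CL f ->
  itg mu (fun xi => nsq (fourier f xi)) /\
  \int[mu]_xi nsq (fourier f xi) = (2 * pi) ^+ n * \int[mu]_x nsq (f x).
Proof.
move=> hf; have hc := CL_citg hf; have [h1 h2] := hf.
set u := Re \o f; set v := Im \o f.
have iX : itg mu (fun xi => fc u xi * fs v xi - fc v xi * fs u xi).
  by apply: itgB; exact: itg_mul_ft.
have iuv : itg mu (fun xi => ft2 u xi + ft2 v xi) by apply: itgD; exact: itg_ft2.
have i0 : itg mu (fun xi => nsq (fourier f xi)).
  by apply: itg_eq (itgD iuv (itgZ 2 iX)) => xi; rewrite nsq_fourier.
split => //.
have X0 : \int[mu]_xi (fc u xi * fs v xi - fc v xi * fs u xi) = 0.
  have mn : measurable_fun setT (fun xi => (nsq (fourier f xi))%:E).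
    by apply/measurable_EFinP; exact: itg_meas i0.
  have := integral_oppv mn (fun xi => nsq_ge0 _ : (0 <= _%:E)%E).
  move=> /(congr1 fine) e.
  have e1 : \int[mu]_xi (ft2 u xi + ft2 v xi - 2 * (fc u xi * fs v xi - fc v xi * fs u xi)) =
            \int[mu]_xi (ft2 u xi + ft2 v xi + 2 * (fc u xi * fs v xi - fc v xi * fs u xi)).
    transitivity (\int[mu]_xi (nsq (fourier f (- xi)))).
      apply: Rint_ext => xi; rewrite (nsq_fourier (- xi) hc) /ft2 !fc_opp (fs_opp _ h1.1) (fs_opp _ h2.1).
      rewrite -/u -/v; ring.
    by rewrite {1}/Rintegral e; apply: Rint_ext => xi; rewrite (nsq_fourier _ hc).
  move: e1; rewrite (RintB iuv (itgZ 2 iX)) (RintD iuv (itgZ 2 iX)) (RintZ 2 iX).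
  exact: (@pm_eq0 R).
transitivity (\int[mu]_xi (ft2 u xi + ft2 v xi + 2 * (fc u xi * fs v xi - fc v xi * fs u xi))).
  by apply: Rint_ext => xi; rewrite (nsq_fourier _ hc).
rewrite (RintD iuv (itgZ 2 iX)) (RintZ 2 iX) X0 mulr0 addr0 (RintD (itg_ft2 h1) (itg_ft2 h2)).
rewrite (plancherel_real h1) (plancherel_real h2) -mulrDr; congr (_ * _).
by rewrite /nrm2 -(RintD h1.2 h2.2).
Qed.

Lemma fourier_resid f (phi : nat -> E -> R[i]) c m : citg mu f ->
  (forall k, citg mu (phi k)) ->
  citg mu (resid f c phi m) /\
  fourier (resid f c phi m) = resid (fourier f) c (fun k => fourier (phi k)) m.
Proof.
move=> hf hp; elim: m => [|m [IH1 IH2]].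
  rewrite (_ : resid f c phi 0 = f); last by apply/funext => x; rewrite /resid big_ord0 subr0.
  by split => //; apply/funext => x; rewrite /resid big_ord0 subr0.
have -> : resid f c phi m.+1 = fun x => resid f c phi m x - c m * phi m x.
  by apply/funext => x; rewrite /resid big_ord_recr /= opprD addrA.
have hz := citgZ (c m) (hp m).
split.
  apply: citg_ext (citgD IH1 (citgZ (-1) hz)) => x; by rewrite mulN1r.
apply/funext => xi; rewrite fourierB// IH2 fourierZ//.
by rewrite /resid big_ord_recr /= opprD addrA.
Qed.

End fourier_transform.

Section cauchy_schwarz.
Context {R : realType} {dp : measure_display} {T : measurableType dp}.
Variable mu : {measure set T -> \bar R}.
Variable w : T -> R.
Hypothesis mw : measurable_fun setT w.
Hypothesis w0 : forall x, 0 <= w x.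
Local Open Scope complex_scope.

Lemma wq_ge0 F : 0 <= wq mu w F.
Proof. by apply: Rintegral_ge0 => x _; rewrite mulr_ge0// nsq_ge0. Qed.

(** Expands the square of F - (z / M) G with z = (F, G). Dividing by a positive bound M instead of
    the squared norm of G covers the case of a vanishing norm. *)
Lemma wform_cs F G (M : R) : wsq mu w F -> wsq mu w G -> 0 < M -> wq mu w G <= M ->
  nsq (wform mu w F G) <= M * wq mu w F.
Proof.
move=> hF hG M0 GM.
set z := wform mu w F G; set c : R[i] := (- M^-1)%:C * z.
have hcG := wsqZ c hG.
have E : wform mu w (fun x => F x + c * G x) (fun x => F x + c * G x) =
   (wq mu w F + 2 * complex.Re (c^* * z) + nsq c * wq mu w G)%:C.
  have hD := wsqD mw hF hcG.
  rewrite (wformDl mw)// (wformZl mw)//.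
  rewrite (wformJ mw hD hF) (wformJ mw hD hG) !(wformDl mw)// !(wformZl mw)//.
  rewrite (wformJ mw hF hG) -/z !wform_diag//.
  clear hcG hD; move: c; move: z (wq _ _ _) (wq _ _ _) => z' a b c'; rewrite /nsq.
  by apply: complex_eq; rewrite !reimE /=; ring.
have := wq_ge0 (fun x => F x + c * G x).
move: E; rewrite (wform_diag (wsqD mw hF hcG)) => /complexI ->.
have -> : complex.Re (c^* * z) = - M^-1 * nsq z.
  by rewrite /c /nsq !reimE /=; ring.
have -> : nsq c = M^-1 ^+ 2 * nsq z.
  by rewrite /c /nsq !reimE /=; ring.
have Mi : 0 < M^-1 by rewrite invr_gt0.
have Mn : M != 0 by rewrite gt_eqF.
have h : M^-1 ^+ 2 * nsq z * wq mu w G <= M^-1 * nsq z.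
  rewrite expr2 -!mulrA ler_wpM2l ?(ltW Mi)// mulrCA ler_piMr ?nsq_ge0//.
  by rewrite mulrC ler_pdivrMr// mul1r.
move=> h'; rewrite -(ler_pM2l Mi) mulrA mulVf// mul1r.
move: h h'; move: (nsq z) (wq _ _ _) (wq _ _ _) (M^-1) => *; lra.
Qed.

End cauchy_schwarz.

(** * Bounds on the Riesz mean *)

Section ae_real.
Context {R : realType} {dp : measure_display} {T : measurableType dp}.
Variable mu : {measure set T -> \bar R}.

Lemma Rint_ae (f g : T -> R) : measurable_fun setT f -> measurable_fun setT g ->
  {ae mu, forall x, f x = g x} -> \int[mu]_x f x = \int[mu]_x g x.
Proof.
move=> mf mg fg; congr fine; apply: ae_eq_integral => //; try exact/measurable_EFinP.
by apply: filterS fg => x + _ => ->.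
Qed.

Lemma itg_ae (f g : T -> R) : measurable_fun setT f -> measurable_fun setT g ->
  {ae mu, forall x, f x = g x} -> itg mu f -> itg mu g.
Proof.
move=> mf mg fg /integrableP[_ h]; apply/integrableP; split; first exact/measurable_EFinP.
rewrite -(@ge0_ae_eq_integral _ _ _ mu setT (fun x => `|(EFin \o f) x|)%E)//.
- by apply/measurable_EFinP; apply: measurableT_comp.
- by apply/measurable_EFinP; apply: measurableT_comp.
- by apply: filterS fg => x + _ => /= ->.
Qed.

End ae_real.

Section translation.
Context {R : realType} {n : nat}.
Local Notation E := 'rV[R]_n.
Local Notation mu := (@lebesgue_rV R n).

Lemma measurable_translate (a : E) : measurable_fun setT (fun x : E => x + a).
Proof.
apply: measurable_fun_rVP => i; under eq_fun do rewrite mxE.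
by apply: measurable_funD => //; exact: measurable_coord_rV.
Qed.

(** Translation invariance carried over from nonnegative integrands through positive and negative
    parts. *)
Lemma Rint_shift (h : E -> R) a : itg mu h ->
  itg mu (fun x => h (x + a)) /\ \int[mu]_x h (x + a) = \int[mu]_x h x.
Proof.
move=> ih; have mh := itg_meas ih.
have mha := measurableT_comp mh (measurable_translate a).
have e (g : E -> \bar R) : measurable_fun setT g -> (forall x, 0 <= g x)%E ->
    (\int[mu]_x g (x + a)%R = \int[mu]_x g x)%E.
  exact: integral_translate.
have mE : measurable_fun setT (EFin \o h) by exact/measurable_EFinP.
split.
  apply/integrableP; split; first exact/measurable_EFinP.
  move/integrableP : ih => [_]; congr (_ < _)%E; apply/esym.
  by apply: (e (fun x => `|(h x)%:E|)%E) => //; exact: measurableT_comp.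
congr fine; rewrite integralE [RHS]integralE.
have e1 := e _ (measurable_funepos mE) (fun x => funepos_ge0 _ x).
have e2 := e _ (measurable_funeneg mE) (fun x => funeneg_ge0 _ x).
have p1 : (fun x => (h (x + a))%:E)^\+%E = (fun x => (EFin \o h)^\+%E (x + a)).
  by apply/funext => x; rewrite !funeposE.
have p2 : (fun x => (h (x + a))%:E)^\-%E = (fun x => (EFin \o h)^\-%E (x + a)).
  by apply/funext => x; rewrite !funenegE.
rewrite p1 p2; exact: (f_equal2 (fun u v : \bar R => (u - v)%E) e1 e2).
Qed.

End translation.

(** Here z and t are the sums of |c_k|^2 and of lambda_k |c_k|^2, x and y are the squared norm and
    the energy of the remainder, and s is the sum over the eigenvalues below l. *)
Lemma spectral_arith (R : realFieldType) (p l K x y z t s e : R) :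
  p * (l * z - t) <= p * s -> - (K * x) <= y -> (p * l + K) * x <= e ->
  p * l * (x + z) - (y + p * t) <= p * s + e.
Proof. by nra. Qed.

(** Here W and q are the squared norm and the energy of the modulated window, w = ln|xi|, M is the
    error C/|xi|, p M' its uniform bound, and g a nonnegative quantity given away. *)
Lemma window_arith (R : realFieldType) (p l W w q M t M' g : R) :
  p * l * W - q <= p * t -> q <= p * W * w + M -> M <= p * M' -> 0 <= p -> 0 <= g ->
  p * (W * (l - w) - g - M') <= p * t.
Proof. by move=> *; nra. Qed.

Lemma max_arith (R : realFieldType) (l a w : R) :
  a <= l -> Num.max 0 (l - w) <= (l - a) + Num.max 0 (a - w).
Proof. by move=> al; case: (leP 0 (l - w)) => q1; case: (leP 0 (a - w)) => q2; lra. Qed.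

Lemma sum_arith (R : realFieldType) (x y z w t : R) :
  x <= y + z -> 0 <= w -> 0 <= t -> x - y - z - w <= t.
Proof. by lra. Qed.

Section spectral.
Context {R : realType} {n : nat}.
Local Open Scope complex_scope.
Local Notation E := 'rV[R]_n.
Local Notation mu := (@lebesgue_rV R n).
Local Notation Re := (@complex.Re R).
Local Notation Im := (@complex.Im R).
Implicit Types f g : E -> R[i].

Definition wl (xi : E) : R := ln (enorm xi).
Definition volB : R := fine (mu (@unit_ball R n)).

Lemma volB_ge0 : 0 <= volB.
Proof. by apply: fine_ge0. Qed.

Lemma measurable_wl : measurable_fun setT wl.
Proof. by apply: (measurableT_comp (@measurable_ln R)); exact: measurable_enorm. Qed.

Definition logp (l : R) (xi : E) : R := Num.max 0 (l - wl xi).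

Lemma measurable_logp l : measurable_fun setT (logp l).
Proof. by apply: measurable_maxr => //; apply: measurable_funB => //; exact: measurable_wl. Qed.

Lemma logp_ge0 l xi : 0 <= logp l xi.
Proof. by rewrite le_max lexx. Qed.

Lemma logp_int l : (0 < n)%N ->
  itg mu (logp l) /\ \int[mu]_xi logp l xi = expR (n%:R * l) / n%:R * volB.
Proof.
move=> n0; have h := integral_log_ball l n0.
have e : (\int[mu]_x (logp l x)%:E = (expR (n%:R * l) / n%:R * volB)%:E)%E.
  by rewrite EFinM /volB -(@ball_volumeE R n) -h.
split; last by rewrite /Rintegral e.
by apply: itg_lty; [exact: measurable_logp|exact: logp_ge0|rewrite e ltry].
Qed.

(* ln|eta| <= ln|xi| + ln(1 + |eta - xi|/|xi|). *)
Lemma log_shift (xi eta : E) : 1 <= enorm xi ->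
  wl eta <= wl xi + (enorm xi)^-1 * enorm (eta - xi).
Proof.
move=> x1; have x0 : 0 < enorm xi by exact: lt_le_trans x1.
have tri : enorm eta <= enorm xi + enorm (eta - xi).
  by rewrite -{1}(subrK xi eta) addrC; exact: enormD.
have := enorm_ge0 (eta - xi); rewrite /wl; move: tri x1 x0.
move: (enorm (eta - xi)) (enorm eta) (enorm xi) => c a b abc b1 b0 c0.
have xr : 0 <= b^-1 * c by rewrite mulr_ge0// invr_ge0 ltW.
have [h0|h0] := ltP 0 a; last by rewrite (ln0 h0) addr_ge0// ln_ge0.
have hq : a / b <= 1 + b^-1 * c.
  by rewrite ler_pdivrMr// mulrDl mul1r mulrAC mulVf ?gt_eqF// mul1r.
rewrite -lerBlDl -ln_div ?posrE//.
apply: le_trans (_ : ln (1 + b^-1 * c) <= _).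
  by rewrite ler_ln ?posrE ?divr_gt0// ltr_pwDl.
by apply: le_ln1Dx; apply: lt_le_trans xr; rewrite ltrN10.
Qed.

Section domain.
Variables (Om : set E) (V : R).
Hypotheses (mOm : measurable Om) (V0 : 0 < V) (OmV : mu Om = V%:E).

Definition w1 : E -> R := \1_Om.

Lemma measurable_w1 : measurable_fun setT w1.
Proof. exact: measurable_indic. Qed.

Lemma w1_ge0 x : 0 <= w1 x.
Proof. by []. Qed.

Lemma w1_le1 x : `|w1 x| <= 1.
Proof. by rewrite /w1 indicE; case: (_ \in _); rewrite ?normr1 ?normr0. Qed.

Lemma w1_sqr x : w1 x * w1 x = w1 x.
Proof. by rewrite /w1 indicE; case: (_ \in _); rewrite ?mulr1 ?mulr0. Qed.

Lemma itg_w1 : itg mu w1.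
Proof. by apply: itg_indic => //; rewrite OmV ltry. Qed.

Lemma int_w1 : \int[mu]_x w1 x = V.
Proof. transitivity (fine (mu Om)); last by rewrite OmV.
by rewrite /Rintegral /w1 integral_indic// setIT. Qed.

Lemma wsq_expi xi : wsq mu w1 (expi xi).
Proof.
split; first exact: cmeas_expi.
by apply: itg_eq itg_w1 => x; rewrite nsq_expi mulr1.
Qed.

(* What is used of f in L^2(Om), phrased through integrals only so that it is
   insensitive to null sets. *)
Definition good f := [/\ CL f, wsq mu w1 f &
  forall xi, fourier f xi = wform mu w1 f (expi xi)].

(** f agrees almost everywhere with its product by the indicator of Om, and each part u of f
    satisfies |1_Om u| <= 1_Om + u^2, which is integrable because Om has finite measure. The other
    claims compare integrals of functions equal almost everywhere. *)
Lemma L2_good f : L2 Om f -> good f /\ \int[mu]_x nsq (f x) = wq mu w1 f.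
Proof.
move=> [f1 f2 f0].
have m1 : measurable_fun setT (Re \o f).
  by move: f1; rewrite inE => /andP[+ _]; rewrite inE.
have m2 : measurable_fun setT (Im \o f).
  by move: f2; rewrite inE => /andP[+ _]; rewrite inE.
have s1 := Lfun2_integrable_sqr f1.
have s2 := Lfun2_integrable_sqr f2.
have mw := measurable_w1.
have f0' : {ae mu, forall x, f x = (w1 x)%:C * f x}.
  apply: filterS f0 => x h; rewrite /w1 indicE.
  have [Ox|/h ->] := pselect (Om x); first by rewrite mem_set// mul1r.
  by rewrite mulr0.
have L12u (u : E -> R) : measurable_fun setT u -> itg mu (fun x => u x ^+ 2) ->
    {ae mu, forall x, u x = w1 x * u x} -> L12 u.
  move=> mu_ iu2 uae; split => //.
  apply: (@itg_ae _ _ _ _ (fun x => w1 x * u x)) => //.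
  - exact: measurable_funM.
  - by apply: filterS uae => x <-.
  - apply: (itg_le _ _ (itgD itg_w1 iu2)); first exact: measurable_funM.
    move=> x; have := w1_ge0 x; have := w1_sqr x; rewrite ler_norml.
    move: (w1 x) (u x) => a b e a0.
    by apply/andP; split; nra.
have hCL : CL f.
  split; apply: L12u => //; apply: filterS f0' => x e /=; by rewrite {1}e reimE /= !mul0r ?subr0 ?addr0.
have mn : measurable_fun setT (nsq \o f) by apply: measurable_nsq; split.
have iw : itg mu (fun x => w1 x * nsq (f x)).
  by apply: (itg_bM (C := 1)) (CL_nsq hCL) => //; exact: w1_le1.
split; last first.
  apply: Rint_ae => //; first exact: measurable_funM.
  apply: filterS f0' => x {1}->; rewrite nsqM; congr (_ * _).
  by rewrite /nsq /= expr0n addr0 expr2 w1_sqr.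
split => //.
have hc := CL_citg hCL.
move=> xi; have [c1 c2] := citg_fourier xi hc.
have wse := wsq_expi xi.
have [g1 g2] : citg mu (fun x => (w1 x)%:C * f x * (expi xi x)^*).
  by apply: citg_wform => //.
rewrite fourierE /wform; apply: complex_eq => /=.
  apply: Rint_ae; [exact: itg_meas c1|exact: itg_meas g1|].
  by apply: filterS f0' => x e; rewrite -e mulrC.
apply: Rint_ae; [exact: itg_meas c2|exact: itg_meas g2|].
by apply: filterS f0' => x e; rewrite -e mulrC.
Qed.

Lemma wq_expi xi : wq mu w1 (expi xi) = V.
Proof. by rewrite /wq -int_w1; apply: Rint_ext => x; rewrite nsq_expi mulr1. Qed.

Lemma L2dot_wform f g : L2dot Om f g = wform mu w1 f g.
Proof.
rewrite /L2dot /cintegral /wform /cint; congr (_ +i* _).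
  rewrite Rintegral_mkcond; apply: Rint_ext => x.
  by rewrite patchE /w1 indicE; case: (_ \in _); rewrite ?mul1r ?mul0r.
rewrite Rintegral_mkcond; apply: Rint_ext => x.
by rewrite patchE /w1 indicE; case: (_ \in _); rewrite ?mul1r ?mul0r.
Qed.

Lemma good_sub c f g : good f -> good g -> good (fun x => f x - c * g x).
Proof.
move=> [f1 f2 f3] [g1 g2 g3].
have hz := wsqZ (- c) g2.
have E : (fun x => f x - c * g x) = (fun x => f x + (- c) * g x).
  by apply/funext => x; rewrite mulNr.
rewrite E; split.
- have [[u1 u2] [v1 v2]] := (f1, g1); split.
    apply: L12_eq (L12D u1 (L12B (L12Z (Re (- c)) v1) (L12Z (Im (- c)) v2))) => x.
    by rewrite /= creD creM.
  apply: L12_eq (L12D u2 (L12D (L12Z (Re (- c)) v2) (L12Z (Im (- c)) v1))) => x.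
  by rewrite /= cimD cimM.
- by apply: wsqD => //; exact: measurable_w1.
- move=> xi; have [cf cg] := (CL_citg f1, CL_citg g1).
  rewrite fourierD//; last exact: citgZ.
  rewrite fourierZ// f3 g3 (wformDl measurable_w1 f2 hz (wsq_expi xi)).
  by rewrite (wformZl measurable_w1 _ g2 (wsq_expi xi)).
Qed.

Lemma good_resid f (phi : nat -> E -> R[i]) c m : good f -> (forall k, good (phi k)) ->
  good (resid f c phi m).
Proof.
move=> hf hp; elim: m => [|m IH].
  by rewrite (_ : resid f c phi 0 = f)//; apply/funext => x; rewrite /resid big_ord0 subr0.
rewrite (_ : resid f c phi m.+1 = fun x => resid f c phi m x - c m * phi m x).
  exact: good_sub.
by apply/funext => x; rewrite /resid big_ord_recr /= opprD addrA.
Qed.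

(** Cauchy-Schwarz on Om against the exponential, whose squared norm there is |Om|. *)
Lemma fourier_sup f xi : good f -> nsq (fourier f xi) <= V * wq mu w1 f.
Proof.
move=> [_ h2 ->].
apply: (wform_cs measurable_w1 w1_ge0 h2 (wsq_expi xi) V0).
by rewrite wq_expi.
Qed.

(** ln|xi| is negative only for |xi| < 1, where the squared transform is at most V |f|^2, and the
    integral of (- ln|xi|)_+ is |B| / n. *)
Lemma log_semibounded f : (0 < n)%N -> good f -> wsq mu wl (fourier f) ->
  - (V * volB / n%:R * wq mu w1 f) <= wq mu wl (fourier f).
Proof.
move=> n0 hf [hm hi]; have [il el] := logp_int 0 n0.
have -> : - (V * volB / n%:R * wq mu w1 f) =
   \int[mu]_xi (- (V * wq mu w1 f) * logp 0 xi).
  by rewrite RintZ// el mulr0 expR0; field; rewrite pnatr_eq0 -lt0n.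
apply: Rint_le => //; first exact: itgZ.
move=> xi; have := fourier_sup xi hf; have := nsq_ge0 (fourier f xi).
rewrite /logp sub0r; move: (nsq _) (V * _) (wl xi) => a b w a0 ab.
have [w0|w0] := leP 0 w; first by rewrite max_l ?oppr_le0// mulr0 mulr_ge0.
rewrite max_r; last by rewrite oppr_ge0 ltW.
nra.
Qed.

Section eigen.
Variables (phi : nat -> E -> R[i]) (lam : nat -> R).
Hypotheses (gphi : forall k, good (phi k)).
Hypotheses (ephi : forall k, wsq mu wl (fourier (phi k))).
Hypotheses (ophi : forall j k, wform mu w1 (phi j) (phi k) = (j == k)%:R).
Hypotheses (lphi : forall j k, wform mu wl (fourier (phi j)) (fourier (phi k)) =
   ((2 * pi) ^+ n * lam j)%:C * (j == k)%:R).
Hypotheses (nphi : forall k, \int[mu]_x nsq (phi k x) = 1).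

Lemma wsq_phi k : wsq mu w1 (phi k).
Proof. by have [] := gphi k. Qed.

Lemma ophi' j k : wform mu w1 (phi j) (phi k) = 1%:C * (j == k)%:R.
Proof. by rewrite ophi mul1r. Qed.

Lemma bessel f m : wsq mu w1 f ->
  \sum_(k < m) nsq (wform mu w1 f (phi k)) <= wq mu w1 f.
Proof.
move=> hf.
have [h1 h2] := @gram_expand _ _ _ mu w1 measurable_w1 f phi (fun k => wform mu w1 f (phi k))
  (fun k => wform mu w1 f (phi k)) (fun=> 1) m hf wsq_phi
  (fun k => etrans (wformJ measurable_w1 hf (wsq_phi k)) (esym (mul1r _))) ophi'.
have := wq_ge0 mu w1_ge0 (resid f (fun k => wform mu w1 f (phi k)) phi m).
rewrite h2 subr_ge0; congr (_ <= _); apply: eq_bigr => k _.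
by rewrite subrr mul1r /nsq /= expr0n addr0 subr0.
Qed.

Lemma bessel_fourier xi m : \sum_(k < m) nsq (fourier (phi k) xi) <= V.
Proof.
rewrite -(wq_expi xi); apply: le_trans (bessel m (wsq_expi xi)).
apply: ler_sum => k _; have [_ _ ->] := gphi k.
by rewrite (wformJ measurable_w1 (wsq_expi xi) (wsq_phi k)) nsqJ.
Qed.

Lemma eigen_energy k : wq mu wl (fourier (phi k)) = (2 * pi) ^+ n * lam k.
Proof.
have := lphi k k; rewrite eqxx mulr1 wform_diag; last exact: ephi.
by move/complexI.
Qed.

Lemma eigen_mass k : itg mu (fun xi => nsq (fourier (phi k) xi)) /\
  \int[mu]_xi nsq (fourier (phi k) xi) = (2 * pi) ^+ n.
Proof.
have [h _ _] := gphi k; have [h1 h2] := plancherel h.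
by split => //; rewrite h2 nphi mulr1.
Qed.

Lemma riesz_upper l m : (0 < n)%N ->
  (2 * pi) ^+ n * \sum_(k < m) (l - lam k) <= V * volB * expR (n%:R * l) / n%:R.
Proof.
move=> n0; have [il el] := logp_int l n0.
have ik k : itg mu (fun xi => (l - wl xi) * nsq (fourier (phi k) xi)).
  have [h1 _] := eigen_mass k; have [_ h2] := ephi k.
  by apply: itg_eq (itgB (itgZ l h1) h2) => xi; rewrite mulrBl.
have -> : (2 * pi) ^+ n * \sum_(k < m) (l - lam k) =
    \int[mu]_xi \sum_(k < m) ((l - wl xi) * nsq (fourier (phi k) xi)).
  rewrite Rint_sum// mulr_sumr; apply: eq_bigr => k _.
  have [h1 h3] := eigen_mass k; have [_ h2] := ephi k.
  rewrite (Rint_ext _ (g := fun xi => l * nsq (fourier (phi k) xi) - wl xi * nsq (fourier (phi k) xi))); last first.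
    by move=> xi; rewrite mulrBl.
  rewrite (RintB (itgZ l h1) h2) (RintZ l h1) h3.
  have := eigen_energy k; rewrite /wq => ->; ring.
have -> : V * volB * expR (n%:R * l) / n%:R = \int[mu]_xi (V * logp l xi).
  by rewrite RintZ// el; ring.
apply: Rint_le; [exact: itg_sum|exact: itgZ|].
move=> xi; rewrite -mulr_sumr; have := bessel_fourier xi m.
have : 0 <= \sum_(k < m) nsq (fourier (phi k) xi) by apply: sumr_ge0 => k _; exact: nsq_ge0.
rewrite /logp; move: (\sum_(k < m) _) (l - wl xi) => a w a0 aV.
have [w0|w0] := leP 0 w; first by rewrite (mulrC V) ler_wpM2l.
by rewrite mulr0; apply: mulr_le0_ge0 => //; exact: ltW.
Qed.

Section lower.
Variables (l : R) (N : nat).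
Hypotheses (l0 : 0 <= l) (hN : forall k, (k < N)%N = (lam k < l)).

(** The factor l - lambda_k is positive exactly for k < N, so stopping at N maximises the partial
    sums. *)
Lemma sum_pos_part (a : nat -> R) m : (forall k, 0 <= a k) ->
  \sum_(k < m) (l - lam k) * a k <= \sum_(k < N) (l - lam k) * a k.
Proof.
move=> a0.
have h M : \sum_(k < M) (l - lam k) * a k <= \sum_(k < minn M N) (l - lam k) * a k.
  have [MN|NM] := leqP M N; first by rewrite lexx.
  rewrite -!(big_mkord xpredT (fun k => (l - lam k) * a k)) (big_cat_nat (leq0n N) (ltnW NM)) /=.
  rewrite gerDl big_nat; apply: sumr_le0 => k /andP[Nk _].
  by rewrite mulr_le0_ge0// subr_le0 leNgt -hN -leqNgt.
apply: le_trans (h m) _.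
rewrite -!(big_mkord xpredT (fun k => (l - lam k) * a k)) [leRHS](big_cat_nat (leq0n _) (geq_minr m N)) /=.
rewrite lerDl big_nat; apply: sumr_ge0 => k /andP[_ kN].
by rewrite mulr_ge0// subr_ge0 ltW// -hN.
Qed.

(* Expanding the remainder of f after m eigenfunctions, whose logarithmic
   energy is at least - K times its squared norm, and letting m tend to oo. *)
Lemma spectral_lower f : (0 < n)%N -> good f -> wsq mu wl (fourier f) ->
  (forall k, wform mu wl (fourier (phi k)) (fourier f) =
     ((2 * pi) ^+ n * lam k)%:C * wform mu w1 (phi k) f) ->
  (forall eps : R, 0 < eps -> exists m (b : nat -> R[i]), wq mu w1 (resid f b phi m) < eps) ->
  (2 * pi) ^+ n * l * wq mu w1 f - wq mu wl (fourier f) <=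
  (2 * pi) ^+ n * \sum_(k < N) (l - lam k) * nsq (wform mu w1 f (phi k)).
Proof.
move=> n0 hf ef lf cf; have [hc hw _] := hf.
set p := (2 * pi) ^+ n; have p0 : 0 < p by rewrite exprn_gt0// mulr_gt0// pi_gt0.
pose c k := wform mu w1 f (phi k).
have g1 k : wform mu w1 (phi k) f = 1%:C * (c k)^*.
  by rewrite mul1r (wformJ measurable_w1 hw (wsq_phi k)).
have g2 k : wform mu wl (fourier (phi k)) (fourier f) = (p * lam k)%:C * (c k)^*.
  by rewrite lf g1 mul1r.
set K := V * volB / n%:R.
have K0 : 0 <= K by apply: divr_ge0 => //; apply: mulr_ge0; [exact: ltW|exact: volB_ge0].
apply/ler_addgt0Pr => e e0.
(* The squared norm of the remainder enters the final estimate with the factor p l + K; the added 1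
   keeps the denominator positive. *)
have [|m [b bm]] := cf (e / (p * l + K + 1)).
  by rewrite divr_gt0// ltr_wpDl// addr_ge0// mulr_ge0// ltW.
have [_ q1] := @gram_expand _ _ _ mu w1 measurable_w1 f phi c c (fun=> 1) m hw wsq_phi g1 ophi'.
have [_ q2] := @gram_expand _ _ _ mu w1 measurable_w1 f phi c b (fun=> 1) m hw wsq_phi g1 ophi'.
have [w3 q3] := @gram_expand _ _ _ mu wl measurable_wl (fourier f) (fun k => fourier (phi k)) c c
  (fun k => p * lam k) m ef ephi g2 lphi.
have S1 (L : nat -> R) : \sum_(k < m) L k * (nsq (c k) - nsq (c k - c k)) = \sum_(k < m) L k * nsq (c k).
  by apply: eq_bigr => k _; rewrite subrr /nsq /= expr0n addr0 subr0.
rewrite (S1 (fun=> 1)) in q1; rewrite (S1 (fun k => p * lam k)) in q3.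
(* Completeness supplies unspecified coefficients b; the Fourier coefficients c do at least as
   well. *)
have qle : wq mu w1 (resid f c phi m) < e / (p * l + K + 1).
  apply: le_lt_trans bm; rewrite q1 q2 lerD2l lerN2.
  by apply: ler_sum => k _; rewrite mul1r mul1r gerBl nsq_ge0.
have gr := good_resid c m hf gphi.
have [_ fr] := fourier_resid c m (CL_citg hc) (fun k => CL_citg (let: And3 h _ _ := gphi k in h)).
have := log_semibounded n0 gr; rewrite fr => /(_ w3); rewrite -/K => sb.
have sp := @sum_pos_part (fun k => nsq (c k)) m (fun k => nsq_ge0 _).
have q1' : wq mu w1 f = wq mu w1 (resid f c phi m) + \sum_(k < m) nsq (c k).
  by rewrite q1; under eq_bigr do rewrite mul1r; rewrite subrK.
have q3' : wq mu wl (fourier f) = wq mu wl (resid (fourier f) c (fun k => fourier (phi k)) m)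
   + p * \sum_(k < m) lam k * nsq (c k).
  rewrite q3 mulr_sumr; under [X in _ - X + _]eq_bigr do rewrite -mulrA; by rewrite subrK.
have r0 := wq_ge0 mu w1_ge0 (resid f c phi m).
have qle' : (p * l + K) * wq mu w1 (resid f c phi m) <= e.
  have D0 : 0 < p * l + K + 1 by rewrite ltr_wpDl// addr_ge0// mulr_ge0// ltW.
  move: qle; rewrite ltr_pdivlMr// => /ltW; apply: le_trans.
  by rewrite mulrC ler_wpM2l// lerDl.
rewrite q1' q3'.
have sp' : p * (l * \sum_(k < m) nsq (c k) - \sum_(k < m) lam k * nsq (c k)) <=
   p * \sum_(k < N) (l - lam k) * nsq (c k).
  rewrite ler_wpM2l ?(ltW p0)//; apply: le_trans sp.
  rewrite mulr_sumr -sumrB le_eqVlt; apply/orP; left; apply/eqP.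
  by apply: eq_bigr => k _; rewrite mulrBl.
exact: (spectral_arith sp' sb qle').
Qed.

(** * Modulated windows as trial functions *)

Section window.
Variable u : E -> R.
Hypotheses (Lu : L12 u) (su : forall x, u x = w1 x * u x) (u1 : forall x, `|u x| <= 1).
Let uC (x : E) : R[i] := (u x)%:C.
Hypothesis iM : itg mu (fun xi => enorm xi * nsq (fourier uC xi)).

Definition modul (xi x : E) : R[i] := (u x)%:C * expi xi x.

Lemma measurable_u : measurable_fun setT u.
Proof. exact: itg_meas Lu.1. Qed.

Lemma CL_uM f : CL f -> CL (fun x => (u x)%:C * f x).
Proof.
have mu_ := measurable_u.
have h (v : E -> R) : L12 v -> L12 (fun x => u x * v x).
  move=> [v1 v2]; split; first exact: (itg_bM mu_ u1 v1).
  apply: itg_eq (itg_bM (C := 1) (measurable_funX 2 mu_) _ v2) => x.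
    by rewrite exprMn.
  by rewrite normrX exprn_ile1.
move=> [f1 f2]; split.
  by apply: L12_eq (h _ f1) => x; rewrite /= reimE /= mul0r subr0.
by apply: L12_eq (h _ f2) => x; rewrite /= reimE /= mul0r addr0.
Qed.

Lemma good_supported f : CL f -> (forall x, f x = (w1 x)%:C * f x) -> good f.
Proof.
move=> hf sf; split => //.
  split; first by split; [exact: itg_meas hf.1.1|exact: itg_meas hf.2.1].
  by apply: (itg_bM (C := 1)) (CL_nsq hf); [exact: measurable_w1|exact: w1_le1].
move=> xi; rewrite fourierE; apply: cint_ext => x.
by rewrite -sf mulrC.
Qed.

Lemma CL_uC : CL uC.
Proof.
split; first by apply: L12_eq Lu.
by split; [exact: itg0|apply: itg_eq (itg0 mu) => x; rewrite expr0n].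
Qed.

Lemma CL_modul xi : CL (modul xi).
Proof.
have mu_ := measurable_u; have [v1 v2] := Lu.
have sq (h : E -> R) : measurable_fun setT h -> (forall x, `|h x| <= 1) -> L12 (fun x => h x * u x).
  move=> mh h1; split; first exact: (itg_bM mh h1 v1).
  apply: itg_eq (itg_bM (C := 1) (measurable_funX 2 mh) _ v2) => x.
    by rewrite exprMn.
  by rewrite normrX exprn_ile1.
split.
  apply: L12_eq (sq _ (measurable_cosdot' xi) (fun x => cos_le1 _)) => x.
  by rewrite -[RHS]/(Re ((u x)%:C * expi xi x)) creM /= mul0r subr0 mulrC.
apply: L12_eq (sq _ (measurable_sindot' xi) (fun x => sin_le1 _)) => x.
by rewrite -[RHS]/(Im ((u x)%:C * expi xi x)) cimM /= mul0r addr0 mulrC.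
Qed.

Lemma good_modul xi : good (modul xi).
Proof.
apply: good_supported; first exact: CL_modul.
move=> x; rewrite /modul {1}su mulrA; congr (_ * _).
by apply: complex_eq; rewrite reimE /=; ring.
Qed.

Lemma fourier_modul xi eta : fourier (modul xi) eta = fourier uC (eta - xi).
Proof.
rewrite !fourierE; apply: cint_ext => x.
rewrite /modul /uC /expi dotDr dotNr cosB sinB.
by apply: complex_eq; rewrite !reimE /=; ring.
Qed.

(** Where ln|xi| is negative the transform is bounded and (- ln|xi|)_+ is integrable; elsewhere g
    dominates. It is applied with g = |xi| to the windows and with g = log(e + |xi|) to the
    eigenfunctions. *)
Lemma wsq_wl f (g : E -> R) : (0 < n)%N -> good f -> (forall xi, 0 <= g xi) ->
  (forall xi, wl xi <= g xi) -> itg mu (fun xi => g xi * nsq (fourier f xi)) ->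
  wsq mu wl (fourier f).
Proof.
move=> n0 hf g0 wg ig; have [hc _ _] := hf; have [il _] := logp_int 0 n0.
have mf := cmeas_fourier (CL_citg hc).
split => //.
apply: (itg_le _ _ (itgD (itgZ (V * wq mu w1 f) il) ig)).
  by apply: measurable_funM; [exact: measurable_wl|exact: measurable_nsq].
move=> xi; have := fourier_sup xi hf; have := nsq_ge0 (fourier f xi).
have := g0 xi; have := wg xi; rewrite normrM /logp sub0r.
move: (nsq _) (V * _) (wl xi) (g xi) => a b w c wc c0 a0 ab.
rewrite [X in _ * X]ger0_norm//; have [w0|w0] := leP 0 w.
  by rewrite max_l ?oppr_le0// mulr0 add0r ler_wpM2r// ger0_norm.
rewrite max_r; last by rewrite oppr_ge0 ltW.
rewrite ltr0_norm//; apply: (@le_trans _ _ (b * - w)); last by rewrite lerDl mulr_ge0.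
by rewrite mulrC ler_wpM2r// oppr_ge0 ltW.
Qed.

Lemma wl_le_enorm xi : wl xi <= enorm xi.
Proof.
have [s0|s0] := ltP 0 (enorm xi); last by rewrite /wl ln0// enorm_ge0.
have h : -1 < enorm xi - 1 by rewrite ltrBDr addNr.
have := le_ln1Dx h; rewrite addrC subrK => /le_trans; apply.
by rewrite gerBl.
Qed.

Let nu (xi : E) : R := nsq (fourier uC xi).

Lemma nu_int : itg mu nu /\ \int[mu]_xi nu xi = (2 * pi) ^+ n * nrm2 u.
Proof.
have [h1 h2] := plancherel CL_uC; split => //; rewrite h2; congr (_ * _).
by apply: Rint_ext => x; rewrite /nsq /uC /= expr0n addr0.
Qed.

Lemma wsq_modul xi : (0 < n)%N -> wsq mu wl (fourier (modul xi)).
Proof.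
move=> n0; apply: (@wsq_wl _ (@enorm R n) n0 (good_modul xi)).
- exact: enorm_ge0.
- exact: wl_le_enorm.
have [inu _] := nu_int.
have [i1 _] := Rint_shift (- xi) inu.
have [i2 _] := Rint_shift (- xi) iM.
apply: (itg_le _ _ (itgD (itgZ (enorm xi) i1) i2)).
  apply: measurable_funM; first exact: measurable_enorm.
  exact: measurable_nsq (cmeas_fourier (CL_citg (CL_modul xi))).
move=> eta; rewrite fourier_modul ger0_norm; last by rewrite mulr_ge0 ?enorm_ge0 ?nsq_ge0.
rewrite /nu -mulrDl ler_wpM2r ?nsq_ge0//.
by rewrite -{1}(subrK xi eta) addrC; exact: enormD.
Qed.

Lemma wq_modul xi : wq mu w1 (modul xi) = nrm2 u.
Proof.
apply: Rint_ext => x; rewrite nsqM nsq_expi mulr1 /nsq /= expr0n addr0.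
have := w1_sqr x; have := su x; move: (w1 x) (u x) => a b e1 e2.
by rewrite {2}e1 exprMn (expr2 a) e2.
Qed.

(** Modulation translates the transform of u by xi, so [log_shift] is integrated against the
    translate: the mass of |u^|^2 multiplies ln|xi|, its first moment multiplies 1/|xi|. *)
Lemma energy_modul xi : (0 < n)%N -> 1 <= enorm xi ->
  wq mu wl (fourier (modul xi)) <=
  (2 * pi) ^+ n * nrm2 u * wl xi + (\int[mu]_eta (enorm eta * nu eta)) / enorm xi.
Proof.
move=> n0 x1; have x0 : 0 < enorm xi by exact: lt_le_trans x1.
have [inu enu] := nu_int.
have [i1 e1] := Rint_shift (- xi) inu.
have [i2 e2] := Rint_shift (- xi) iM.
have [_ i3] := wsq_modul xi n0.
have -> : (2 * pi) ^+ n * nrm2 u * wl xi + (\int[mu]_eta (enorm eta * nu eta)) / enorm xi =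
  \int[mu]_eta (wl xi * nu (eta - xi) + (enorm xi)^-1 * (enorm (eta - xi) * nu (eta - xi))).
  rewrite (RintD (itgZ _ i1) (itgZ _ i2)) (RintZ _ i1) (RintZ _ i2) e1 e2 enu.
  by rewrite (mulrC (wl xi)) (mulrC _^-1).
apply: (Rint_le i3 (itgD (itgZ _ i1) (itgZ _ i2))).
move=> eta; rewrite fourier_modul -/(nu (eta - xi)) mulrA -mulrDl.
apply: (ler_wpM2r (nsq_ge0 _)).
exact: log_shift.
Qed.

(** Up to conjugation the coefficient of the modulated window is the transform of u phi_k at xi.
    Integration over xi is thus Plancherel for u phi_k, of norm at most 1. *)
Lemma coef_modul xi k : nsq (wform mu w1 (modul xi) (phi k)) =
  nsq (fourier (fun x => (u x)%:C * phi k x) xi).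
Proof.
have [h _ _] := gphi k; have hu := CL_uM h.
rewrite -[RHS]nsqJ fourierE -cintJ; last exact: citg_fourier (CL_citg hu).
congr nsq; apply: cint_ext => x.
have E : (w1 x)%:C * (u x)%:C = (u x)%:C by rewrite -rmorphM -su.
rewrite /modul mulrA E.
by apply: complex_eq; rewrite !reimE /=; ring.
Qed.

Lemma mass_uphi k : itg mu (fun xi => nsq (fourier (fun x => (u x)%:C * phi k x) xi)) /\
  \int[mu]_xi nsq (fourier (fun x => (u x)%:C * phi k x) xi) <= (2 * pi) ^+ n.
Proof.
have [h _ _] := gphi k; have hu := CL_uM h.
have [h1 h2] := plancherel hu; split => //; rewrite h2.
rewrite -[leRHS]mulr1 ler_wpM2l ?exprn_ge0 ?mulr_ge0 ?pi_ge0// -(nphi k).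
apply: Rint_le; [exact: CL_nsq hu|exact: CL_nsq h|].
move=> x; rewrite nsqM ler_piMl ?nsq_ge0// /nsq /= expr0n addr0 -real_normK ?num_real//.
by rewrite exprn_ile1.
Qed.

Lemma itg_ball r : 0 < r -> itg mu (\1_[set x : E | enorm x < r]) /\
  \int[mu]_x (\1_[set x : E | enorm x < r] x) = r ^+ n * volB.
Proof.
move=> r0; have mB := @measurable_enorm_lt R n r.
have e : mu [set x : E | enorm x < r] = (r ^+ n * volB)%:E.
  by rewrite ball_volume// EFinM /volB -(@ball_volumeE R n).
split; first by apply: itg_indic => //; rewrite e ltry.
transitivity (fine (mu [set x : E | enorm x < r])); last by rewrite e.
by rewrite /Rintegral integral_indic// setIT.
Qed.

Hypothesis lmod : forall xi k, wform mu wl (fourier (phi k)) (fourier (modul xi)) =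
     ((2 * pi) ^+ n * lam k)%:C * wform mu w1 (phi k) (modul xi).
Hypothesis cmod : forall xi (eps : R), 0 < eps ->
  exists m (b : nat -> R[i]), wq mu w1 (resid (modul xi) b phi m) < eps.

(** The parameter a splits frequency space. In |xi| < e^a nothing is claimed, which costs the second
    and third terms; for e^a <= |xi| < e^l the error C/|xi| is at most C e^(-a), which integrates to
    the last term. *)
Lemma riesz_lower a : (0 < n)%N -> 0 <= a -> a <= l ->
  nrm2 u * (expR (n%:R * l) / n%:R * volB)
   - nrm2 u * (l - a) * (expR (n%:R * a) * volB)
   - nrm2 u * (expR (n%:R * a) / n%:R * volB)
   - (\int[mu]_eta (enorm eta * nu eta)) / (2 * pi) ^+ n / expR a * (expR (n%:R * l) * volB)
  <= (2 * pi) ^+ n * \sum_(k < N) (l - lam k).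
Proof.
move=> n0 a0 al; set M := \int[mu]_eta _; set p := (2 * pi) ^+ n.
have p0 : 0 < p by rewrite exprn_gt0// mulr_gt0// pi_gt0.
have M0 : 0 <= M by apply: Rintegral_ge0 => x _; rewrite mulr_ge0 ?enorm_ge0// nsq_ge0.
have W0 : 0 <= nrm2 u by apply: Rintegral_ge0 => x _; exact: sqr_ge0.
have [il el] := logp_int l n0; have [ia ea] := logp_int a n0.
have [bl vl] := itg_ball (expR_gt0 l); have [ba va] := itg_ball (expR_gt0 a).
rewrite -expRM_natl in vl; rewrite -expRM_natl in va.
pose T (xi : E) := \sum_(k < N) (l - lam k) * nsq (fourier (fun x => (u x)%:C * phi k x) xi).
have iT : itg mu T by apply: itg_sum => k; apply: itgZ; exact: (mass_uphi k).1.
have lk (k : 'I_N) : 0 <= l - lam k by rewrite subr_ge0 ltW// -hN.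
have T0 xi : 0 <= T xi by apply: sumr_ge0 => k _; rewrite mulr_ge0 ?nsq_ge0.
apply: (@le_trans _ _ (\int[mu]_xi T xi)); last first.
  rewrite /T Rint_sum; last by move=> k; apply: itgZ; exact: (mass_uphi k).1.
  rewrite mulr_sumr; apply: ler_sum => k _.
  have [h1 h2] := mass_uphi k.
  by rewrite (RintZ _ h1) mulrC ler_wpM2r.
set M' := M / p / expR a.
have i1 := itgZ (nrm2 u) il; have i2 := itgZ (nrm2 u * (l - a)) ba.
have i3 := itgZ (nrm2 u) ia; have i4 := itgZ M' bl.
rewrite -el -ea -vl -va -(RintZ _ il) -(RintZ _ ba) -(RintZ _ ia) -(RintZ _ bl).
rewrite -(RintB i1 i2) -(RintB (itgB i1 i2) i3) -(RintB (itgB (itgB i1 i2) i3) i4).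
apply: (Rint_le (itgB (itgB (itgB i1 i2) i3) i4) iT) => xi.
have M'0 : 0 <= M' by rewrite !divr_ge0 ?expR_ge0// ltW.
have ga := logp_ge0 a xi; have gl := logp_ge0 l xi; have Tx := T0 xi.
have la0 : 0 <= l - a by rewrite subr_ge0.
rewrite !indicE; have [ha|ha] := ltP (enorm xi) (expR a).
  (* In the small ball the subtracted terms already outweigh [logp l], and T >= 0 suffices. *)
  rewrite (@mem_set _ [set x | enorm x < expR a] xi)// mulr1.
  have h : logp l xi <= (l - a) + logp a xi.
    exact: max_arith.
  have h1 : nrm2 u * logp l xi <= nrm2 u * (l - a) + nrm2 u * logp a xi.
    by rewrite -mulrDr ler_wpM2l.
  have h2 : 0 <= M' * (xi \in [set x | enorm x < expR l])%:R by rewrite mulr_ge0.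
  exact: (sum_arith h1 h2 Tx).
rewrite (@memNset _ [set x | enorm x < expR a] xi)/= ?ltNge ?ha// mulr0 subr0.
have x1 : 1 <= enorm xi by apply: le_trans ha; rewrite -[leLHS](@expR0 R) ler_expR.
have x0 : 0 < enorm xi by exact: lt_le_trans x1.
have h3 : 0 <= nrm2 u * logp a xi by rewrite mulr_ge0.
have [hl|hl] := ltP (enorm xi) (expR l); last first.
  (* Beyond radius e^l the positive part vanishes, so the left side is at most 0. *)
  rewrite (@memNset _ [set x | enorm x < expR l] xi)/= ?ltNge ?hl// mulr0 subr0.
  rewrite {1}/logp max_l ?mulr0 ?sub0r; last by rewrite subr_le0 -ler_expR /wl lnK.
  by apply: le_trans Tx; rewrite oppr_le0.
rewrite (@mem_set _ [set x | enorm x < expR l] xi)// mulr1.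
(* The shell e^a <= |xi| < e^l, where the spectral inequality is used. *)
have := spectral_lower n0 (good_modul xi) (wsq_modul xi n0) (lmod xi) (cmod xi).
rewrite wq_modul (eq_bigr (fun k : 'I_N => (l - lam k) * nsq (fourier (fun x => (u x)%:C * phi k x) xi))); last first.
  by move=> k _; rewrite coef_modul.
rewrite -/(T xi) -/p => sl.
have := energy_modul n0 x1; rewrite -/p -/M => en.
have Ms : M / enorm xi <= p * M'.
  have -> : p * M' = M / expR a.
    by rewrite /M' mulrA; congr (_ / _); rewrite mulrC divfK// gt_eqF.
  by apply: ler_wpM2l => //; rewrite lef_pV2 ?posrE ?expR_gt0.
have lE : logp l xi = l - wl xi.
  by rewrite /logp max_r// subr_ge0 ltW// -ltr_expR /wl lnK.
rewrite lE -(ler_pM2l p0).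
exact: (window_arith sl en Ms (ltW p0) h3).
Qed.

End window.

End lower.
End eigen.
End domain.
End spectral.

(** * Smooth cutoffs *)

Section flat_exponential.
Context {R : realType}.

(** Differentiating e^(-1/t) produces powers of 1/t; carrying the power k in the definition makes
    the family closed under derivatives up to linear combination. *)
Definition flat (k : nat) (t : R) : R := if 0 < t then t^-1 ^+ k * expR (- t^-1) else 0.

Lemma flat_ge0 k t : 0 <= flat k t.
Proof.
rewrite /flat; case: ifP => // t0; apply: mulr_ge0; last exact: expR_ge0.
by apply: exprn_ge0; rewrite invr_ge0 ltW.
Qed.

Lemma flat0_le1 t : flat 0 t <= 1.
Proof.
rewrite /flat; case: ifP => // t0; rewrite expr0 mul1r expR_le1// oppr_le0.
by rewrite invr_ge0 ltW.
Qed.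

Lemma flat0_gt0 t : (0 < flat 0 t) = (0 < t).
Proof. by rewrite /flat; case: ifP => // t0; rewrite ?ltxx// expr0 mul1r expR_gt0. Qed.

(** With s = 1/t this is s^(k+1) <= (k+1)^(k+1) e^s, the (k+1)-st power of s/(k+1) <= e^(s/(k+1)).
    The linear decay at 0 is what the derivative there needs. *)
Lemma flat_le k t : flat k t <= k.+1%:R ^+ k.+1 * `|t|.
Proof.
rewrite /flat; case: ifP => t0; last by rewrite mulr_ge0 ?exprn_ge0.
rewrite (gtr0_norm t0); set s := t^-1; have s0 : 0 < s by rewrite invr_gt0.
have -> : t = s^-1 by rewrite invrK.
rewrite expRN ler_pdivrMr ?expR_gt0// mulrAC ler_pdivlMr// -exprSr.
have -> : s ^+ k.+1 = k.+1%:R ^+ k.+1 * (s / k.+1%:R) ^+ k.+1.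
  by rewrite -exprMn mulrC divfK// pnatr_eq0.
rewrite ler_wpM2l ?exprn_ge0//.
have -> : expR s = expR (s / k.+1%:R) ^+ k.+1.
  by rewrite -expRM_natl mulrC divfK// pnatr_eq0.
apply: lerXn2r; rewrite ?nnegrE ?expR_ge0 ?divr_ge0 ?(ltW s0)//.
by apply: le_trans (expR_ge1Dx _); rewrite lerDr.
Qed.

Lemma flat_continuous0 k : flat k t @[t --> 0^'] --> 0.
Proof.
apply: (@squeeze_cvgr _ _ _ _ (fun=> 0) (fun t => k.+1%:R ^+ k.+1 * `|t|)); last 2 first.
- exact: cvg_cst.
- rewrite -[X in _ --> X](mulr0 (k.+1%:R ^+ k.+1)); apply: cvgMr.
  apply: cvg_trans (_ : (fun t : R => `|t|) @ 0 --> 0).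
    by apply: cvg_app; exact: nbhs_dnbhs.
  by have := @norm_continuous _ R^o 0; rewrite /continuous_at normr0.
by near=> t; rewrite flat_ge0 flat_le.
Unshelve. all: by end_near. Qed.

Lemma is_derive_flat k (t : R) :
  is_derive t 1 (flat k) (flat k.+2 t - k%:R * flat k.+1 t).
Proof.
have [t0|t0|->] := ltgtP t 0.
- rewrite /flat (ltNge 0 t) (ltW t0) /= mulr0 subr0.
  apply: (@near_eq_is_derive _ _ _ (cst 0)).
  by near=> s; rewrite /= ltNge ltW//; near: s; exact: lt_nbhsl.
- rewrite /flat t0.
  have d1 : is_derive t 1 (fun s : R => s^-1 ^+ k * expR (- s^-1))
     (t^-1 ^+ k.+2 * expR (- t^-1) - k%:R * (t^-1 ^+ k.+1 * expR (- t^-1))).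
    have tn : t != 0 by rewrite gt_eqF.
    have dV : is_derive t 1 (fun s : R => s^-1) (- t^-1 ^+ 2).
      apply: DeriveDef; first exact: derivableV.
      by rewrite deriveV// derive_id /GRing.scale /= mulr1 exprVn.
    have dE : is_derive t 1 (fun s : R => expR (- s^-1)) (expR (- t^-1) * t^-1 ^+ 2).
      have := @is_derive1_comp _ expR (fun s : R => - s^-1) t _ _ (is_derive_expR _) (is_deriveN dV).
      by rewrite opprK mulrC.
    have dM := is_deriveM (is_deriveX k dV) dE.
    have -> : (fun s : R => s^-1 ^+ k * expR (- s^-1)) =
       (fun s : R => s^-1) ^+ k * (fun s : R => expR (- s^-1)).
      by apply/funext => s; rewrite exprfctE.
    apply: (is_derive_eq dM).
    rewrite exprfctE /GRing.scale /=.
    by case: k {dM} => [|k]; rewrite !exprS /= ?expr0; ring.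
  apply: near_eq_is_derive d1.
  by near=> s; rewrite ifT//; near: s; exact: lt_nbhsr.
- have f0 m : flat m 0 = 0 by rewrite /flat ltxx.
  rewrite !f0 mulr0 subr0.
  (* At 0 the difference quotient of [flat k] is [flat k.+1] itself, which tends to 0. *)
  have e : (fun h : R => h^-1 *: ((flat k \o shift 0) (h *: 1) - flat k 0)) =1 flat k.+1.
    move=> h; rewrite f0 /= addr0 subr0 /GRing.scale /= mulr1 /flat.
    by case: ifP; rewrite ?mulr0// exprS mulrA.
  have c : (h^-1 *: ((flat k \o shift 0) (h *: 1) - flat k 0)) @[h --> 0^'] --> (0 : R).
    by under eq_fun do rewrite e; exact: flat_continuous0.
  apply: DeriveDef; first by apply/cvg_ex; exists 0.
  exact/cvg_lim.
Unshelve. all: by end_near. Qed.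

End flat_exponential.

Section smooth_functions.
Context {R : realType} {n : nat}.
Local Notation E := 'rV[R]_n.
Implicit Types (u : E -> R) (v : E).

Lemma is_derive_ridge (h : R -> R) (a dh : R) (v e x : E) :
  is_derive (a + dot x v) 1 h dh ->
  is_derive x e (fun y => h (a + dot y v)) (dot e v * dh).
Proof.
move=> hd.
have g1 : is_derive (0 : R) 1 (fun s : R => a + dot x v + dot e v * s) (dot e v).
  have := is_deriveD (is_derive_cst (a + dot x v) (0 : R) 1) (is_deriveZ (dot e v) (is_derive_id (0 : R) 1)).
  by rewrite add0r /GRing.scale /= mulr1.
have hd' : is_derive ((fun s : R => a + dot x v + dot e v * s) 0) 1 h dh by rewrite /= mulr0 addr0.
have [d1 d2] := @is_derive1_comp _ h _ 0 _ _ hd' g1.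
have e1 : (fun s : R => s^-1 *: (((fun y => h (a + dot y v)) \o shift x) (s *: e) - h (a + dot x v))) =
   (fun s : R => s^-1 *: (((h \o (fun s : R => a + dot x v + dot e v * s)) \o shift 0) (s *: 1) -
      (h \o (fun s : R => a + dot x v + dot e v * s)) 0)).
  apply/funext => s; rewrite /= mulr0 !addr0 dotDl dotZl /GRing.scale /= mulr1.
  by congr (_ * (h _ - _)); ring.
apply: DeriveDef; first by rewrite /derivable e1.
by rewrite /derive e1 mulrC; exact: d2.
Qed.

(* Stable under partial derivatives, hence made of smooth functions. *)
Inductive nice : (E -> R) -> Prop :=
| nice_cst c : nice (cst c)
| nice_cos a (v : E) : nice (fun x : E => cos (a + dot x v))
| nice_flat k a (v : E) : nice (fun x : E => flat k (a + dot x v))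
| niceD f g : nice f -> nice g -> nice (f + g)
| niceM f g : nice f -> nice g -> nice (f * g).

Lemma nice_derive u i : nice u ->
  exists2 u', nice u' & forall x, is_derive x (delta_mx ord0 i) u (u' x).
Proof.
elim=> [c|a v|k a v|f g _ [f' nf df] _ [g' ng dg]|f g hf [f' nf df] hg [g' ng dg]].
- exists (cst 0); first exact: nice_cst.
  by move=> x; exact: is_derive_cst.
(* The derivative - sin is a cosine with phase advanced by pi / 2, so no constructor for sines is
   called for. *)
- exists (cst (dot (delta_mx ord0 i) v) * (fun x => cos (a + pi / 2 + dot x v))).
    by apply: niceM; [exact: nice_cst|exact: nice_cos].
  move=> x; have := @is_derive_ridge cos a _ v (delta_mx ord0 i) x (is_derive_cos _).
  rewrite -mulrN1 fctE /= [in X in _ -> X]addrAC cosD cos_pihalf sin_pihalf.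
  by rewrite mulr0 mulr1 sub0r mulrN1.
- exists (cst (dot (delta_mx ord0 i) v) * ((fun x => flat k.+2 (a + dot x v)) +
     cst (- k%:R) * (fun x => flat k.+1 (a + dot x v)))).
    apply: niceM; first exact: nice_cst.
    by apply: niceD; [exact: nice_flat|apply: niceM; [exact: nice_cst|exact: nice_flat]].
  move=> x; have := @is_derive_ridge (flat k) a _ v (delta_mx ord0 i) x (is_derive_flat k _).
  by rewrite !fctE /= mulNr.
- by exists (f' + g'); [exact: niceD|move=> x; exact: is_deriveD].
- exists (f * g' + g * f'); first by apply: niceD; apply: niceM.
  by move=> x; exact: is_deriveM.
Qed.

Lemma dot_continuous (v : E) : continuous (fun x : E => dot x v).
Proof.
have h (s : seq 'I_n) : continuous (fun x : E => \sum_(i <- s) x ord0 i * v ord0 i).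
  elim: s => [|i s IH]; first by under eq_fun do rewrite big_nil; exact: cst_continuous.
  under eq_fun do rewrite big_cons.
  have cM : continuous (fun x : E => x ord0 i * v ord0 i).
    move=> x; apply: (@continuous_comp _ _ _ (fun y : E => y ord0 i) (fun t => t * v ord0 i)).
      exact: coord_continuous.
    by apply: cvgMl; exact: cvg_id.
  by move=> x; exact: (continuousD (cM x) (IH x)).
exact: h.
Qed.

Lemma nice_continuous u : nice u -> continuous u.
Proof.
have rc (h : R -> R) a v : continuous h -> continuous (fun x : E => h (a + dot x v)).
  move=> hc x; apply: (@continuous_comp _ _ _ (fun x => a + dot x v) h); last exact: hc.
  by apply: continuousD; [exact: cst_continuous|exact: dot_continuous].
elim=> [c|a v|k a v|f g _ cf _ cg|f g _ cf _ cg].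
- exact: cst_continuous.
- by apply: rc; exact: continuous_cos.
- apply: rc => t; apply: differentiable_continuous; apply/derivable1_diffP.
  by have [] := is_derive_flat k t.
- by move=> x; apply: continuousD; [exact: cf|exact: cg].
- by move=> x; apply: continuousM; [exact: cf|exact: cg].
Qed.

Lemma nice_smooth u : nice u -> smooth u.
Proof.
move=> nu s.
suff h : nice (partial s u).
  split; first exact: nice_continuous.
  by move=> i x; have [u' _ /(_ x)[]] := nice_derive i h.
elim: s => //= i s IH; have [u' nu' du] := nice_derive i IH.
rewrite (_ : (fun x => _) = u')//; apply/funext => x.
by have [_ ->] := du x.
Qed.

Lemma nice_sin v : nice (fun x => sin (dot x v)).
Proof.
rewrite (_ : (fun x => _) = fun x => cos (- (pi / 2) + dot x v)); first exact: nice_cos.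
by apply/funext => x; rewrite addrC cosB cos_pihalf sin_pihalf mulr0 add0r mulr1.
Qed.

Lemma nice_cos0 v : nice (fun x => cos (dot x v)).
Proof.
rewrite (_ : (fun x => _) = fun x => cos (0 + dot x v)); first exact: nice_cos.
by apply/funext => x; rewrite add0r.
Qed.

Lemma nice_prod (I : Type) (s : seq I) (F : I -> E -> R) :
  (forall i, nice (F i)) -> nice (fun x => \prod_(i <- s) F i x).
Proof.
move=> nF; elim: s => [|i s IH].
  by under eq_fun do rewrite big_nil; exact: nice_cst.
by under eq_fun do rewrite big_cons; exact: niceM.
Qed.

Lemma nice_exp u m : nice u -> nice (fun x => u x ^+ m).
Proof.
move=> nu; have := nice_prod (iota 0 m) (fun=> nu).
congr nice; apply/funext => x.
by rewrite (big_const_seq) count_predT size_iota iter_mulr_1.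
Qed.

Lemma nice_onem u : nice u -> nice (fun x => 1 - u x).
Proof.
move=> nu; have := niceD (nice_cst 1) (niceM (nice_cst (-1)) nu).
by congr nice; apply/funext => x; rewrite !fctE mulN1r.
Qed.

End smooth_functions.

(** * Fourier decay of test functions *)

Section moments.
Context {R : realType} {n : nat}.
Local Open Scope complex_scope.
Local Notation E := 'rV[R]_n.
Local Notation mu := (@lebesgue_rV R n).
Local Notation Re := (@complex.Re R).
Local Notation Im := (@complex.Im R).
Implicit Types (f : E -> R[i]) (v : E -> R).

Lemma CL_shift f a : CL f -> CL (fun x => f (x + a)).
Proof.
move=> [[f1 f2] [f3 f4]]; split; split.
- exact: (Rint_shift a f1).1.
- exact: (Rint_shift a f2).1.
- exact: (Rint_shift a f3).1.
- exact: (Rint_shift a f4).1.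
Qed.

Lemma cint_shift f a : citg mu f -> cint mu (fun x => f (x + a)) = cint mu f.
Proof.
by move=> [f1 f2]; rewrite /cint (Rint_shift a f1).2 (Rint_shift a f2).2.
Qed.

Lemma fourier_shift f a xi : CL f ->
  fourier (fun x => f (x + a)) xi = expi xi a * fourier f xi.
Proof.
move=> hf; have cf := citg_fourier xi (CL_citg hf).
rewrite !fourierE -cintZ// -(cint_shift a (citgZ (expi xi a) cf)).
apply: cint_ext => x; rewrite mulrA; congr (_ * _).
rewrite /expi dotDl cosD sinD; have := cos2Dsin2 (dot a xi).
move: (cos (dot a xi)) (sin (dot a xi)) (cos (dot x xi)) (sin (dot x xi)) => c s c' s' e.
apply: complex_eq; rewrite !reimE /=.
  by transitivity ((c ^+ 2 + s ^+ 2) * c'); [rewrite e mul1r|ring].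
by transitivity ((c ^+ 2 + s ^+ 2) * - s'); [rewrite e mul1r|ring].
Qed.

Lemma cvg_quotient (h : R -> R) (dh : R) : is_derive (0 : R) 1 h dh ->
  m.+1%:R * (h (m.+1%:R^-1) - h 0) @[m --> \oo] --> dh.
Proof.
move=> [d <-]; move: d => /= d.
have t0 : (@harmonic R) m @[m --> \oo] --> (0 : R)^'.
  apply: cvg_trans (_ : _ --> within (fun x => x != 0) (nbhs (0 : R))) => //.
  move=> A /= [e e0 he]; have := @cvg_harmonic R; move/cvgrPdist_lt => /(_ e e0).
  by apply: filterS => m hm; apply: he => //=; rewrite gt_eqF// invr_gt0.
have := @cvg_comp _ _ _ (@harmonic R)
  (fun t => t^-1 *: ((h \o shift 0) (t *: 1) - h 0)) _ _ _ t0 d; apply: cvg_trans; apply: near_eq_cvg; near=> m => /=.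
by rewrite invrK addr0 /GRing.scale /= mulr1.
Unshelve. all: by end_near. Qed.

(* Plancherel for the difference quotients of f in the direction j, whose
   transforms tend to i xi_j F(xi), and Fatou. *)
Lemma second_moment f (K : R) (j : 'I_n) : CL f ->
  (forall t, 0 < t <= 1 ->
    \int[mu]_x nsq (f (x + t *: delta_mx ord0 j) - f x) <= K * t ^+ 2) ->
  itg mu (fun xi => xi ord0 j ^+ 2 * nsq (fourier f xi)).
Proof.
move=> hf hK; have cf := CL_citg hf.
have mf := measurable_nsq (cmeas_fourier cf).
set e := delta_mx ord0 j : E.
have de (xi : E) : dot e xi = xi ord0 j.
  rewrite /dot (bigD1 j)//= /e mxE !eqxx mul1r big1 ?addr0// => i ij.
  by rewrite mxE (negPf ij) mul0r.
pose F m (xi : E) := m.+1%:R ^+ 2 * nsq (fourier (fun x => f (x + m.+1%:R^-1 *: e) - f x) xi).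
have hs m : CL (fun x => f (x + m.+1%:R^-1 *: e) - f x) := CLB (CL_shift _ hf) hf.
(* A translation by t e multiplies the transform by e^(i t xi_j). The two squares are those of
   difference quotients of cos(t xi_j) and sin(t xi_j) at t = 0, with limits 0 and xi_j. *)
have FE m xi : F m xi =
    ((m.+1%:R * (cos (m.+1%:R^-1 * xi ord0 j) - cos (0 * xi ord0 j))) ^+ 2 +
     (m.+1%:R * (sin (m.+1%:R^-1 * xi ord0 j) - sin (0 * xi ord0 j))) ^+ 2) * nsq (fourier f xi).
  rewrite /F fourierB//; last exact: CL_citg (CL_shift _ hf).
  rewrite fourier_shift// -[X in _ - X]mul1r -mulrBl nsqM mulrA; congr (_ * _).
  by rewrite /expi dotZl de mul0r cos0 sin0 /nsq !reimE /=; ring.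
apply: itg_lty.
- by apply: measurable_funM => //; apply: measurable_funX; exact: measurable_coord_rV.
- by move=> xi; rewrite mulr_ge0 ?sqr_ge0// nsq_ge0.
apply: le_lt_trans (ltry ((2 * pi) ^+ n * K)).
apply: (fatou_bound (F := F)).
- move=> m; apply: measurable_funM => //.
  exact: measurable_nsq (cmeas_fourier (CL_citg (hs m))).
- by move=> m xi; rewrite mulr_ge0 ?sqr_ge0// nsq_ge0.
- move=> xi; under eq_fun do rewrite FE.
  apply: cvgMl.
  have dl : is_derive (0 : R) 1 (fun s : R => s * xi ord0 j) (xi ord0 j).
    have := is_deriveM (is_derive_id (0 : R) 1) (is_derive_cst (xi ord0 j) (0 : R) 1).
    by rewrite scaler0 add0r /GRing.scale /= mulr1.
  have hc := @is_derive1_comp _ cos _ 0 _ _ (is_derive_cos _) dl.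
  have hs' := @is_derive1_comp _ sin _ 0 _ _ (is_derive_sin _) dl.
  rewrite mul0r sin0 oppr0 mul0r in hc; rewrite mul0r cos0 mul1r in hs'.
  have c1 := cvg_quotient hc; have c2 := cvg_quotient hs'.
  have -> : xi ord0 j ^+ 2 = 0 ^+ 2 + xi ord0 j ^+ 2 by rewrite expr0n add0r.
  by apply: cvgD; rewrite expr2; apply: cvgM.
- move=> m; have [i1 i2] := plancherel (hs m).
  rewrite itg_fin; last exact: itgZ.
  rewrite lee_fin (RintZ _ i1) i2 mulrCA ler_wpM2l ?exprn_ge0 ?mulr_ge0 ?pi_ge0//.
  have t1 : 0 < (m.+1%:R^-1 : R) <= 1 by rewrite invr_gt0 ltr0n /= invf_le1// ler1n.
  have := hK _ t1; rewrite -(ler_pM2l (exprn_gt0 2 (ltr0Sn R m))) => /le_trans; apply.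
  by rewrite mulrCA -exprMn mulfV// expr1n mulr1.
Qed.

Section directional.
Variables (v : E -> R) (j : 'I_n).
Hypotheses (sv : smooth v) (cv : compact (closure [set x | v x != 0])).
Let e : E := delta_mx ord0 j.

Lemma smooth_bounded : exists2 C : R, 0 <= C & forall x, `|v x| <= C.
Proof.
have [c0 _] := sv [::].
have [M [_ HM]] := compact_bounded (continuous_compact (continuous_subspaceT c0) cv).
exists (`|M| + 1) => [|x]; first by rewrite addr_ge0.
have [->|vx] := eqVneq (v x) 0; first by rewrite normr0 addr_ge0.
apply: HM; first by rewrite ltr_pwDr// ler_norm.
by exists x => //; exact: subset_closure.
Qed.

Lemma smooth_supported : exists N : nat, forall x t, 0 <= t <= 1 ->
  v (x + t *: e) != 0 -> ocube N x.
Proof.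
have [M [_ HM]] := compact_bounded cv.
(* One unit is the margin in the bound on the support, the other the length of the translation. *)
have [N HN] : exists N : nat, `|M| + 1 + 1 < N%:R.
  by exists (Num.bound (`|M| + 1 + 1)); rewrite archi_boundP// !addr_ge0.
exists N => x t /andP[t0 t1] vx i.
have h1 : `|x + t *: e| <= `|M| + 1.
  by apply: HM; [rewrite ltr_pwDr// ler_norm|exact: subset_closure].
have h2 : `|(x + t *: e) ord0 i| <= `|M| + 1.
  apply: le_trans h1; rewrite [leRHS]/Num.Def.normr /= mx_normrE.
  exact: (le_bigmax _ (fun ij => `|(x + t *: e) ij.1 ij.2|) (ord0, i)).
have h3 : `|x ord0 i| < N%:R.
  apply: le_lt_trans HN; rewrite -[x ord0 i](addrK (t * e ord0 i)).
  apply: le_trans (ler_normB _ _) _; apply: lerD; first by move: h2; rewrite !mxE.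
  by rewrite /e mxE normrM ger0_norm// eqxx; case: (_ == _); rewrite ?normr1 ?normr0 ?mulr1 ?mulr0.
by rewrite /= in_itv /= -ltr_norml.
Qed.

(** The partial derivative is continuous and vanishes off the compact support, hence is bounded;
    then the mean value theorem along the direction e. *)
Lemma smooth_lipschitz : exists2 C : R, 0 <= C &
  forall x t, 0 <= t -> `|v (x + t *: e) - v x| <= C * t.
Proof.
have [_ dv] := sv [::]; have [c1 _] := sv [:: j].
pose w x := 'D_e v x.
have [M [_ HM]] := compact_bounded (continuous_compact (continuous_subspaceT c1) cv).
have C0 : 0 <= `|M| + 1 by rewrite addr_ge0.
have wC x : `|w x| <= `|M| + 1.
  have [xK|xK] := pselect (closure [set x | v x != 0] x).
    by apply: HM; [rewrite ltr_pwDr// ler_norm|exists x].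
  rewrite (_ : w x = 0) ?normr0// /w.
  rewrite (@near_eq_derive _ _ _ v (cst 0)) ?derive_cst//.
  have : nbhs x (~` closure [set x | v x != 0]).
    by apply: open_nbhs_nbhs; split => //; apply: closed_openC; exact: closed_closure.
  apply: filterS => y hy /=; apply/eqP/negP => /negP vy; apply: hy.
  exact: subset_closure.
exists (`|M| + 1) => // x t t0.
have dg (s : R) : is_derive s 1 (fun s : R => v (s *: e + x)) (w (s *: e + x)).
  have e1 : (fun h : R => h^-1 *: (((fun s : R => v (s *: e + x)) \o shift s) (h *: 1) - v (s *: e + x))) =
     (fun h : R => h^-1 *: ((v \o shift (s *: e + x)) (h *: e) - v (s *: e + x))).
    apply/funext => h; rewrite /= [h%:A]mulr1 scalerDl addrA.
    by [].
  apply: DeriveDef; first by rewrite /derivable e1; exact: dv.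
  by rewrite /derive e1.
have cg : {within `[0, t], continuous (fun s : R => v (s *: e + x))}.
  apply: continuous_subspaceT => s; apply: differentiable_continuous.
  by apply/derivable1_diffP; have [] := dg s.
have [c _] := @MVT_segment R _ _ 0 t t0 (fun s _ => dg s) cg.
rewrite scale0r add0r subr0 (addrC x) => ->.
by rewrite normrM (ger0_norm t0) ler_wpM2r.
Qed.

End directional.

Lemma bounded_L12 v C N : measurable_fun setT v -> (forall x, `|v x| <= C) ->
  (forall x, v x != 0 -> ocube N x) -> L12 v.
Proof.
move=> mv vC vN.
have mK : measurable (@ocube R n N) by exact: measurable_obox.
have iK : itg mu (\1_(@ocube R n N)).
  by apply: itg_indic => //; exact: obox_lty.
have vE x : v x = v x * \1_(@ocube R n N) x.
  have [->|/vN h] := eqVneq (v x) 0; first by rewrite mul0r.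
  by rewrite indicE mem_set// mulr1.
split; first by apply: itg_eq (itg_bM mv vC iK) => x; rewrite -vE.
apply: itg_eq (itg_bM (C := C ^+ 2) (measurable_funX 2 mv) _ iK) => x.
  by rewrite [in RHS]vE exprMn; congr (_ * _); rewrite indicE; case: (_ \in _); rewrite ?expr1n ?expr0n.
by rewrite normrX ler_sqr ?nnegrE// (le_trans _ (vC x)).
Qed.

Definition logw (xi : E) : R := ln (expR 1 + enorm xi).

Lemma measurable_logw : measurable_fun setT logw.
Proof.
apply: (measurableT_comp (@measurable_ln R)); apply: measurable_funD => //.
exact: measurable_enorm.
Qed.

Lemma logw_ge0 xi : 0 <= logw xi.
Proof.
apply: ln_ge0; apply: le_trans (_ : expR 1 <= _); last by rewrite lerDl enorm_ge0.
by rewrite -[leLHS](@expR0 R) ler_expR.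
Qed.

Lemma enorm_le_sqr (xi : E) : enorm xi <= 1 + dot xi xi.
Proof.
rewrite -enorm_sqr; have := sqr_ge0 (enorm xi - 1); have := enorm_ge0 xi.
by move: (enorm xi) => a; nra.
Qed.

Lemma logw_le xi : logw xi <= expR 1 + enorm xi.
Proof.
have e1 : 0 < expR 1 + enorm xi by rewrite ltr_pwDl ?expR_gt0// enorm_ge0.
have h : -1 < expR 1 + enorm xi - 1 by rewrite ltrBDr addNr.
have := le_ln1Dx h; rewrite addrC subrK => /le_trans; apply.
by rewrite gerBl.
Qed.

Section test_functions.
Variables (Om : set E) (f : E -> R[i]).
Hypothesis tf : test_function Om f.

Lemma test_parts : [/\ smooth (Re \o f), smooth (Im \o f),
  compact (closure [set x | (Re \o f) x != 0]) & compact (closure [set x | (Im \o f) x != 0])].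
Proof.
have [s1 s2 c _] := tf; split => //.
  apply: (subclosed_compact _ c); first exact: closed_closure.
  by apply: closure_subset => x /=; apply: contra_neq => ->.
apply: (subclosed_compact _ c); first exact: closed_closure.
by apply: closure_subset => x /=; apply: contra_neq => ->.
Qed.

Lemma CL_test : CL f.
Proof.
have L (v : E -> R) : smooth v -> compact (closure [set x | v x != 0]) -> L12 v.
  move=> sv cv; have [C _ vC] := smooth_bounded sv cv.
  have [[|N] HN] : exists N, forall x, v x != 0 -> ocube N x.
  (* [smooth_supported] takes a coordinate direction; in dimension 0 there is none, but every cube
     is the whole space. *)
  - case: (posnP n) => [n0|n0]; first by exists 0%N => x _ i; have := ltn_ord i; rewrite {2}n0.
    have [N HN] := smooth_supported (Ordinal n0) cv; exists N => x vx.
    by apply: (HN x 0); rewrite ?lexx ?ler01// scale0r addr0.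
  - apply: (bounded_L12 _ vC HN); apply: continuous_measurable_rV.
    by have [] := sv [::].
  - apply: (bounded_L12 _ vC HN); apply: continuous_measurable_rV.
    by have [] := sv [::].
have [s1 s2 c1 c2] := test_parts.
by split; exact: L.
Qed.

(** The difference f(x + t e) - f(x) is O(t) by the Lipschitz bound and vanishes off a fixed cube
    for all t <= 1, so its squared norm is O(t^2). *)
Lemma test_second_moment j : itg mu (fun xi => xi ord0 j ^+ 2 * nsq (fourier f xi)).
Proof.
have [s1 s2 c1 c2] := test_parts.
have [C1 C10 l1] := smooth_lipschitz j s1 c1; have [C2 C20 l2] := smooth_lipschitz j s2 c2.
have [N1 h1] := smooth_supported j c1; have [N2 h2] := smooth_supported j c2.
have mK N : measurable (@ocube R n N) by exact: measurable_obox.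
have iK N : itg mu (\1_(@ocube R n N)).
  by apply: itg_indic => //; exact: obox_lty.
have D (v : E -> R) C N : 0 <= C ->
    (forall x t, 0 <= t -> `|v (x + t *: delta_mx ord0 j) - v x| <= C * t) ->
    (forall x t, 0 <= t <= 1 -> v (x + t *: delta_mx ord0 j) != 0 -> ocube N x) ->
    forall x t, 0 < t <= 1 ->
    (v (x + t *: delta_mx ord0 j) - v x) ^+ 2 <= C ^+ 2 * t ^+ 2 * \1_(ocube N) x.
  move=> C0 vl vN x t /andP[t0 t1].
  have [xN|xN] := pselect (ocube N x).
    rewrite indicE mem_set// mulr1 -exprMn -real_normK ?num_real//.
    by rewrite ler_sqr ?nnegrE ?mulr_ge0 ?(ltW t0)// vl// ltW.
  have v0 s : 0 <= s <= 1 -> v (x + s *: delta_mx ord0 j) = 0.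
    by move=> s01; apply/eqP/negP => /negP /(vN _ _ s01).
  have vx : v x = 0 by rewrite -[x]addr0 -(scale0r (delta_mx ord0 j)) v0// lexx ler01.
  by rewrite v0 ?(ltW t0)// vx subrr expr0n mulr_ge0// mulr_ge0 ?sqr_ge0.
pose K := C1 ^+ 2 * \int[mu]_x (\1_(@ocube R n N1) x) + C2 ^+ 2 * \int[mu]_x (\1_(@ocube R n N2) x).
apply: (@second_moment _ K); first exact: CL_test.
move=> t t01; have hs := CL_shift (t *: delta_mx ord0 j) CL_test.
have i1 := itgZ (C1 ^+ 2 * t ^+ 2) (iK N1); have i2 := itgZ (C2 ^+ 2 * t ^+ 2) (iK N2).
have -> : K * t ^+ 2 = \int[mu]_x (C1 ^+ 2 * t ^+ 2 * \1_(ocube N1) x + C2 ^+ 2 * t ^+ 2 * \1_(ocube N2) x).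
  by rewrite (RintD i1 i2) (RintZ _ (iK N1)) (RintZ _ (iK N2)) /K; ring.
apply: (Rint_le (CL_nsq (CLB hs CL_test)) (itgD i1 i2)) => x.
rewrite /= /nsq !reimE; apply: lerD; first exact: (D (Re \o f)).
exact: (D (Im \o f)).
Qed.

Lemma test_energy : itg mu (fun xi => enorm xi * nsq (fourier f xi)) /\
  itg mu (fun xi => logw xi * nsq (fourier f xi)).
Proof.
have mf := measurable_nsq (cmeas_fourier (CL_citg CL_test)).
have [i0 _] := plancherel CL_test.
have i1 : itg mu (fun xi => enorm xi * nsq (fourier f xi)).
  have i2 : itg mu (fun xi => dot xi xi * nsq (fourier f xi)).
    have := @itg_sum _ _ _ mu _ (index_enum 'I_n) _ test_second_moment.
    by apply: itg_eq => xi; rewrite -mulr_suml.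
  apply: (itg_le _ _ (itgD i0 i2)).
    by apply: measurable_funM => //; exact: measurable_enorm.
  move=> xi; have := enorm_le_sqr xi; have := nsq_ge0 (fourier f xi).
  rewrite normrM (ger0_norm (enorm_ge0 _)) (ger0_norm (nsq_ge0 _)).
  move: (nsq _) (enorm _) (dot _ _) => a b c a0 bc.
  by rewrite -{2}(mul1r a) -mulrDl ler_wpM2r.
split => //; apply: (itg_le _ _ (itgD (itgZ (expR 1) i0) i1)).
  by apply: measurable_funM => //; exact: measurable_logw.
move=> xi; rewrite normrM (ger0_norm (logw_ge0 _)) (ger0_norm (nsq_ge0 _)) -mulrDl.
by apply: ler_wpM2r; [exact: nsq_ge0|exact: logw_le].
Qed.

End test_functions.

End moments.

(** * Cutoffs built from bumps on cubes *)

Section cube_bumps.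
Context {R : realType} {n : nat}.
Local Notation E := 'rV[R]_n.

(** Positive on the open cube of centre c and half-side r, zero outside it, with values in
    [0, 1]. *)
Definition cube_bump (c : E) (r : R) (x : E) : R :=
  \prod_(i < n) (flat 0 (1 + (x ord0 i - c ord0 i) / r) * flat 0 (1 - (x ord0 i - c ord0 i) / r)).

Lemma cube_bump_itv c r x : 0 <= cube_bump c r x <= 1.
Proof.
apply/andP; split; first by apply: prodr_ge0 => i _; rewrite mulr_ge0 ?flat_ge0.
by apply: prodr_ile1 => i _; rewrite mulr_ge0 ?flat_ge0//= mulr_ile1 ?flat_ge0 ?flat0_le1.
Qed.

Lemma cube_bump_gt0 (c : E) r (x : E) : 0 < r -> (forall i, `|x ord0 i - c ord0 i| < r) -> 0 < cube_bump c r x.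
Proof.
move=> r0 h; apply: prodr_gt0 => i _.
have : `|(x ord0 i - c ord0 i) / r| < 1.
  by rewrite normrM normfV (gtr0_norm r0) ltr_pdivrMr// mul1r.
rewrite ltr_norml => /andP[h1 h2].
by rewrite mulr_gt0// flat0_gt0 ?subr_gt0// -ltrBlDl sub0r.
Qed.

Lemma cube_bump_neq0 (c : E) r (x : E) : 0 < r -> cube_bump c r x != 0 ->
  forall i, `|x ord0 i - c ord0 i| <= r.
Proof.
move=> r0 /prodf_neq0 h i; have := h i isT.
rewrite mulf_eq0 negb_or => /andP[h1 h2].
have p1 : 0 < 1 + (x ord0 i - c ord0 i) / r by rewrite -flat0_gt0 lt0r h1 flat_ge0.
have p2 : 0 < 1 - (x ord0 i - c ord0 i) / r by rewrite -flat0_gt0 lt0r h2 flat_ge0.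
suff : `|(x ord0 i - c ord0 i) / r| <= 1.
  by rewrite normrM normfV (gtr0_norm r0) ler_pdivrMr// mul1r.
by rewrite ler_norml; apply/andP; split; lra.
Qed.

Lemma nice_cube_bump c r : nice (cube_bump c r).
Proof.
rewrite /cube_bump; apply: (@nice_prod R n 'I_n (index_enum _)
  (fun i x => flat 0 (1 + (x ord0 i - c ord0 i) / r) * flat 0 (1 - (x ord0 i - c ord0 i) / r))) => i.
have de a (x : E) : dot x (a *: delta_mx ord0 i) = x ord0 i * a.
  rewrite /dot (bigD1 i)//= !mxE !eqxx mulr1 big1 ?addr0// => j ij.
  by rewrite !mxE (negPf ij) !mulr0.
have := niceM (nice_flat 0 (1 - c ord0 i / r) (r^-1 *: delta_mx ord0 i))
  (nice_flat 0 (1 + c ord0 i / r) (- r^-1 *: delta_mx ord0 i)).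
congr nice; apply/funext => x; rewrite !fctE !de.
by congr (flat 0 _ * flat 0 _); ring.
Qed.

Variables (c : nat -> E) (r : nat -> R).
Hypothesis r0 : forall k, 0 < r k.

(** The bumps never reach 1, but at a point where some bump is positive the factor (1 - bump)^m
    tends to 0. The cutoffs thus tend to 1 on the union of the open cubes, while each one vanishes
    off finitely many closed cubes. *)
Definition cutoff m (x : E) : R :=
  1 - \prod_(k <- iota 0 m) (1 - cube_bump (c k) (r k) x) ^+ m.

Lemma nice_cutoff m : nice (cutoff m).
Proof.
apply: nice_onem; apply: (@nice_prod R n nat (iota 0 m)
  (fun k x => (1 - cube_bump (c k) (r k) x) ^+ m)) => k.
by apply: nice_exp; apply: nice_onem; exact: nice_cube_bump.
Qed.

Let bump1 k x m : 0 <= (1 - cube_bump (c k) (r k) x) ^+ m <= 1.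
Proof.
have /andP[b0 b1] := cube_bump_itv (c k) (r k) x.
by rewrite exprn_ge0 ?subr_ge0//= exprn_ile1 ?subr_ge0// gerBl.
Qed.

Lemma cutoff_itv m x : 0 <= cutoff m x <= 1.
Proof.
rewrite /cutoff subr_ge0 gerBl; apply/andP; split.
  by apply: prodr_ile1 => k _; exact: bump1.
by apply: prodr_ge0 => k _; have /andP[] := bump1 k x m.
Qed.

Lemma cutoff_neq0 m (x : E) : cutoff m x != 0 ->
  exists2 k, (k < m)%N & forall i, `|x ord0 i - c k ord0 i| <= r k.
Proof.
move=> h; apply: contrapT => hN; move/eqP: h; apply.
rewrite /cutoff big_seq big1 ?subrr// => k; rewrite mem_iota add0n => /= km.
have [->|b0] := eqVneq (cube_bump (c k) (r k) x) 0; first by rewrite subr0 expr1n.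
by exfalso; apply: hN; exists k => //; exact: cube_bump_neq0.
Qed.

Lemma cutoff_cvg (x : E) : (exists k, forall i, `|x ord0 i - c k ord0 i| < r k) ->
  cutoff m x @[m --> \oo] --> (1 : R).
Proof.
move=> [k hk]; have b0 := cube_bump_gt0 (r0 k) hk.
have /andP[_ b1] := cube_bump_itv (c k) (r k) x.
set b := cube_bump (c k) (r k) x in b0 b1.
rewrite -[X in _ --> X]subr0; apply: cvgB; first exact: cvg_cst.
apply: (@squeeze_cvgr _ _ _ _ (fun=> 0) (fun m => (1 - b) ^+ m)); last 2 first.
- exact: cvg_cst.
- by apply: cvg_expr; rewrite ger0_norm ?subr_ge0// ltrBlDr ltrDl.
near=> m.
have km : (k < m)%N by near: m; exact: nbhs_infty_gt.
apply/andP; split; first by apply: prodr_ge0 => j _; have /andP[] := bump1 j x m.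
rewrite (big_rem k) ?mem_iota//= -[leRHS]mulr1 -/b.
apply: ler_wpM2l; first by have /andP[] := bump1 k x m.
by apply: prodr_ile1 => j _; exact: bump1.
Unshelve. all: by end_near. Qed.

Definition cubes m : set E := [set x | exists2 k, (k < m)%N & forall i, `|x ord0 i - c k ord0 i| <= r k].

Lemma compact_cubes m : compact (cubes m).
Proof.
elim: m => [|m IH].
  by rewrite (_ : cubes 0 = set0); [exact: compact0|apply/seteqP; split => x // [k]].
rewrite (_ : cubes m.+1 = cubes m `|` [set x | forall i, `[c m ord0 i - r m, c m ord0 i + r m]%classic (x ord0 i)]).
  apply: compactU => //.
  by apply: (@rV_compact R n (fun i => `[c m ord0 i - r m, c m ord0 i + r m]%classic)) => i; exact: segment_compact.
apply/seteqP; split => x /=.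
  move=> [k]; rewrite ltnS leq_eqVlt => /orP[/eqP -> h|km h]; last by left; exists k.
  by right => i; rewrite in_itv /= -ler_distl.
move=> [[k km h]|h]; first by exists k => //; exact: ltnW.
by exists m => // i; have := h i; rewrite in_itv /= -ler_distl.
Qed.

Lemma closed_cubes m : closed (cubes m).
Proof. by apply: compact_closed; [exact: norm_hausdorff|exact: compact_cubes]. Qed.

End cube_bumps.

Section test_modul.
Context {R : realType} {n : nat}.
Local Open Scope complex_scope.
Local Notation E := 'rV[R]_n.
Local Notation mu := (@lebesgue_rV R n).
Local Notation Re := (@complex.Re R).
Local Notation Im := (@complex.Im R).
Variables (Om : set E).

Definition is_window (u : E -> R) := [/\ nice u, forall x, 0 <= u x <= 1,
  compact (closure [set x | u x != 0]) & closure [set x | u x != 0] `<=` Om].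

Lemma window_exists : open Om -> Om !=set0 -> exists W : nat -> E -> R,
  (forall m, is_window (W m)) /\ (forall x, Om x -> W m x @[m --> \oo] --> (1 : R)).
Proof.
move=> oOm nOm; have [c [r [r0 cO cov]]] := open_cube_cover oOm nOm.
exists (cutoff c r); split => [m|x Ox]; last by apply: cutoff_cvg => //; exact: cov.
have sub : closure [set x | cutoff c r m x != 0] `<=` cubes c r m.
  rewrite closureE => x; apply; split; first exact: closed_cubes.
  by move=> y; exact: cutoff_neq0.
split; [exact: nice_cutoff|exact: cutoff_itv| |].
  by apply: (subclosed_compact _ (@compact_cubes _ _ c r m) sub); exact: closed_closure.
by move=> x /sub[k _ hk]; exact: cO hk.
Qed.

Variable u : E -> R.
Hypothesis wu : is_window u.

Lemma test_modul xi : test_function Om (modul u xi).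
Proof.
have [nu u01 cu uO] := wu.
have sub : closure [set x | modul u xi x != 0] `<=` closure [set x | u x != 0].
  apply: closure_subset => x /=; apply: contra_neq => ux.
  by rewrite /modul ux mul0r.
split.
- rewrite (_ : _ \o _ = u * (fun x => cos (dot x xi))).
    by apply: nice_smooth; apply: niceM => //; exact: nice_cos0.
  by apply/funext => x; rewrite -[LHS]/(Re ((u x)%:C * expi xi x)) creM /= mul0r subr0.
- rewrite (_ : _ \o _ = u * (fun x => sin (dot x xi))).
    by apply: nice_smooth; apply: niceM => //; exact: nice_sin.
  by apply/funext => x; rewrite -[LHS]/(Im ((u x)%:C * expi xi x)) cimM /= mul0r addr0.
- by apply: (subclosed_compact _ cu sub); exact: closed_closure.
- exact: subset_trans uO.
Qed.

Lemma test_window : test_function Om (fun x => (u x)%:C).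
Proof.
rewrite (_ : (fun x => _) = modul u 0); first exact: test_modul.
apply/funext => x; rewrite /modul (_ : expi 0 x = 1) ?mulr1//.
by rewrite /expi dotC /dot big1 ?cos0 ?sin0// => i _; rewrite mxE mul0r.
Qed.

End test_modul.

(** * The form domain *)

Section energy_space.
Context {R : realType} {n : nat}.
Local Open Scope complex_scope.
Local Notation E := 'rV[R]_n.
Local Notation mu := (@lebesgue_rV R n).
Local Notation Re := (@complex.Re R).
Local Notation Im := (@complex.Im R).
Variables (Om : set E) (V : R).
Hypotheses (mOm : measurable Om) (OmV : mu Om = V%:E).

Lemma L12_Lfun (v : E -> R) : L12 v -> v \in Lfun mu 2%:E.
Proof.
move=> [v1 v2]; rewrite inE; apply/andP; split; rewrite inE /=; first exact: itg_meas v1.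
rewrite /finite_norm unlock /=.
apply: poweR_lty.
have -> : (\int[mu]_x `|(EFin \o v) x| `^ 2)%E = (\int[mu]_x (v x ^+ 2)%:E)%E.
  apply: eq_integral => x _ /=.
  by rewrite powR_mulrn// real_normK ?num_real.
exact: itg_fin_lty.
Qed.

Lemma L2_test f : test_function Om f -> L2 Om f.
Proof.
move=> tf; have [h1 h2] := CL_test tf; have [_ _ _ sO] := tf.
split; [exact: L12_Lfun|exact: L12_Lfun|].
apply: aeW => x nO; apply/eqP/negP => /negP fx; apply: nO; apply: sO.
exact: subset_closure.
Qed.

Lemma HH_test f : test_function Om f -> HH Om f.
Proof.
move=> tf; split; first exact: L2_test.
move=> eps e0; exists f => //.
have z : fourier (f \- f)%R = fun=> 0.
  apply/funext => xi; rewrite fourierE (cint_ext _ (G := fun=> 0)); last first.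
    by move=> x; rewrite /= subrr mulr0.
  by apply: complex_eq; rewrite /= /Rintegral integral0.
rewrite /norm_star z; under eq_integral do rewrite nsqE /nsq /= expr0n addr0 mulr0.
by rewrite integral0 /= sqrtr0 lte_fin.
Qed.

(** A single test function within distance 1 suffices: it has finite logarithmic energy, and so has
    the difference. *)
Lemma HH_energy f : HH Om f -> itg mu (fun xi => logw xi * nsq (fourier f xi)).
Proof.
move=> [L2f /(_ 1 ltr01)[psi tpsi hpsi]].
have [[hf _ _] _] := L2_good mOm OmV L2f.
have hp := CL_test tpsi; have [_ ip] := test_energy tpsi.
have hd := CLB hf hp.
have md := measurable_nsq (cmeas_fourier (CL_citg hd)).
have id : itg mu (fun xi => logw xi * nsq (fourier (fun x => f x - psi x) xi)).
  apply: itg_lty.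
  - by apply: measurable_funM => //; exact: measurable_logw.
  - by move=> xi; rewrite mulr_ge0 ?logw_ge0 ?nsq_ge0.
  have e : norm_star (f \- psi)%R =
      sqrte (\int[mu]_xi (logw xi * nsq (fourier (fun x => f x - psi x) xi))%:E)%E.
    by congr sqrte; apply: eq_integral => xi _; rewrite nsqE.
  by move: hpsi; rewrite e; case: (integral _ _ _) => [s| |] //=; rewrite ltry.
apply: (itg_le _ _ (itgD (itgZ 2 id) (itgZ 2 ip))).
  apply: measurable_funM; first exact: measurable_logw.
  exact: measurable_nsq (cmeas_fourier (CL_citg hf)).
move=> xi; rewrite normrM (ger0_norm (logw_ge0 _)) (ger0_norm (nsq_ge0 _)).
rewrite !(mulrCA 2) -mulrDr; apply: ler_wpM2l; first exact: logw_ge0.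
apply: le_trans (nsqD_le _ _).
by rewrite fourierB ?subrK//; exact: CL_citg.
Qed.

End energy_space.

(** * The Tauberian step *)

Section tauber.
Context {R : realType}.

(** Equivalent to e^x (1 - x) <= 1, which is e^(-x) >= 1 - x; the next bound comes likewise from e^x
    >= 1 + x. *)
Lemma expR_diff_le (x : R) : 0 <= x -> x < 1 -> (expR x - 1) * (1 - x) <= x.
Proof.
move=> x0 x1.
have h : expR x * (1 - x) <= 1.
  have := expR_ge1Dx (- x); rewrite -(ler_pM2l (expR_gt0 x)) => /le_trans; apply.
  by rewrite expRN mulfV// gt_eqF ?expR_gt0.
by move: h; move: (expR x) => e h; nra.
Qed.

Lemma expRN_diff_ge (x : R) : 0 <= x -> x <= (1 - expR (- x)) * (1 + x).
Proof.
move=> x0.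
have h : expR (- x) * (1 + x) <= 1.
  have := expR_ge1Dx x; rewrite -(ler_pM2l (expR_gt0 (- x))) => /le_trans; apply.
  by rewrite expRN mulVf// gt_eqF ?expR_gt0.
by move: h; move: (expR (- x)) => e h; nra.
Qed.

Lemma tauber_step (kap eta : R) : 0 <= kap -> 0 < eta ->
  (* The step x = eta / (kap + 2 eta) used below makes x (kap + eta) <= eta, which absorbs the
     denominators 1 - x and 1 + x of the two exponential bounds. *)
  exists2 x : R, 0 < x & kap * (expR x - 1) <= (kap + eta) * x /\
     (kap - eta) * x <= kap * (1 - expR (- x)).
Proof.
move=> k0 e0; pose D := kap + eta + eta; have D0 : 0 < D by rewrite /D; lra.
pose x := eta / D; have x0 : 0 < x by rewrite divr_gt0.
have xD : x * (kap + eta + eta) = eta by rewrite /x divfK// gt_eqF.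
have x1 : x < 1 by rewrite /x ltr_pdivrMr// mul1r /D; lra.
exists x => //; split.
  have h1 := expR_diff_le (ltW x0) x1.
  have x1' : 0 < 1 - x by rewrite subr_gt0.
  rewrite -(ler_pM2r x1') -mulrA; apply: le_trans (ler_wpM2l k0 h1) _.
  rewrite -subr_ge0; have -> : (kap + eta) * x * (1 - x) - kap * x = x * (eta - x * (kap + eta)) by ring.
  apply: mulr_ge0; first exact: ltW.
  by have : 0 <= x * eta; [rewrite mulr_ge0// ltW|rewrite -{2}xD; lra].
have h1 := expRN_diff_ge (ltW x0).
have x1' : 0 < 1 + x by rewrite addr_gt0.
rewrite -(ler_pM2r x1') -(mulrA kap); apply: le_trans (ler_wpM2l k0 h1).
rewrite -subr_ge0; have -> : kap * x - (kap - eta) * x * (1 + x) = x * (eta - x * kap + x * eta) by ring.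
apply: mulr_ge0; [exact: ltW|]; have : 0 <= x * eta by rewrite mulr_ge0// ltW.
by move: xD; rewrite !mulrDr; lra.
Qed.

(** A difference quotient of S with fixed step h = x / n bounds N on either side. As the upper bound
    on S holds at every level, the asymptotic lower bound is invoked at l only. Half of eps pays for
    the finite step, half for the error in that lower bound. *)
Lemma tauber (N S : R -> R) (kap n : R) : 0 < n -> 0 <= kap ->
  (forall l h, 0 <= h -> h * N l <= S (l + h) - S l) ->
  (forall l h, 0 <= h -> S l - S (l - h) <= h * N l) ->
  (forall l, S l <= kap / n * expR (n * l)) ->
  (forall del, 0 < del -> \forall l \near +oo, (kap / n - del) * expR (n * l) <= S l) ->
  expR (- (n * l)) * N l @[l --> +oo] --> kap.
Proof.
move=> n0 k0 h1 h2 up low; apply/cvgrPdist_le => eps e0.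
have eta0 : 0 < eps / 2 by rewrite divr_gt0.
have [x x0 [b1 b2]] := tauber_step k0 eta0.
set eta := eps / 2 in eta0 b1 b2; pose h := x / n; have hh : 0 < h by rewrite divr_gt0.
have nh : n * h = x by rewrite /h mulrC divfK// gt_eqF.
near=> l.
(* The error is taken proportional to h because it gets divided by h. *)
have lo : (kap / n - h * eta) * expR (n * l) <= S l.
  by near: l; apply: low; rewrite mulr_gt0.
have u1 := up (l + h); have u2 := up (l - h).
have s1 := h1 l h (ltW hh); have s2 := h2 l h (ltW hh).
rewrite mulrDr nh expRD in u1; rewrite mulrBr nh expRD in u2.
set e := expR (n * l) in lo u1 u2; have ee : 0 < e by exact: expR_gt0.
rewrite expRN -/e distrC ler_distl (mulrC e^-1).
apply/andP; split.
  rewrite ler_pdivlMr// -(ler_pM2l hh).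
  apply: le_trans s2; apply: le_trans (lerB lo u2).
  have -> : h * ((kap - eps) * e) = ((kap - eta) * x - eta * x) / n * e.
    by rewrite /h (_ : eps = eta + eta); [ring|rewrite /eta; field].
  have -> : (kap / n - h * eta) * e - kap / n * (e * expR (- x)) =
    (kap * (1 - expR (- x)) - eta * x) / n * e by rewrite /h; ring.
  by rewrite ler_pM2r// ler_pM2r ?invr_gt0// lerD2r.
rewrite ler_pdivrMr// -(ler_pM2l hh); apply: le_trans s1 _; apply: le_trans (lerB u1 lo) _.
have -> : h * ((kap + eps) * e) = ((kap + eta) * x + eta * x) / n * e.
  by rewrite /h (_ : eps = eta + eta); [ring|rewrite /eta; field].
have -> : kap / n * (e * expR x) - (kap / n - h * eta) * e =
  (kap * (expR x - 1) + eta * x) / n * e by rewrite /h; ring.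
by rewrite ler_pM2r// ler_pM2r ?invr_gt0// lerD2r.
Unshelve. all: by end_near. Qed.

Lemma expR_decay1 (l : R) : 0 < l -> expR (- (l / 2)) <= 2 / l.
Proof.
move=> l0; rewrite expRN -[leRHS]invrK lef_pV2 ?posrE ?expR_gt0 ?invr_gt0 ?divr_gt0//.
by rewrite invf_div; apply: le_trans (expR_ge1Dx _); rewrite lerDr.
Qed.

(** Splits e^(-l/2) into two factors e^(-l/4), each at most 4 / l. *)
Lemma expR_decay2 (l : R) : 0 < l -> l / 2 * expR (- (l / 2)) <= 8 / l.
Proof.
move=> l0; have l20 : 0 < l / 2 by rewrite divr_gt0.
have h := expR_decay1 l20.
have -> : - (l / 2) = - (l / 2 / 2) + - (l / 2 / 2) by field.
rewrite expRD.
have e0 := expR_ge0 (- (l / 2 / 2)).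
have h2 : expR (- (l / 2 / 2)) * expR (- (l / 2 / 2)) <= 2 / (l / 2) * (2 / (l / 2)).
  by apply: ler_pM.
apply: le_trans (ler_wpM2l (ltW l20) h2) _.
rewrite le_eqVlt; apply/orP; left; apply/eqP; field.
by rewrite gt_eqF.
Qed.

End tauber.

Lemma counting_lt (R : realType) (lam : nat -> R) (l : R) (N : nat) :
  (forall k, (k < N)%N = (lam k < l)) -> counting_function lam l = (N%:R)%:E.
Proof.
move=> hN; rewrite /counting_function (_ : [set k | lam k < l] = `I_N); last first.
  by apply/seteqP; split => k /=; rewrite hN.
rewrite /counting asboolT//.
rewrite fset_set_II finmap.card_imfset /=; last exact: val_inj.
by rewrite -cardE card_ord.
Qed.

Lemma count_exists (R : realType) (lam : nat -> R) :
  {homo lam : j k / (j <= k)%N >-> j <= k} -> lam @ \oo --> +oo ->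
  forall l, exists N : nat, forall k, (k < N)%N = (lam k < l).
Proof.
move=> hm /cvgryPge hy l.
have [K _ hK] := hy l.
have exK : exists k, l <= lam k by exists K; apply: hK => /=.
exists (ex_minn exK); case: ex_minnP => m hm1 hm2 k.
apply/idP/idP; first by move=> km; rewrite ltNge; apply/negP => /hm2; rewrite leqNgt km.
by move=> kl; rewrite ltnNge; apply/negP => /hm; rewrite leNgt (lt_le_trans kl).
Qed.

(** * Weyl's law *)

(** Here e = e^(n l), x = e^(n l / 2), q = e^(-l/2), hl = l / 2, li = 1 / l, ni = 1 / n, P = (2
    pi)^(-n), W is the squared norm of the window and M its first moment; the three losses are
    bounded one by one. *)
Lemma window_final (R : realFieldType) (W B P ni M e q x hl li : R) :
  0 <= W -> 0 <= B -> 0 <= P -> 0 <= ni -> 0 <= M -> 0 <= e -> 0 <= hl ->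
  x <= e * q -> q <= 2 * li -> hl * q <= 8 * li ->
  (W * B * P * ni - P * B * (8 * W + 2 * W * ni + 2 * M * P) * li) * e <=
  P * (W * (e * ni * B) - W * hl * (x * B) - W * (x * ni * B) - M * P * q * (e * B)).
Proof.
move=> W0 B0 P0 ni0 M0 e0 hl0 xe ql hql.
have t1 : 0 <= 8 * li * e - hl * x.
  rewrite subr_ge0; apply: le_trans (ler_wpM2l hl0 xe) _.
  by rewrite mulrCA mulrC ler_wpM2r.
have t3 : 0 <= 2 * li * e - q * e by rewrite subr_ge0 ler_wpM2r.
have t2 : 0 <= 2 * li * e - x by rewrite subr_ge0; apply: le_trans xe _; rewrite mulrC -subr_ge0.
rewrite -subr_ge0.
have -> : P * (W * (e * ni * B) - W * hl * (x * B) - W * (x * ni * B) - M * P * q * (e * B)) -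
    (W * B * P * ni - P * B * (8 * W + 2 * W * ni + 2 * M * P) * li) * e =
  P * W * B * (8 * li * e - hl * x) + P * W * B * ni * (2 * li * e - x) +
  P * P * M * B * (2 * li * e - q * e) by ring.
by rewrite !addr_ge0// !mulr_ge0.
Qed.

Section weyl.
Context {R : realType} {n : nat}.
Local Open Scope complex_scope.
Local Notation E := 'rV[R]_n.
Local Notation mu := (@lebesgue_rV R n).
Local Notation Re := (@complex.Re R).
Local Notation Im := (@complex.Im R).
Local Notation B := (@volB R n).

(** Strict positivity is what makes |Om| an admissible bound M in [wform_cs]. *)
Lemma open_measure_gt0 (Om : set E) : open Om -> Om !=set0 -> (0 < mu Om)%E.
Proof.
move=> oOm nOm; have [c [r [r0 cO _]]] := open_cube_cover oOm nOm.
pose a i := c 0%N ord0 i - r 0%N; pose b i := c 0%N ord0 i + r 0%N.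
have sub : obox a b `<=` Om.
  move=> y hy; apply: (cO 0%N) => i; have := hy i; rewrite /= in_itv /= => /andP[h1 h2].
  by rewrite ler_distl !ltW.
have ob : (0 < mu (obox a b))%E.
  rewrite (@lebesgue_rV_box R n (fun i => `]a i, b i[%classic))//.
  apply: (big_ind (fun x : \bar R => (0 < x)%E)) => [|x y x0 y0|i _].
  - by rewrite lte_fin ltr01.
  - exact: mule_gt0.
  have ab : a i < b i by rewrite /a /b ltrD2l gtrN.
  by rewrite lebesgue_measure_itv /= lte_fin ab -EFinD lte_fin subr_gt0.
apply: lt_le_trans ob _; apply: le_measure sub; rewrite inE.
  exact: measurable_obox.
exact: open_measurable_rV.
Qed.

Lemma log_form_wform (f g : E -> R[i]) :
  log_form f g = ((2 * pi) ^- n)%:C * wform mu wl (fourier f) (fourier g).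
Proof. by []. Qed.

Lemma log_form_solve (f g : E -> R[i]) (a : R) z : log_form f g = a%:C * z ->
  wform mu wl (fourier f) (fourier g) = ((2 * pi) ^+ n * a)%:C * z.
Proof.
rewrite log_form_wform => h; rewrite rmorphM -mulrA -h mulrA -rmorphM mulfV ?mul1r//.
by rewrite expf_neq0// mulf_neq0 ?gt_eqF ?pi_gt0.
Qed.

Lemma wl_le_logw (xi : E) : wl xi <= logw xi.
Proof.
have [s0|s0] := ltP 0 (enorm xi); last by rewrite /wl (ln0 s0) logw_ge0.
have e0 := expR_gt0 (1 : R).
by rewrite /wl /logw ler_ln ?posrE ?addr_gt0// lerDr ltW.
Qed.

Lemma measure_finE (Om : set E) : (mu Om < +oo)%E -> mu Om = (fine (mu Om))%:E.
Proof. by move=> h; rewrite fineK// ge0_fin_numE. Qed.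

Variables (Om : set E) (lam : nat -> R).
Hypotheses (n0 : (0 < n)%N) (nOm : Om !=set0) (oOm : open Om) (fOm : (mu Om < +oo)%E).
Hypothesis ev : eigenvalue_sequence Om lam.

Let V := fine (mu Om).
Let mOm : measurable Om := open_measurable_rV oOm.
Let OmV : mu Om = V%:E := measure_finE fOm.
Let V0 : 0 < V.
Proof. by rewrite -lte_fin -OmV open_measure_gt0. Qed.
Let p : R := (2 * pi) ^+ n.
Let p0 : 0 < p.
Proof. by rewrite exprn_gt0// mulr_gt0// pi_gt0. Qed.

(** Translates the eigenvalue sequence into identities between weighted forms, the factor (2
    pi)^(-n) of the logarithmic form being moved to the eigenvalue. *)
Lemma eigen_data : exists phi : nat -> E -> R[i],
  [/\ forall k, good Om (phi k) /\ wsq mu wl (fourier (phi k)),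
   forall j k, wform mu (w1 Om) (phi j) (phi k) = (j == k)%:R,
   forall f, L2 Om f -> forall eps : R, 0 < eps ->
     exists m (b : nat -> R[i]), wq mu (w1 Om) (resid f b phi m) < eps,
   forall k f, HH Om f -> wform mu wl (fourier (phi k)) (fourier f) =
     (p * lam k)%:C * wform mu (w1 Om) (phi k) f &
   (forall j k, wform mu wl (fourier (phi j)) (fourier (phi k)) = (p * lam j)%:C * (j == k)%:R) /\
   forall k, \int[mu]_x nsq (phi k x) = 1].
Proof.
have [_ _ _ [phi [[L2p op cp] ep]]] := ev.
have Hp k : HH Om (phi k) by have [] := ep k.
have gp k : good Om (phi k) := (L2_good mOm OmV (L2p k)).1.
have ow j k : wform mu (w1 Om) (phi j) (phi k) = (j == k)%:R by rewrite -L2dot_wform.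
have lf k f : HH Om f -> wform mu wl (fourier (phi k)) (fourier f) =
     (p * lam k)%:C * wform mu (w1 Om) (phi k) f.
  move=> hf; have [_ _ /(_ f hf)] := ep k; rewrite L2dot_wform; exact: log_form_solve.
have wp k : wsq mu (w1 Om) (phi k) by have [] := gp k.
exists phi; split => //.
- move=> k; split => //; apply: (wsq_wl mOm V0 OmV n0 (gp k) logw_ge0 wl_le_logw).
  exact: (HH_energy mOm OmV).
- move=> f Lf eps e0; have [m [c hc]] := cp f Lf eps e0.
  (* Coefficients indexed by m positions become a sequence, extended by 0. *)
  pose b k := if insub k is Some i then c i else 0.
  exists m, b; have [gf _] := L2_good mOm OmV Lf.
  have [_ [_ ir] _] := good_resid mOm OmV b m gf gp.
  rewrite -lte_fin -(itg_fin ir); apply: le_lt_trans hc.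
  rewrite [leRHS]integral_mkcond le_eqVlt; apply/orP; left; apply/eqP.
  apply: eq_integral => x _; rewrite patchE /w1 indicE; case: ifP => xO.
    rewrite mul1r nsqE /resid; congr (nsq (_ - _))%:E.
    by apply: eq_bigr => k _; rewrite /b valK.
  by rewrite mul0r.
- split; first by move=> j k; rewrite lf// ow.
  move=> k; rewrite (L2_good mOm OmV (L2p k)).2.
  have := ow k k; rewrite eqxx wform_diag; last exact: wp.
  by move/complexI.
Qed.

Let count_ex l := cid (count_exists (let: And4 _ h _ _ := ev in h) (let: And4 _ _ h _ := ev in h) l).
Let N l := projT1 (count_ex l).
Let hN l : forall k, (k < N l)%N = (lam k < l) := projT2 (count_ex l).
Let S l : R := \sum_(k < N l) (l - lam k).

Let S_ge l m : \sum_(k < m) (l - lam k) <= S l.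
Proof.
have := @sum_pos_part R lam l (N l) (hN l) (fun=> 1) m (fun=> ler01).
by under eq_bigr do rewrite mulr1; under [leRHS]eq_bigr do rewrite mulr1.
Qed.

(** Keeping N(l) terms at level l + h costs S(l + h) at most, by [S_ge]; with h and with - h this
    yields both difference inequalities of the Tauberian step. *)
Let S_shift l h : \sum_(k < N l) (l + h - lam k) = S l + h * (N l)%:R.
Proof.
under eq_bigr do rewrite addrAC.
by rewrite big_split /= sumr_const card_ord mulr_natr.
Qed.

Let kap := p^-1 * V * B.

Let kap_ge0 : 0 <= kap.
Proof. by rewrite !mulr_ge0 ?volB_ge0 ?invr_ge0 ?(ltW p0) ?(ltW V0). Qed.

Let S_upper l : S l <= kap / n%:R * expR (n%:R * l).
Proof.
have [phi [gp op _ _ [lp np]]] := eigen_data.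
have h := riesz_upper mOm OmV (fun k => (gp k).1) (fun k => (gp k).2) op lp np l (N l) n0.
rewrite -(ler_pM2l p0); apply: le_trans h _.
rewrite -/p /kap le_eqVlt; apply/orP; left; apply/eqP; field.
by rewrite pnatr_eq0 -lt0n n0 gt_eqF.
Qed.

Lemma window_limit : exists W : nat -> E -> R,
  (forall m, is_window Om (W m)) /\ nrm2 (W m) @[m --> \oo] --> V.
Proof.
have [W [wW cW]] := window_exists oOm nOm; exists W; split => //.
have Wout m x : ~ Om x -> W m x = 0.
  move=> nO; apply/eqP/negP => /negP Wx; apply: nO.
  by have [_ _ _ sub] := wW m; apply: sub; exact: subset_closure.
rewrite -(int_w1 mOm OmV); apply: (dominated_Rint (g := w1 Om)).
- move=> m; apply: measurable_funX; apply: continuous_measurable_rV.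
  by apply: nice_continuous; have [] := wW m.
- exact: measurable_w1.
- move=> x; rewrite /w1 indicE; have [Ox|nO] := pselect (Om x).
    rewrite mem_set//= -[X in _ --> X](mulr1 1); under eq_fun do rewrite expr2.
    by apply: cvgM; exact: cW.
  by rewrite memNset//=; under eq_fun do rewrite Wout// expr0n; exact: cvg_cst.
- exact: itg_w1 OmV.
- move=> m x; rewrite /w1 indicE; have [Ox|nO] := pselect (Om x).
    have [_ /(_ x)/andP[u0 u1] _ _] := wW m.
    by rewrite mem_set//= normrX exprn_ile1// ger0_norm.
  by rewrite memNset//= Wout// expr0n normr0.
Qed.

(** [riesz_lower] at a = l / 2, which makes all the losses O(e^(n l) / l) with a constant depending
    on u. *)
Lemma window_lower u : is_window Om u -> exists C : R, forall l, 0 < l ->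
  (nrm2 u * B / p / n%:R - C / l) * expR (n%:R * l) <= S l.
Proof.
move=> wu; have [nu u01 cu uO] := wu.
have [phi [gp op cp lf [lp np]]] := eigen_data.
have tu := test_window wu.
have Lu : L12 u by have [h _] := CL_test tu.
have [iM _] := test_energy tu.
have su x : u x = w1 Om x * u x.
  have [->|ux] := eqVneq (u x) 0; first by rewrite mulr0.
  rewrite /w1 indicE mem_set ?mul1r//; apply: uO.
  exact: subset_closure.
have u1 x : `|u x| <= 1 by have /andP[h1 h2] := u01 x; rewrite ger0_norm.
have lm xi k := lf k _ (HH_test (test_modul wu xi)).
have cm xi := cp _ (L2_test (test_modul wu xi)).
have lo := fun l l0 a => @riesz_lower R n Om V mOm V0 OmV phi lam (fun k => (gp k).1) (fun k => (gp k).2)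
  op lp np l (N l) l0 (hN l) u Lu su u1 iM lm cm a n0.
set M := \int[mu]_eta _ in lo; have M0 : 0 <= M.
  by apply: Rintegral_ge0 => x _; rewrite mulr_ge0 ?enorm_ge0// nsq_ge0.
have W0 : 0 <= nrm2 u by apply: Rintegral_ge0 => x _; exact: sqr_ge0.
exists (p^-1 * B * (8 * nrm2 u + 2 * nrm2 u / n%:R + 2 * M / p)) => l l0.
have l20 : 0 <= l / 2 by rewrite divr_ge0// ltW.
have ll : l / 2 <= l by rewrite ler_pdivrMr// mulr_natr mulr2n lerDl ltW.
have := lo l (ltW l0) (l / 2) l20 ll; rewrite -/p -/(S l) -(ler_pM2l (_ : 0 < p^-1)) ?invr_gt0// mulKf ?gt_eqF//.
apply: le_trans.
have d1 := expR_decay1 l0; have d2 := expR_decay2 l0.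
(* Since n >= 1, the discarded ball gains a factor e^(-l/2) over the full one. *)
have e1 : expR (n%:R * (l / 2)) <= expR (n%:R * l) * expR (- (l / 2)).
  rewrite -expRD ler_expR -subr_ge0.
  have -> : n%:R * l - l / 2 - n%:R * (l / 2) = (n%:R - 1) * (l / 2) by field.
  by rewrite mulr_ge0// subr_ge0 ler1n.
have l2E : l - l / 2 = l / 2 by field.
rewrite expRN in d1 d2 e1; rewrite l2E.
have li0 : 0 <= l^-1 by rewrite invr_ge0 ltW.
have P0 : 0 <= p^-1 by rewrite invr_ge0 ltW.
have ni0 : 0 <= n%:R^-1 :> R by rewrite invr_ge0.
exact: (window_final W0 (@volB_ge0 R n) P0 ni0 M0 (expR_ge0 _) l20 e1 d1 d2).
Qed.

(** Order of choices: first a window whose squared norm is close enough to |Om| to cost del / 2,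
    then l so large that C / l, with C belonging to that window, costs the other half. *)
Let S_lower del : 0 < del -> \forall l \near +oo, (kap / n%:R - del) * expR (n%:R * l) <= S l.
Proof.
move=> d0; have [W [wW cW]] := window_limit.
have cW' : nrm2 (W m) * B / p / n%:R @[m --> \oo] --> kap / n%:R.
  have -> : kap / n%:R = V * B / p / n%:R by rewrite /kap; ring.
  by apply: cvgMl; apply: cvgMl; apply: cvgMl.
have del2 : 0 < del / 2 by rewrite divr_gt0.
move/cvgrPdist_le : cW' => /(_ _ del2)[m _ /(_ m (leqnn m)) hm].
have [C hC] := window_lower (wW m).
near=> l.
have l0 : 0 < l by near: l; exact: nbhs_pinfty_gt.
have Cl : C / l <= del / 2.
  rewrite ler_pdivrMr// -ler_pdivrMl//; near: l; exact: nbhs_pinfty_ge.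
apply: le_trans (hC l l0); apply: ler_wpM2r; first exact: expR_ge0.
move: hm; rewrite /= ler_norml => /andP[_ hm].
have := lerD hm Cl; rewrite -splitr; lra.
Unshelve. all: by end_near. Qed.

Lemma weyl_law : expR (- (n%:R * l)) * (N l)%:R @[l --> +oo] --> kap.
Proof.
apply: (@tauber R (fun l => (N l)%:R) S kap n%:R) => //.
- by rewrite ltr0n.
- by move=> l h h0; rewrite lerBrDl -S_shift S_ge.
- move=> l h h0; rewrite lerBlDr (addrC (h * _)) -lerBlDr -mulNr -S_shift.
  exact: S_ge.
Qed.

Lemma weyl_law_counting :
  ((expR (- (n%:R * l)))%:E * counting_function lam l)%E @[l --> +oo] -->
  (((2 * pi) ^- n)%:E * mu Om * mu (@unit_ball R n))%E.
Proof.
rewrite OmV (@ball_volumeE R n) -!EFinM.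
apply: cvg_EFin.
  by near=> l; rewrite (counting_lt (hN l)).
rewrite (_ : _ \o _ = fun l => expR (- (n%:R * l)) * (N l)%:R); first exact: weyl_law.
by apply/funext => l; rewrite /= (counting_lt (hN l)).
Unshelve. all: by end_near. Qed.

End weyl.

Theorem corollary6p2 (R : realType) (d : nat) (Omega : set 'rV[R]_d)
    (lambda : nat -> R) :
  (0 < d)%N -> Omega !=set0 -> open Omega ->
  (lebesgue_rV d Omega < +oo)%E ->
  eigenvalue_sequence Omega lambda ->
  ((expR (- (d%:R * l)))%:E * counting_function lambda l)%E @[l --> +oo%R] -->
  (((2 * pi) ^- d)%:E * lebesgue_rV d Omega * lebesgue_rV d unit_ball)%E.
Proof. exact: weyl_law_counting. Qed.
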